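(* Let $\tau$ be a pseudo-spherical representation of $\widetilde T_0$, and let $\pi$ be a smooth irreducible $\widetilde T$-module. The $\tau$-isotypic subspace of $\pi|_{\widetilde T_0}$ is nonzero if and only if $\pi\cong i_{\eta,\tau}(\chi)$ for some unramified character $\chi:T\to\mathbb{C}^\times$.
   Context: $F$ is a finite extension of $\mathbb{Q}_2$ with ring of integers $\mathcal{O}$ and uniformizer $\varpi$. $(-,-)$ is the quadratic Hilbert symbol of $F$. $G$ is the group of $F$-points of an almost simple simply-connected split (Chevalley) group with irreducible simply-laced root system $\Phi$ (relative to a split maximal torus $T$) of rank at least $2$, with simple roots $\Delta=\{\alpha_1,\dots,\alpha_r\}$, Weyl group $W$ and cocharacter lattice $Y=\mathbb{Z}[\Phi^\vee]$. $x_\alpha(t)$ are the Chevalley generators, $w_\alpha(t)=x_\alpha(t)x_{-\alpha}(-t^{-1})x_\alpha(t)$, $h_\alpha(t)=w_\alpha(t)w_\alpha(-1)$. $\widetilde{G}$ is the unique nontrivial topological central extension $1\to\mu_2\to\widetilde{G}\xrightarrow{\mathrm{pr}}G\to1$; it is generated by $\mu_2$ and lifts $\tilde{x}_\alpha(t)$ of $x_\alpha(t)$ with relations $\tilde x_\alpha(t)\tilde x_\alpha(u)=\tilde x_\alpha(t+u)$; for $\alpha+\beta\ne0$, $[\tilde x_\alpha(t),\tilde x_\beta(u)]=\tilde x_{\alpha+\beta}(ctu)$ if $\alpha+\beta\in\Phi$ (with $c=c(\alpha,\beta)\in\{\pm1\}$ as in $G$) and $1$ otherwise; $\tilde h_\alpha(t)\tilde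 h_\alpha(u)=(t,u)\tilde h_\alpha(tu)$, where $\tilde w_\alpha(t)=\tilde x_\alpha(t)\tilde x_{-\alpha}(-t^{-1})\tilde x_\alpha(t)$, $\tilde h_\alpha(t)=\tilde w_\alpha(t)\tilde w_\alpha(-1)$. For $H\subseteq G$, $\widetilde{H}=\mathrm{pr}^{-1}(H)$. A representation is genuine if $-1\in\mu_2$ acts by $-1$. $T_0=\langle h_\alpha(u):u\in\mathcal{O}^\times,\alpha\in\Phi\rangle$. $R=\{a\in\mathcal{O}^\times:(a,b)=1\ \forall b\in\mathcal{O}^\times\}$ and $T_R=\langle h_\alpha(a):a\in R,\alpha\in\Phi\rangle$, regarded as a subgroup of $\widetilde{T}_0$ via $\prod_i h_{\alpha_i}(a_i)\mapsto\prod_i\tilde h_{\alpha_i}(a_i)$. A pseudo-spherical representation of $\widetilde{T}_0$ is an irreducible genuine representation trivial on $T_R$. $\widetilde Y=\{y\in Y:\langle\alpha,y\rangle\in2\mathbb{Z}\ \forall\alpha\in\Phi\}$. For $y=\sum_ic_i\alpha_i^\vee\in\widetilde Y$ put $\tilde y(\varpi)=\prod_i\tilde h_{\alpha_i}(\varpi^{c_i})$ (independent of the order). $\mu_2\widetilde Y(\varpi)$ is the subgroup generated by $\mu_2$ and the $\tilde y(\varpi)$, $y\in\widetilde Y$; it lies in the center $Z(\widetilde T)$, and $Z(\widetilde T)\widetilde T_0=\mu_2\widetilde Y(\varpi)\cdot\widetilde T_0$ with $\mu_2\widetilde Y(\varpi)\cap\widetilde T_0=\mu_2$. Fix a genuine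 $W$-invariant character $\eta:\mu_2\widetilde Y(\varpi)\to\mathbb{C}^\times$ trivial on the elements $\tilde h_\alpha(\varpi^2)$, $\alpha\in\Phi$. Then $\tau_\eta=\eta\otimes\tau$ descends to a representation of $Z(\widetilde T)\widetilde T_0$, and for an unramified character $\chi:T\to\mathbb{C}^\times$ (i.e. trivial on $T_0$, pulled back to $\widetilde T$), $i_{\eta,\tau}(\chi)=\chi\otimes\mathrm{Ind}_{Z(\widetilde T)\widetilde T_0}^{\widetilde T}\tau_\eta$. *)

(* Defs.v *)
From HB Require Import structures.
From mathcomp Require Import all_boot all_order all_algebra all_field.
From mathcomp Require Import complex.
From mathcomp Require Import all_classical all_reals all_analysis.

Set Implicit Arguments.
Unset Strict Implicit.
Unset Printing Implicit Defensive.

Import Order.TTheory GRing.Theory Num.Theory.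
Local Open Scope classical_set_scope.
Local Open Scope ring_scope.

HB.mixin Record isTopologicalGroup (G : Type) & Group G & Topological G := {
  mulg_continuous : continuous (fun p : G * G => (p.1 * p.2)%g);
  invg_continuous : continuous (fun x : G => (x^-1)%g) }.

#[short(type="topologicalGroupType")]
HB.structure Definition TopologicalGroup :=
  { G of Group G & Topological G & isTopologicalGroup G }.

(* The operations are arguments because this is used both inside a groupType
   and inside the multiplicative monoid of a matrix ring. *)
Definition generated (M : Type) (one : M) (mul : M -> M -> M) (inv : M -> M)
    (S : set M) : set M :=
  smallest [set A | [/\ A one, (forall x y, A x -> A y -> A (mul x y))
                      & (forall x, A x -> A (inv x))]] S.

Section DyadicField.
Variables (R : realType) (Q2 : fieldType) (abs2 : Q2 -> R).

Definition rat_abs2 (q : rat) : R :=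
  if q == 0 then 0
  else 2 ^ ((logn 2 `|denq q|%N)%:Z - (logn 2 `|numq q|%N)%:Z).

(* Q2 is the completion of the rationals for the 2-adic absolute value. *)
Record is_Q2 : Prop := IsQ2 {
  abs2_ge0 : forall x, 0 <= abs2 x;
  abs2_eq0 : forall x, abs2 x = 0 <-> x = 0;
  abs2M : forall x y, abs2 (x * y) = abs2 x * abs2 y;
  abs2D : forall x y, abs2 (x + y) <= abs2 x + abs2 y;
  abs2_rat : forall q : rat, abs2 (ratr q) = rat_abs2 q;
  abs2_dense : forall (x : Q2) (e : R), 0 < e ->
    exists q : rat, abs2 (x - ratr q) < e;
  abs2_complete : forall u : nat -> Q2,
    (forall e : R, 0 < e -> exists n0 : nat, forall m n : nat,
       (n0 <= m)%N -> (n0 <= n)%N -> abs2 (u m - u n) < e) ->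
    exists l, forall e : R, 0 < e -> exists n0 : nat, forall n : nat,
       (n0 <= n)%N -> abs2 (u n - l) < e }.

Variable F : fieldExtType Q2.

(* Integral closure in F of the ring of 2-adic integers. *)
Definition integers : set F := [set x | exists p : {poly Q2},
  [/\ p \is monic, (forall i, abs2 p`_i <= 1)
    & root (map_poly (in_alg F) p) x]].

Definition int_units : set F :=
  [set x | [/\ x != 0, integers x & integers x^-1]].

Definition is_uniformizer (varpi : F) : Prop :=
  [/\ varpi != 0, integers varpi, ~ int_units varpi
    & forall x, integers x -> ~ int_units x ->
        exists2 y, integers y & x = varpi * y].

(* hilbert a b is true when the quadratic Hilbert symbol (a, b) is 1. *)
Definition hilbert (a b : F) : bool :=
  `[< exists x y z : F, (x, y, z) <> (0, 0, 0) /\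
        z ^+ 2 = a * x ^+ 2 + b * y ^+ 2 >].

Definition hilbert_radical : set F :=
  [set a | int_units a /\ forall b, int_units b -> hilbert a b].

(* The sets [congruent1 varpi N m], for varying m, are a fundamental system of
   neighborhoods of 1 in the topology of matrices over F. *)
Definition congruent1 (varpi : F) (N m : nat) : set 'M[F]_N.+1 :=
  [set g | forall i j, exists2 a, integers a &
     g i j - (i == j)%:R = varpi ^+ m * a].

End DyadicField.

Section RootSystem.
Variables (R : realType) (r : nat).
Implicit Types (a b v : 'rV[R]_r) (Phi : seq 'rV[R]_r).

Definition dot a b : R := (a *m b^T) 0 0.

Definition coroot a : 'rV[R]_r := (2 / dot a a) *: a.

(* The pairing of v with the coroot of a. *)
Definition cartan v a : R := dot v (coroot a).

(* (Reduced, crystallographic) root system spanning R^r, hence of rank r. *)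
Record is_root_system Phi : Prop := IsRootSystem {
  roots_span : (<<Phi>> = fullv)%VS;
  roots_neq0 : 0 \notin Phi;
  roots_refl : forall a b, a \in Phi -> b \in Phi ->
    b - cartan b a *: a \in Phi;
  roots_int : forall a b, a \in Phi -> b \in Phi -> cartan b a \is a Num.int;
  roots_reduced : forall (k : R) a, a \in Phi -> k *: a \in Phi ->
    k = 1 \/ k = -1 }.

Definition irreducible_roots Phi : Prop := forall A : set 'rV[R]_r,
  (exists2 a, a \in Phi & A a) -> (exists2 b, b \in Phi & ~ A b) ->
  exists a b, [/\ a \in Phi, b \in Phi, A a, ~ A b & dot a b != 0].

(* For an irreducible root system: all roots have the same length. *)
Definition simply_laced Phi : Prop :=
  forall a b, a \in Phi -> b \in Phi -> dot a a = dot b b.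

Definition is_base Phi (Delta : 'I_r -> 'rV[R]_r) : Prop :=
  [/\ forall i, Delta i \in Phi,
      free (codom Delta)
    & forall a, a \in Phi -> exists k : 'I_r -> nat,
        a = \sum_i (k i)%:R *: Delta i \/ a = - \sum_i (k i)%:R *: Delta i].

Definition Zspan (S : set 'rV[R]_r) : set 'rV[R]_r :=
  [set v | exists (n : nat) (k : 'I_n -> int) (s : 'I_n -> 'rV[R]_r),
     (forall i, S (s i)) /\ v = \sum_i (k i)%:~R *: s i].

Definition coroot_lattice Phi : set 'rV[R]_r :=
  Zspan [set coroot a | a in [set a | a \in Phi]].

Definition even_coroot_lattice Phi : set 'rV[R]_r :=
  [set y | coroot_lattice Phi y /\
     forall a, a \in Phi -> exists m : int, dot a y = 2 * m%:~R].

Definition weight_lattice Phi : set 'rV[R]_r :=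
  [set v | forall a, a \in Phi -> cartan v a \is a Num.int].

End RootSystem.

Section ChevalleyGroup.
Variables (R : realType) (F : fieldType) (r : nat) (Phi : seq 'rV[R]_r).
Variable (N : nat).
Implicit Types (a b : 'rV[R]_r) (t u : F).

(* The simply connected Chevalley group is built as in Steinberg's lectures,
   from a representation of the split Lie algebra, given in a basis of weight
   vectors (the j-th one having weight wt j): X a is the matrix of the root
   vector attached to a in a Chevalley basis and c gives the structure
   constants.  Simple connectedness means that the weights of the
   representation generate the whole weight lattice. *)
Definition coroot_mx (wt : 'I_N.+1 -> 'rV[R]_r) a : 'M[F]_N.+1 :=
  diag_mx (\row_j (Num.floor (cartan (wt j) a))%:~R).

Record is_chevalley_rep (wt : 'I_N.+1 -> 'rV[R]_r)
    (c : 'rV[R]_r -> 'rV[R]_r -> int) (X : 'rV[R]_r -> 'M[F]_N.+1) : Prop :=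
  IsChevalleyRep {
  chev_sign : forall a b, a \in Phi -> b \in Phi -> a + b \in Phi ->
    c a b = 1 \/ c a b = -1;
  chev_add : forall a b, a \in Phi -> b \in Phi -> a + b \in Phi ->
    X a * X b - X b * X a = (c a b)%:~R *: X (a + b);
  chev_comm : forall a b, a \in Phi -> b \in Phi -> a + b \notin Phi ->
    a + b != 0 -> X a * X b = X b * X a;
  chev_opp : forall a, a \in Phi ->
    X a * X (- a) - X (- a) * X a = coroot_mx wt a;
  chev_weight : forall a b, a \in Phi -> b \in Phi ->
    coroot_mx wt a * X b - X b * coroot_mx wt a
      = (Num.floor (cartan b a))%:~R *: X b;
  chev_wt : Zspan (range wt) = weight_lattice Phi }.

Variable X : 'rV[R]_r -> 'M[F]_N.+1.

(* exp (t X_a); the matrices X a are nilpotent of order at most N.+1. *)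
Definition xroot a t : 'M[F]_N.+1 :=
  \sum_(k < N.+1) (t ^+ k / (k`!)%:R) *: X a ^+ k.

Definition wroot a t := xroot a t * xroot (- a) (- t^-1) * xroot a t.

Definition hroot a t := wroot a t * wroot a (-1).

Definition gen_mx : set 'M[F]_N.+1 -> set 'M[F]_N.+1 :=
  generated 1 *%R GRing.inv.

Definition chevalley_group : set 'M[F]_N.+1 :=
  gen_mx [set g | exists a t, a \in Phi /\ g = xroot a t].

Definition torus_over (A : set F) : set 'M[F]_N.+1 :=
  gen_mx [set g | exists a t, [/\ a \in Phi, A t & g = hroot a t]].

Definition torus : set 'M[F]_N.+1 := torus_over [set t | t != 0].

End ChevalleyGroup.

Section Cover.
Variables (R : realType) (Q2 : fieldType) (abs2 : Q2 -> R).
Variables (F : fieldExtType Q2) (varpi : F).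
Variables (r : nat) (Phi : seq 'rV[R]_r) (N : nat).
Variables (c : 'rV[R]_r -> 'rV[R]_r -> int) (X : 'rV[R]_r -> 'M[F]_N.+1).
Variables (Gt : topologicalGroupType) (pr : Gt -> 'M[F]_N.+1) (zeta : Gt).
Variable xt : 'rV[R]_r -> F -> Gt.
Implicit Types (a b : 'rV[R]_r) (t u : F).

Local Notation G := (chevalley_group Phi X).

Definition wtilde a t : Gt := (xt a t * xt (- a)%R (- t^-1)%R * xt a t)%g.

Definition htilde a t : Gt := (wtilde a t * wtilde a (-1)%R)%g.

(* zeta is the image in the cover of the element -1 of mu_2. *)
Record is_metaplectic_cover : Prop := IsMetaplecticCover {
  cover_one : pr 1%g = 1;
  cover_mul : forall x y, pr (x * y)%g = pr x * pr y;
  cover_range : range pr = G;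
  cover_ker : forall x, pr x = 1 <-> x = 1%g \/ x = zeta;
  zeta_neq1 : zeta <> 1%g;
  zeta_sqr : (zeta * zeta)%g = 1%g;
  zeta_central : forall x, (zeta * x)%g = (x * zeta)%g;
  (* pr is a homomorphism, so its continuity, its openness onto G and the
     discreteness of its kernel can be expressed at 1 *)
  cover_continuous : forall m,
    nbhs (1%g : Gt) [set x | congruent1 abs2 varpi m (pr x)];
  cover_open : forall U : set Gt, nbhs (1%g : Gt) U -> exists m,
    G `&` congruent1 abs2 varpi m `<=` pr @` U;
  cover_discrete : nbhs (1%g : Gt) [set x | x <> zeta];
  (* the topological extension is not split *)
  cover_nontrivial : ~ exists s : 'M[F]_N.+1 -> Gt,
    [/\ forall g, G g -> pr (s g) = g,
        forall g h, G g -> G h -> s (g * h) = (s g * s h)%g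
      & forall U : set Gt, nbhs (1%g : Gt) U -> exists m,
          G `&` congruent1 abs2 varpi m `<=` s @^-1` U];
  cover_lift : forall a t, a \in Phi -> pr (xt a t) = xroot X a t;
  cover_gen : generated 1%g (fun x y : Gt => x * y)%g (fun x : Gt => x^-1)%g
      [set x | x = zeta \/ exists a t, a \in Phi /\ x = xt a t] = setT;
  xtD : forall a t u, a \in Phi -> (xt a t * xt a u)%g = xt a (t + u);
  xt_comm_add : forall a b t u, a \in Phi -> b \in Phi -> a + b \in Phi ->
    (xt a t * xt b u * (xt a t)^-1 * (xt b u)^-1)%g
      = xt (a + b) ((c a b)%:~R * t * u);
  xt_comm1 : forall a b t u, a \in Phi -> b \in Phi -> a + b \notin Phi ->
    a + b != 0 -> (xt a t * xt b u * (xt a t)^-1 * (xt b u)^-1)%g = 1%g;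
  htildeM : forall a t u, a \in Phi -> t != 0 -> u != 0 ->
    (htilde a t * htilde a u)%g =
      ((if hilbert t u then 1%g else zeta) * htilde a (t * u)%R)%g }.

Definition Ttilde : set Gt := pr @^-1` torus Phi X.

Definition T0 : set 'M[F]_N.+1 := torus_over Phi X (int_units abs2 (F := F)).

Definition T0tilde : set Gt := pr @^-1` T0.

Definition Ttilde_center : set Gt :=
  [set z | Ttilde z /\ forall x, Ttilde x -> (z * x)%g = (x * z)%g].

(* Z(T~) T0~ *)
Definition ZT0tilde : set Gt :=
  [set x | exists z y, [/\ Ttilde_center z, T0tilde y & x = (z * y)%g]].

Variable Delta : 'I_r -> 'rV[R]_r.

Definition TR : set 'M[F]_N.+1 :=
  torus_over Phi X (hilbert_radical abs2 (F := F)).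

(* T_R as a subgroup of the cover: every element of the torus is uniquely
   prod_i h_(Delta i) (s i) since the group is simply connected. *)
Definition TRtilde : set Gt :=
  [set x | exists s : 'I_r -> F, [/\ forall i, s i != 0,
     TR (\prod_(i < r) hroot X (Delta i) (s i))
   & x = (\big[*%g/1%g]_(i < r) htilde (Delta i) (s i))%g]].

(* y~(varpi) for y = sum_i (k i) coroot (Delta i). *)
Definition ytilde (k : 'I_r -> int) : Gt :=
  (\big[*%g/1%g]_(i < r) htilde (Delta i) (varpi ^ k i)%R)%g.

Definition mu2Ytilde : set Gt :=
  generated 1%g (fun x y : Gt => x * y)%g (fun x : Gt => x^-1)%g
    [set x | x = zeta \/ exists k : 'I_r -> int,
       even_coroot_lattice Phi (\sum_i (k i)%:~R *: coroot (Delta i)) /\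
       x = ytilde k].

(* Genuine characters of mu_2 Y~(varpi), invariant under the Weyl group (the
   reflection in the root a acts by conjugation by wtilde a 1) and trivial on
   the elements htilde a (varpi^2). *)
Record is_eta (eta : Gt -> R[i]) : Prop := IsEta {
  eta_neq0 : forall x, mu2Ytilde x -> eta x != 0;
  etaM : forall x y, mu2Ytilde x -> mu2Ytilde y ->
    eta (x * y)%g = eta x * eta y;
  eta_genuine : eta zeta = -1;
  eta_Weyl : forall a x, a \in Phi -> mu2Ytilde x ->
    eta (wtilde a 1 * x * (wtilde a 1)^-1)%g = eta x;
  eta_trivial : forall a, a \in Phi -> eta (htilde a (varpi ^+ 2)) = 1 }.

(* Representations of a subgroup H of Gt are families of linear maps indexed
   by Gt of which only the members indexed by H matter. *)
Definition is_rep (V : lmodType R[i]) (H : set Gt)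
    (rho : Gt -> {linear V -> V}) : Prop :=
  (forall v, rho 1%g v = v) /\
  (forall g h v, H g -> H h -> rho (g * h)%g v = rho g (rho h v)).

Definition is_irreducible (V : lmodType R[i]) (H : set Gt)
    (rho : Gt -> {linear V -> V}) : Prop :=
  [/\ is_rep H rho, exists v : V, v <> 0
    & forall S : set V, S 0 -> (forall v w, S v -> S w -> S (v + w)) ->
        (forall (k : R[i]) v, S v -> S (k *: v)) ->
        (forall g v, H g -> S v -> S (rho g v)) ->
        S = [set 0] \/ S = setT].

Definition is_smooth (V : lmodType R[i]) (H : set Gt)
    (rho : Gt -> {linear V -> V}) : Prop :=
  forall v, exists2 U : set Gt, nbhs (1%g : Gt) U &
    forall g, U g -> H g -> rho g v = v.

Definition is_pseudo_spherical (V : lmodType R[i])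
    (tau : Gt -> {linear V -> V}) : Prop :=
  [/\ is_irreducible T0tilde tau, forall v, tau zeta v = - v
    & forall x v, TRtilde x -> tau x v = v].

(* The sum of the H-subrepresentations of W isomorphic to V. *)
Definition isotypic_subspace (V W : lmodType R[i]) (H : set Gt)
    (tau : Gt -> {linear V -> V}) (pi : Gt -> {linear W -> W}) : set W :=
  [set w | exists (n : nat) (f : 'I_n -> {linear V -> W}) (v : 'I_n -> V),
     [/\ forall i, injective (f i),
         forall i g x, H g -> f i (tau g x) = pi g (f i x)
       & w = \sum_i f i (v i)]].

(* eta (x) tau on ZT0tilde; the value does not depend on the decomposition
   x = p.1 * p.2 that is picked. *)
Definition tau_eta (V : lmodType R[i]) (eta : Gt -> R[i])
    (tau : Gt -> {linear V -> V}) (x : Gt) (v : V) : V :=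
  let p := xget (1%g, 1%g)
    [set p : Gt * Gt |
       [/\ mu2Ytilde p.1, T0tilde p.2 & x = (p.1 * p.2)%g]] in
  eta p.1 *: tau p.2 v.

(* Smooth induction from H to K; functions on K are extended by 0 to Gt. *)
Definition Ind (V : lmodType R[i]) (H K : set Gt) (sigma : Gt -> V -> V) :
    set (Gt -> V) :=
  [set f | [/\ forall x, ~ K x -> f x = 0,
     forall h x, H h -> K x -> f (h * x)%g = sigma h (f x)
   & exists2 U : set Gt, nbhs (1%g : Gt) U &
       forall g x, U g -> K g -> K x -> f (x * g)%g = f x]].

Definition is_unramified (chi : 'M[F]_N.+1 -> R[i]) : Prop :=
  [/\ forall g, torus Phi X g -> chi g != 0,
      forall g h, torus Phi X g -> torus Phi X h -> chi (g * h) = chi g * chi h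
    & forall g, T0 g -> chi g = 1].

(* The representation pi of Ttilde on W is isomorphic to i_(eta, tau)(chi),
   that is to Ind tau_eta with Ttilde acting by right translation twisted by
   chi. *)
Definition iso_i (V W : lmodType R[i]) (eta : Gt -> R[i])
    (tau : Gt -> {linear V -> V}) (chi : 'M[F]_N.+1 -> R[i])
    (pi : Gt -> {linear W -> W}) : Prop :=
  exists j : {linear W -> (Gt -> V)},
    [/\ injective j, range j = Ind ZT0tilde Ttilde (tau_eta eta tau)
      & forall g w, Ttilde g ->
          j (pi g w) = (fun x => chi (pr g) *: j w (x * g)%g)].

End Cover.

(* Main.v *)
Require Import Defs.
From HB Require Import structures.
From mathcomp Require Import all_boot all_order all_algebra all_field.
From mathcomp Require Import complex.
From mathcomp Require Import all_classical all_reals all_analysis.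
From mathcomp Require finmap.
From mathcomp Require Import ring lra zify.

(* The covering torus T~ is two-step nilpotent, with commutators given by the
   Hilbert symbol: [h~_a(s), h~_b(t)] = (s, t)^<b, a^vee>.  Let t0 be a unit
   such that F(sqrt t0) is unramified over F; then (a, t0) = (-1)^(val a), so
   t0 lies in the radical R.  The elements z_j = h~_(alpha_j)(t0), which lie in
   T_R, therefore detect Z(T~) T0~: it is the set of elements of T~ commuting
   with all z_j, and it equals mu2 Y~(varpi) T0~.

   Suppose that f : V -> W embeds tau into pi.  By Schur's lemma, available
   because W has countable dimension, mu2 Y~(varpi) acts on W by scalars; their
   quotient by eta extends to an unramified character chi, since Y~ contains 2Y
   and complex numbers have square roots.  Once pi is divided by chi, the map f
   is equivariant for Z(T~) T0~.  Each z_j acts trivially on f(V), and on a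
   translate of f(V) by an element outside Z(T~) T0~ some z_j acts by -1.
   Hence averaging over the z_j gives a projection of W onto f(V), that is a
   map W -> V of Z(T~) T0~-modules; Frobenius reciprocity turns it into a map
   from W to the induced representation, which is bijective because sections
   supported on different cosets are separated by the z_j.  Conversely the
   sections supported on Z(T~) T0~ form a copy of tau. *)

Set Implicit Arguments.
Unset Strict Implicit.
Unset Printing Implicit Defensive.

Import Order.TTheory GRing.Theory Num.Theory.
Local Open Scope classical_set_scope.
Local Open Scope ring_scope.

(** * The 2-adic absolute value *)

(** [F] comes without a topology, only with the integral closure of Z_2, and the Hilbert symbol is a
    mere solvability condition. Finiteness of O/2O, obtained from a maximal family independent
    modulo 2, plays the part of compactness: it gives the valuation, the convergence of series and
    Hensel's lemma. Bilinearity of the symbol is not proved by arithmetic. It is read off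
    commutators in the cover, where two roots with Cartan integer -1, which exist because the rank
    is at least 2, make the commutator of h~_a(w^-1) and h~_b(v) equal to (v, w). Residue
    characteristic 2 is the obstacle: units can pair nontrivially with each other, so T0~ need not
    be commutative, nor tau one-dimensional. Cosets of Z(T~) T0~ are therefore separated by elements
    whose action under tau is known in advance, those of T_R. The unit t0 is 1 + 4c, where x^2 + x =
    c has no solution in the residue field. The norm form of F(sqrt t0) is then anisotropic modulo
    varpi, which forces norms to have even valuation, while Hensel's lemma makes every unit a
    norm. *)

Section Q2Theory.
Variables (R : realType) (Q2 : fieldType) (abs2 : Q2 -> R).
Hypothesis hQ2 : is_Q2 abs2.
Implicit Types x y : Q2.

Let abs_ge0 := abs2_ge0 hQ2.
Let absM := abs2M hQ2.

Lemma abs2_0 : abs2 0 = 0.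
Proof. exact/(abs2_eq0 hQ2). Qed.

Lemma abs2_neq0 x : (abs2 x == 0) = (x == 0).
Proof. by apply/eqP/eqP => /(abs2_eq0 hQ2). Qed.

Lemma abs2_gt0 x : (0 < abs2 x) = (x != 0).
Proof. by rewrite lt_neqAle eq_sym abs2_neq0 abs_ge0 andbT. Qed.

Lemma abs2_int (n : int) :
  abs2 n%:~R = if n == 0 then 0 else 2 ^ (- (logn 2 `|n|%N)%:Z).
Proof.
have -> : n%:~R = ratr n%:~R :> Q2 by rewrite ratr_int.
rewrite (abs2_rat hQ2) /rat_abs2 intr_eq0 numq_int denq_int.
by case: eqP => // _; rewrite /= logn1 sub0r.
Qed.

Lemma abs2_nat (n : nat) :
  abs2 n%:R = if n == 0%N then 0 else 2 ^ (- (logn 2 n)%:Z).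
Proof. by rewrite pmulrn abs2_int. Qed.

Lemma abs2_1 : abs2 1 = 1.
Proof. by rewrite (abs2_nat 1) logn1. Qed.

Lemma abs2_2 : abs2 2%:R = 2^-1.
Proof. by rewrite (abs2_nat 2). Qed.

Lemma Q2_natr_eq0 (n : nat) : (n%:R == 0 :> Q2) = (n == 0%N).
Proof.
rewrite -abs2_neq0 abs2_nat; case: (n == 0%N); first by rewrite eqxx.
by apply/negbTE; rewrite expfz_neq0 // pnatr_eq0.
Qed.

Lemma Q2_intr_eq0 (n : int) : (n%:~R == 0 :> Q2) = (n == 0).
Proof.
rewrite -abs2_neq0 abs2_int; case: (n == 0); first by rewrite eqxx.
by apply/negbTE; rewrite expfz_neq0 // pnatr_eq0.
Qed.

Lemma abs2N x : abs2 (- x) = abs2 x.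
Proof.
rewrite -mulN1r absM.
have -> : abs2 (-1) = 1; last by rewrite mul1r.
by rewrite -[-1 in LHS]/((-1)%:~R) abs2_int logn1.
Qed.

Lemma abs2X x n : abs2 (x ^+ n) = abs2 x ^+ n.
Proof. by elim: n => [|n IH]; rewrite ?expr0 ?abs2_1 // !exprS absM IH. Qed.

Lemma abs2V x : abs2 x^-1 = (abs2 x)^-1.
Proof.
have [->|x0] := eqVneq x 0; first by rewrite invr0 abs2_0 invr0.
apply: (mulfI (x := abs2 x)); rewrite ?abs2_neq0 //.
by rewrite -absM !divff ?abs2_1 ?abs2_neq0.
Qed.

Lemma abs2_int_le1 (n : int) : abs2 n%:~R <= 1.
Proof.
rewrite abs2_int; case: eqP => // _.
rewrite -exprnN invf_le1 ?exprn_gt0 ?ltr0n //.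
by rewrite exprn_ege1 // ler1n.
Qed.

Lemma abs2_int_ultra (m n : int) :
  abs2 (m%:~R + n%:~R) <= Num.max (abs2 m%:~R) (abs2 n%:~R).
Proof.
wlog mn : m n / abs2 m%:~R <= abs2 n%:~R.
  move=> H; case: (leP (abs2 m%:~R) (abs2 n%:~R)) => h.
    by move: (H _ _ h); rewrite max_r.
  by move: (H _ _ (ltW h)); rewrite addrC max_r // ltW.
rewrite max_r //.
have [n0|n0] := eqVneq n 0.
  have -> : m = 0; last by rewrite n0 add0r.
  rewrite {}n0 in mn.
  move: mn; rewrite mulr0z abs2_0 => m0; apply/eqP.
  by rewrite -Q2_intr_eq0 -abs2_neq0 eq_le m0 abs_ge0.
have [->|m0] := eqVneq m 0; first by rewrite add0r.
have e : (logn 2 `|n| <= logn 2 `|m|)%N.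
  move: mn; rewrite !abs2_int (negbTE n0) (negbTE m0) ler_eXz2l ?ltr1n //.
  by rewrite lerN2 lez_nat.
have dn : (2 ^ logn 2 `|n| %| `|n|)%N by rewrite pfactor_dvdnn.
have dm : (2 ^ logn 2 `|n| %| `|m|)%N.
  exact: dvdn_trans (dvdn_exp2l _ e) (pfactor_dvdnn _ _).
have [a na] : exists a, n = a * (2 ^ logn 2 `|n|)%N%:Z.
  by have /dvdzP := (dn : ((2 ^ logn 2 `|n|)%N%:Z %| n)%Z).
have [b mb] : exists b, m = b * (2 ^ logn 2 `|n|)%N%:Z.
  by have /dvdzP := (dm : ((2 ^ logn 2 `|n|)%N%:Z %| m)%Z).
have mn' : m + n = (b + a) * (2 ^ logn 2 `|n|)%N%:Z by rewrite mulrDl -mb -na.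
rewrite -rmorphD mn' rmorphM absM /=.
apply: le_trans (_ : abs2 (2 ^ logn 2 `|n|)%N%:Z%:~R <= _).
  by rewrite ler_piMl ?abs_ge0 // abs2_int_le1.
rewrite [leRHS]abs2_int (negbTE n0) -pmulrn natrX abs2X abs2_2.
by rewrite exprVn -exprnN.
Qed.

Lemma abs2_rat_ultra (p q : rat) :
  abs2 (ratr p + ratr q) <= Num.max (abs2 (ratr p)) (abs2 (ratr q)).
Proof.
have E (s : rat) : ratr s = (numq s)%:~R / (denq s)%:~R :> Q2 by [].
have d0 (s : rat) : ((denq s)%:~R : Q2) != 0 by rewrite Q2_intr_eq0 denq_neq0.
rewrite !E addf_div // !(absM _ _^-1) !abs2V.
set a := numq p; set b := denq p; set c := numq q; set d := denq q.
have bp : 0 < abs2 b%:~R by rewrite abs2_gt0 d0.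
have dp : 0 < abs2 d%:~R by rewrite abs2_gt0 d0.
rewrite absM ler_pdivrMr ?mulr_gt0 // -!rmorphM.
apply: le_trans (abs2_int_ultra _ _) _.
rewrite !rmorphM !absM maxr_pMl ?mulr_ge0 ?abs_ge0 //.
rewrite le_eqVlt; apply/orP; left; apply/eqP; congr Num.max.
  by field; rewrite lt0r_neq0.
by field; rewrite lt0r_neq0.
Qed.

(** Only the triangle inequality is an axiom. The strong inequality holds on rationals by
    divisibility and passes to limits: replacing x and y by rationals costs three times e / 4. *)
Lemma abs2_ultra x y : abs2 (x + y) <= Num.max (abs2 x) (abs2 y).
Proof.
apply/ler_addgt0Pr => e e0.
have e4 : 0 < e / 4 by rewrite divr_gt0.
have [p hp] := abs2_dense hQ2 x e4.
have [q hq] := abs2_dense hQ2 y e4.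
have hpx : abs2 (ratr p) <= abs2 x + e / 4.
  rewrite -[ratr p](subrK x) (le_trans (abs2D hQ2 _ _)) // addrC lerD2l.
  by rewrite -abs2N opprB ltW.
have hqy : abs2 (ratr q) <= abs2 y + e / 4.
  rewrite -[ratr q](subrK y) (le_trans (abs2D hQ2 _ _)) // addrC lerD2l.
  by rewrite -abs2N opprB ltW.
have -> : x + y = (ratr p + ratr q) + ((x - ratr p) + (y - ratr q)) by ring.
apply: le_trans (abs2D hQ2 _ _) _.
have := abs2D hQ2 (x - ratr p) (y - ratr q).
have := abs2_rat_ultra p q.
have : Num.max (abs2 (ratr p)) (abs2 (ratr q)) <= Num.max (abs2 x) (abs2 y) + e / 4.
  rewrite ge_max; apply/andP; split.
    by rewrite (le_trans hpx) // lerD2r le_max lexx.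
  by rewrite (le_trans hqy) // lerD2r le_max lexx orbT.
lra.
Qed.

Lemma abs2_add_le1 x y : abs2 x <= 1 -> abs2 y <= 1 -> abs2 (x + y) <= 1.
Proof. by move=> hx hy; rewrite (le_trans (abs2_ultra _ _)) // ge_max hx. Qed.

Lemma abs2_add_lt (e : R) x y : abs2 x < e -> abs2 y < e -> abs2 (x + y) < e.
Proof. by move=> hx hy; rewrite (le_lt_trans (abs2_ultra _ _)) // gt_max hx. Qed.

Lemma abs2_sum_lt (e : R) (I : Type) (s : seq I) (P : pred I) (f : I -> Q2) :
  0 < e ->
  (forall i, P i -> abs2 (f i) < e) -> abs2 (\sum_(i <- s | P i) f i) < e.
Proof.
move=> e0 H; elim/big_ind: _ => //; rewrite ?abs2_0 //.
by move=> x y; exact: abs2_add_lt.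
Qed.

Lemma abs2_dense_eq x : x != 0 -> exists q : rat,
  [/\ q != 0, abs2 x = abs2 (ratr q) & abs2 (x - ratr q) < abs2 x].
Proof.
move=> x0; have [q hq] := abs2_dense hQ2 x (eq_rect_r is_true x0 (abs2_gt0 x)).
have h1 : abs2 (ratr q) <= abs2 x.
  rewrite -[ratr q](subrK x) (le_trans (abs2_ultra _ _)) // ge_max lexx andbT.
  by rewrite -abs2N opprB ltW.
have h2 : abs2 x <= abs2 (ratr q).
  have := abs2_ultra (x - ratr q) (ratr q).
  by rewrite subrK le_max leNgt hq.
have h : abs2 x = abs2 (ratr q) by apply/eqP; rewrite eq_le h1 h2.
exists q; split=> //; apply: contra_neq x0 => q0.
by apply/eqP; rewrite -abs2_neq0 h q0 (abs2_rat hQ2) /rat_abs2 eqxx.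
Qed.

(** By the strong inequality a nonzero x has the same absolute value as some rational, that is a
    power of 2. *)
Lemma abs2_lt1_half x : abs2 x < 1 -> abs2 x <= 2^-1.
Proof.
have [->|x0] := eqVneq x 0; first by rewrite abs2_0 invr_ge0 ler0n.
have [q [q0 -> _]] := abs2_dense_eq x0.
rewrite (abs2_rat hQ2) /rat_abs2 (negbTE q0) -[1 in X in X -> _](expr0z 2).
rewrite ltr_eXz2l ?ltr1n // => h.
rewrite -[2^-1]/(2 ^ (-1)) ler_eXz2l ?ltr1n //; lia.
Qed.

Lemma abs2_half x : abs2 x < 1 -> exists2 y, abs2 y <= 1 & x = 2%:R * y.
Proof.
move/abs2_lt1_half=> h; have n2 : (2%:R : Q2) != 0 by rewrite Q2_natr_eq0.
exists (x / 2%:R); last by rewrite mulrC divfK.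
by rewrite absM abs2V abs2_2 invrK -ler_pdivlMr ?div1r.
Qed.

(** The residue field of Z_2 has two elements: a rational that is a unit has odd numerator and
    denominator, so their difference is even. *)
Lemma abs2_mod2 x : abs2 x <= 1 -> abs2 x < 1 \/ abs2 (x - 1) < 1.
Proof.
rewrite le_eqVlt => /orP [/eqP x1|]; last by left.
right; have x0 : x != 0 by rewrite -abs2_neq0 x1 oner_neq0.
have [q [q0 xq hq]] := abs2_dense_eq x0.
rewrite x1 in hq; have -> : x - 1 = (x - ratr q) + (ratr q - 1) by ring.
apply: abs2_add_lt => //.
have q1 : abs2 (ratr q) = 1 by rewrite -xq.
move: q1; rewrite (abs2_rat hQ2) /rat_abs2 (negbTE q0) => /eqP.
rewrite -[1 in X in X -> _](expr0z 2) => /eqP h.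
have {}h : logn 2 `|denq q| = logn 2 `|numq q|.
  have : ((logn 2 `|denq q|)%:Z - (logn 2 `|numq q|)%:Z) = 0.
    by apply: (ieexprIz (x := 2 : R)) h; rewrite ?ltr0n // -[1]/(1%:R) eqr_nat.
  by move/eqP; rewrite subr_eq0 => /eqP [].
have od : odd `|denq q|.
  apply/negPn/negP => ed.
  have l1 : (0 < logn 2 `|denq q|)%N
    by rewrite logn_gt0 mem_primes absz_gt0 denq_neq0 dvdn2 ed.
  have := coprime_num_den q; rewrite /coprime => /eqP cop.
  have : (2 %| gcdn `|numq q| `|denq q|)%N.
    rewrite dvdn_gcd !dvdn2 ed andbT -dvdn2.
    by move: l1; rewrite h logn_gt0 mem_primes => /and3P [].
  by rewrite cop.
have on : odd `|numq q|.
  apply/negPn/negP => en.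
  have : (0 < logn 2 `|numq q|)%N
    by rewrite logn_gt0 mem_primes absz_gt0 numq_eq0 q0 dvdn2 en.
  by rewrite -h logn_gt0 mem_primes dvdn2 od !andbF.
have d0 : ((denq q)%:~R : Q2) != 0 by rewrite Q2_intr_eq0 denq_neq0.
have -> : ratr q - 1 = (numq q - denq q)%:~R / (denq q)%:~R :> Q2.
  by rewrite rmorphB /= mulrBl divff.
rewrite absM abs2V.
have -> : abs2 (denq q)%:~R = 1.
  rewrite abs2_int (negbTE (denq_neq0 q)).
  by rewrite lognE dvdn2 od !andbF.
rewrite invr1 mulr1.
have [k ->] : exists k : int, numq q - denq q = 2 * k.
  have : ~~ odd `|numq q - denq q| by lia.
  by rewrite -dvdn2 => /(dvdzP (d := 2)) [k ->]; exists k; rewrite mulrC.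
rewrite rmorphM absM /= (_ : (2 : int)%:~R = 2%:R :> Q2) // abs2_2.
apply: le_lt_trans (_ : 2^-1 < 1); first by rewrite ler_piMr ?abs2_int_le1.
by rewrite invf_lt1 ?ltr1n.
Qed.

End Q2Theory.

(** * Integers of a finite extension *)
Section Z2Ring.
Variables (R : realType) (Q2 : fieldType) (abs2 : Q2 -> R).
Hypothesis hQ2 : is_Q2 abs2.

Definition Z2pred : {pred Q2} := fun x => abs2 x <= 1.

Fact Z2pred_subring : subring_closed Z2pred.
Proof.
rewrite /Z2pred; split=> [|x y|x y]; rewrite !unfold_in.
- by rewrite (abs2_1 hQ2).
- by move=> hx hy; apply: (abs2_add_le1 hQ2); rewrite ?(abs2N hQ2).
- by move=> hx hy; rewrite (abs2M hQ2) mulr_ile1 ?(abs2_ge0 hQ2).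
Qed.

HB.instance Definition _ := GRing.isSubringClosed.Build Q2 Z2pred Z2pred_subring.

Record Z2ring := Z2Ring { z2val :> Q2; _ : z2val \in Z2pred }.

HB.instance Definition _ := [isSub for z2val].
HB.instance Definition _ := [Choice of Z2ring by <:].
HB.instance Definition _ := [SubChoice_isSubComNzRing of Z2ring by <:].

Variable F : fieldExtType Q2.
Local Notation O := (integers abs2 (F := F)).
Implicit Types x y d : F.

Local Notation vZ2 := (val : Z2ring -> Q2).
Definition Z2emb : {rmorphism Z2ring -> F} := in_alg F \o vZ2.

(** Seen as integrality over the ring [Z2ring], the definition of [integers] inherits closure under
    the ring operations. *)
Lemma integers_integralOver x : O x <-> integralOver Z2emb x.
Proof.
split=> [[p [pm pc px]]|[p pm px]]; last first.
  exists (map_poly vZ2 p); split.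
  - exact: monic_map pm.
  - by move=> i; rewrite coef_map; case: (p`_i).
  - by rewrite -map_poly_comp.
have pv i : vZ2 (insubd 0 p`_i : Z2ring) = p`_i.
  by apply: (insubdK (0 : Z2ring)); exact: pc.
have Ep : p = map_poly vZ2 (\poly_(i < size p) (insubd 0 p`_i : Z2ring)).
  apply/polyP=> i; rewrite coef_map coef_poly; case: ltnP => [_|h].
    by rewrite /= pv.
  by rewrite nth_default.
exists (\poly_(i < size p) (insubd 0 p`_i : Z2ring)).
  apply/eqP/val_inj; rewrite -(lead_coef_map_inj (f := vZ2) val_inj) //.
  by rewrite -Ep (eqP pm).
by rewrite (map_poly_comp (in_alg F) vZ2) -Ep.
Qed.

Lemma integersB x y : O x -> O y -> O (x - y).
Proof. by rewrite !integers_integralOver; exact: integral_sub. Qed.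

Lemma integersD x y : O x -> O y -> O (x + y).
Proof. by rewrite !integers_integralOver; exact: integral_add. Qed.

Lemma integersM x y : O x -> O y -> O (x * y).
Proof. by rewrite !integers_integralOver; exact: integral_mul. Qed.

Lemma integersN x : O x -> O (- x).
Proof. by rewrite !integers_integralOver; exact: integral_opp. Qed.

Lemma integers_nat n : O n%:R.
Proof. by rewrite integers_integralOver; exact: integral_nat. Qed.

Lemma integers0 : O 0. Proof. exact: (integers_nat 0). Qed.
Lemma integers1 : O 1. Proof. exact: (integers_nat 1). Qed.

Lemma integersX x n : O x -> O (x ^+ n).
Proof.
move=> hx; elim: n => [|n IH]; first by rewrite expr0; exact: integers1.
by rewrite exprS; exact: integersM.
Qed.

Lemma integers_scalar (a : Q2) : abs2 a <= 1 -> O (a%:A).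
Proof.
move=> ha; rewrite integers_integralOver.
exact: (integral_id Z2emb (Z2Ring (ha : a \in Z2pred))).
Qed.

Lemma integersZ (a : Q2) x : abs2 a <= 1 -> O x -> O (a *: x).
Proof. by move=> ha hx; rewrite -mulr_algl; apply: integersM => //;
  exact: integers_scalar. Qed.

Lemma fieldext_two_neq0 : (2%:R : F) != 0.
Proof. by rewrite -[2%:R](rmorph_nat (in_alg F)) fmorph_eq0 (Q2_natr_eq0 hQ2). Qed.

(** Multiplying a monic equation of degree n for 1/2 by 2^n would write -1 as a sum of multiples of
    2. *)
Lemma half_notin_integers : ~ O (2%:R^-1).
Proof.
case=> p [pm pc].
rewrite -[2%:R](rmorph_nat (in_alg F)) -fmorphV fmorph_root => /rootP.
have two0 : (2%:R : Q2) != 0 by rewrite (Q2_natr_eq0 hQ2).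
have sp : (0 < size p)%N by rewrite size_poly_gt0 monic_neq0.
rewrite horner_coef -(prednK sp) big_ord_recr /=.
have -> : p`_(size p).-1 = 1 by rewrite -/(lead_coef p) (eqP pm).
set n := (size p).-1; rewrite mul1r => /(congr1 (fun z => z * 2%:R ^+ n)).
rewrite mul0r mulrDl exprVn mulVf ?expf_neq0 // => /eqP.
rewrite addrC addr_eq0 => /eqP e1; have := abs2_1 hQ2;
  rewrite e1 (abs2N hQ2) mulr_suml.
suff : abs2 (\sum_(i < n) p`_i * 2^-1 ^+ i * 2 ^+ n) < 1 by move=> h /eqP;
  rewrite lt_eqF.
apply: (abs2_sum_lt hQ2) => // i _.
have -> : p`_i * 2^-1 ^+ i * 2 ^+ n = p`_i * 2 ^+ (n - i).
  rewrite -mulrA; congr (_ * _).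
  have -> : (2%:R : Q2) ^+ n = 2%:R ^+ (n - i) * 2%:R ^+ i
    by rewrite -exprD subnK // ltnW.
  by rewrite exprVn mulrCA mulVf ?expf_neq0 ?mulr1.
rewrite (abs2M hQ2) (abs2X hQ2) (abs2_2 hQ2).
apply: le_lt_trans (_ : 2^-1 ^+ (n - i) < 1).
  by rewrite ler_piMl ?exprn_ge0 ?invr_ge0 ?ler0n.
by rewrite exprn_ilt1 ?invr_ge0 ?ler0n ?invf_lt1 ?ltr1n // -lt0n subn_gt0.
Qed.

(** If 2^m bounds the coefficients of the minimal polynomial of x, of degree d, then 2^m x is a root
    of the monic polynomial whose coefficient of index i is multiplied by 2^(m (d - i)), which is
    integral. *)
Lemma integers_scale x : exists m, O (2%:R ^+ m * x).
Proof.
have /polyOver1P [p Ep] := minPolyOver 1%AS x.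
have pm : p \is monic by rewrite -(map_monic (in_alg F)) -Ep monic_minPoly.
have px : root (map_poly (in_alg F) p) x by rewrite -Ep root_minPoly.
have [m hm] : exists m, forall i, abs2 p`_i <= 2 ^+ m.
  have [m hm] : exists m, forall i : 'I_(size p), abs2 p`_i <= 2 ^+ m.
    have H (i : 'I_(size p)) : exists m, abs2 p`_i <= 2 ^+ m.
      exists (Num.bound (abs2 p`_i)).
      by apply/ltW/(lt_le_trans (archi_boundP (abs2_ge0 hQ2 _)));
        rewrite -natrX ler_nat ltnW // ltn_expl.
    have [f hf] := choice H; exists (\max_i f i) => i.
    by apply: le_trans (hf i) _; rewrite ler_weXn2l ?ler1n // leq_bigmax.
  exists m => i; case: (ltnP i (size p)) => hi; first exact: (hm (Ordinal hi)).
  by rewrite nth_default // (abs2_0 hQ2) exprn_ge0 // ler0n.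
have two0 : (2%:R : Q2) != 0 by rewrite (Q2_natr_eq0 hQ2).
have sp : (0 < size p)%N by rewrite size_poly_gt0 monic_neq0.
set d := (size p).-1.
have lp : p`_d = 1 by rewrite -/(lead_coef p) (eqP pm).
pose E i := p`_i * 2%:R ^+ (m * (d - i)).
have sq : size (\poly_(i < size p) E i) = size p.
  by apply: size_poly_eq; rewrite /E subnn muln0 mulr1 lp oner_neq0.
exists m, (\poly_(i < size p) E i); split.
- by rewrite monicE /lead_coef sq coef_poly prednK // leqnn /E subnn muln0 mulr1 lp.
- move=> i; rewrite coef_poly; case: ltnP => hi; last by rewrite (abs2_0 hQ2).
  rewrite (abs2M hQ2) (abs2X hQ2) (abs2_2 hQ2).
  have [->|/eqP id_] := eqVneq i d;
    first by rewrite lp (abs2_1 hQ2) subnn muln0 mulr1.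
  rewrite exprVn ler_pdivrMr ?exprn_gt0 ?ltr0n // mul1r.
  apply: le_trans (hm i) _; rewrite ler_weXn2l ?ler1n // leq_pmulr //.
  by rewrite subn_gt0; lia.
- rewrite /root horner_coef size_map_poly sq.
  move: px => /rootP; rewrite horner_coef size_map_poly => px.
  suff -> : \sum_(i < size p) (map_poly (in_alg F) (\poly_(i < size p) E i))`_i *
    (2 ^+ m * x) ^+ i
      = 2%:R ^+ (m * d) * \sum_(i < size p) (map_poly (in_alg F) p)`_i * x ^+ i.
    by rewrite px mulr0.
  rewrite mulr_sumr; apply: eq_bigr => i _;
    rewrite !coef_map coef_poly ltn_ord /E /=.
  have -> : (2%:R : F) = (2%:R)%:A by rewrite -(rmorph_nat (in_alg F)).
  have hi : (i <= d)%N by have := ltn_ord i; rewrite /d; lia.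
  rewrite exprMn [LHS]mulrA [RHS]mulrA; congr (_ * _).
  rewrite -!(rmorphXn (in_alg F)) -!(rmorphM (in_alg F)) /=; congr (_%:A).
  rewrite -exprM -mulrA -exprD mulrC; congr (_ ^+ _ * _).
  by rewrite -mulnDr subnK.
Qed.

Definition multiple d x : Prop := exists2 a, O a & x = d * a.

Lemma multipleD d x y : multiple d x -> multiple d y -> multiple d (x + y).
Proof.
by case=> a ha -> [b hb ->]; exists (a + b); [exact: integersD | rewrite mulrDr].
Qed.

Lemma multipleN d x : multiple d x -> multiple d (- x).
Proof. by case=> a ha ->; exists (- a); [exact: integersN | rewrite mulrN]. Qed.

Lemma multipleB d x y : multiple d x -> multiple d y -> multiple d (x - y).
Proof. by move=> hx /multipleN; exact: multipleD. Qed.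

Lemma multipleMl d x y : O x -> multiple d y -> multiple d (x * y).
Proof. by move=> hx [a ha ->]; exists (x * a);
  [exact: integersM | rewrite mulrCA]. Qed.

Lemma multipleMM d e x y : multiple d x -> multiple e y -> multiple (d * e) (x * y).
Proof. by case=> a ha -> [b hb ->]; exists (a * b); [exact: integersM | ring]. Qed.

Lemma multiple_trans d e x : multiple d e -> multiple e x -> multiple d x.
Proof. by case=> a ha -> [b hb ->]; exists (a * b);
  [exact: integersM | rewrite mulrA]. Qed.

Lemma multiple0 d : multiple d 0.
Proof. by exists 0; [exact: integers0 | rewrite mulr0]. Qed.

Lemma multiple_self d : multiple d d.
Proof. by exists 1; [exact: integers1 | rewrite mulr1]. Qed.

Lemma multiple_sum d (I : Type) (s : seq I) (P : pred I) (f : I -> F) :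
  (forall i, P i -> multiple d (f i)) -> multiple d (\sum_(i <- s | P i) f i).
Proof. by move=> H; elim/big_ind: _ => //;
  [exact: multiple0 | exact: multipleD]. Qed.

Lemma multiple2Z (a : Q2) x : abs2 a < 1 -> O x -> multiple 2%:R (a *: x).
Proof.
move=> /(abs2_half hQ2) [b hb ->] hx; exists (b *: x); first exact: integersZ.
by rewrite -scalerA scaler_nat mulr_natl.
Qed.

(** For integral e_i this is independence over F_2 of their classes in O/2O, expressed with
    coefficients in Z_2. *)
Definition indep2 m (e : 'I_m -> F) := forall a : 'I_m -> Q2,
  (forall i, abs2 (a i) <= 1) -> multiple 2%:R (\sum_i a i *: e i) ->
  forall i, abs2 (a i) < 1.

(** Dividing a linear relation over Q2 by its largest coefficient gives a relation over Z_2 with a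
    unit coefficient, which independence modulo 2 forbids. *)
Lemma indep2_leq_dim m (e : 'I_m -> F) : indep2 e -> (m <= \dim {:F})%N.
Proof.
move=> he; have fe : free [tuple e i | i < m].
  apply/freeP => k hk i; apply/eqP; apply: contrapT => /negP ki.
  have [i0 _ hi0] : exists2 i0, true & forall j, abs2 (k j) <= abs2 (k i0).
    by case: (arg_maxP (fun j => abs2 (k j)) (erefl : xpredT i)) => i0 _ h;
      exists i0 => // j; exact: h.
  have k0 : abs2 (k i0) != 0.
    rewrite gt_eqF // (lt_le_trans _ (hi0 i)) // lt_neqAle (abs2_ge0 hQ2) andbT.
    by rewrite eq_sym (abs2_neq0 hQ2).
  have := he (fun j => (k i0)^-1 * k j) _ _ i0.
  rewrite mulVf ?(abs2_1 hQ2) ?ltxx; last by rewrite -(abs2_neq0 hQ2).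
  move=> H; suff : false by []; apply: H => [j|].
    rewrite (abs2M hQ2) (abs2V hQ2) mulrC ler_pdivrMr ?mul1r //.
    by rewrite lt_neqAle eq_sym k0 (abs2_ge0 hQ2).
  under eq_bigr => j _ do rewrite -scalerA.
  rewrite -scaler_sumr.
  have -> : \sum_i k i *: e i = 0.
    by rewrite -[RHS]hk; apply: eq_bigr => j _; rewrite -tnth_nth tnth_mktuple.
  by rewrite scaler0; exact: multiple0.
have := dimvS (subvf <<[tuple e i | i < m]>>); rewrite (eqP fe) size_tuple //.
Qed.

(** O/2O is finite. A family of maximal length independent modulo 2 exists because the dimension of
    F bounds the length; it spans O modulo 2, and coefficients in Z_2 can be reduced to 0 or 1. *)
Lemma integers_mod2_basis : exists m (e : 'I_m -> F), (forall i, O (e i)) /\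
  forall x, O x -> exists eps : {ffun 'I_m -> bool},
    multiple 2%:R (x - \sum_i (eps i)%:R * e i).
Proof.
pose P m := `[< exists e : 'I_m -> F, (forall i, O (e i)) /\ indep2 e >].
have P0 : exists m, P m.
  by exists 0%N; apply/asboolP; exists (fun=> 0); split=> [[]|a _ _ []].
have Pb m : P m -> (m <= \dim {:F})%N by move=> /asboolP [e [_ /indep2_leq_dim]].
case: (ex_maxnP P0 Pb) => m /asboolP [e [eO ei]] mmax.
exists m, e; split=> // x xO.
pose e' (i : 'I_m.+1) := if unlift ord0 i is Some j then e j else x.
have e'0 : e' ord0 = x by rewrite /e' unlift_none.
have e'S j : e' (lift ord0 j) = e j by rewrite /e' liftK.
have : ~ indep2 e'.
  move=> he'; have : P m.+1.
    by apply/asboolP; exists e'; split=> // i; rewrite /e'; case: unliftP.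
  by move/mmax; rewrite ltnn.
move=> /existsNP [a]; rewrite not_implyE => -[ha]; rewrite not_implyE => -[hs].
move=> /existsNP [i hi].
rewrite big_ord_recl e'0 in hs.
rewrite (eq_bigr (fun j => a (lift ord0 j) *: e j)) in hs; last first.
  by move=> j _; rewrite e'S.
have a0 : abs2 (a ord0) = 1.
  apply/eqP; rewrite eq_le ha /= leNgt; apply/negP => lt1; apply: hi.
  case: (unliftP ord0 i) => [j ->|->]; last by [].
  apply: (ei (fun j => a (lift ord0 j))) => //.
  by move: (multipleB hs (multiple2Z lt1 xO)); rewrite addrC addKr.
have a0n : a ord0 != 0 by rewrite -(abs2_neq0 hQ2) a0 oner_neq0.
pose b j := - (a ord0)^-1 * a (lift ord0 j).
have hb j : abs2 (b j) <= 1
  by rewrite (abs2M hQ2) (abs2N hQ2) (abs2V hQ2) a0 invr1 mul1r.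
have hxb : multiple 2%:R (x - \sum_j b j *: e j).
  have := multipleMl (integers_scalar (a := (a ord0)^-1) _) hs.
  rewrite (abs2V hQ2) a0 invr1 => /(_ (lexx _)).
  rewrite mulr_algl scalerDr scalerA mulVf // scale1r scaler_sumr -sumrN.
  by under eq_bigr => j _ do rewrite scalerA -[_ * _]opprK scaleNr -mulNr.
exists [ffun j => `[< abs2 (b j - 1) < 1 >]].
have -> : x - \sum_j ([ffun j => `[< abs2 (b j - 1) < 1 >]] j)%:R * e j =
   x - \sum_j b j *: e j + \sum_j (b j - (`[< abs2 (b j - 1) < 1 >])%:R) *: e j.
  rewrite -addrA; congr (_ + _); rewrite -!sumrN -big_split; apply: eq_bigr => j _.
  rewrite ffunE /= scalerBl addKr; congr (- _).
  by rewrite scaler_nat mulr_natl.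
apply: multipleD => //; apply: multiple_sum => j _; apply: multiple2Z => //.
case: asboolP => // h; rewrite subr0.
by case: (abs2_mod2 hQ2 (hb j)).
Qed.

End Z2Ring.

(** * Valuation *)
Section LocalField.
Variables (R : realType) (Q2 : fieldType) (abs2 : Q2 -> R).
Hypothesis hQ2 : is_Q2 abs2.
Variables (F : fieldExtType Q2) (varpi : F).
Hypothesis hvarpi : is_uniformizer abs2 varpi.
Local Notation O := (integers abs2 (F := F)).
Local Notation unit := (int_units abs2 (F := F)).
Local Notation mult := (multiple abs2).
Implicit Types x y : F.

Lemma uniformizer_neq0 : varpi != 0. Proof. by case: hvarpi. Qed.
Let w0 := uniformizer_neq0.

Lemma integers_varpi : O varpi. Proof. by case: hvarpi. Qed.

Lemma varpi_nonunit : ~ O varpi^-1.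
Proof. by case: hvarpi => h1 h2 h3 _ h4; apply: h3; split. Qed.

Lemma nonunit_multiple x : O x -> ~ unit x -> mult varpi x.
Proof. by case: hvarpi => _ _ _; apply. Qed.

Lemma int_unitM x y : unit x -> unit y -> unit (x * y).
Proof.
move=> [x0 xO xV] [y0 yO yV]; split; first by rewrite mulf_neq0.
  exact: (integersM hQ2).
by rewrite invfM; exact: (integersM hQ2).
Qed.

Lemma int_unitV x : unit x -> unit x^-1.
Proof. by move=> [x0 xO xV]; split; rewrite ?invr_eq0 ?invrK. Qed.

Lemma int_unit1 : unit 1.
Proof. by split; rewrite ?oner_neq0 ?invr1 //; exact: (integers1 hQ2). Qed.

Lemma multiple_unit x : unit x -> ~ mult varpi x.
Proof.
move=> [x0 xO xV] [a aO e]; apply: varpi_nonunit.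
have a0 : a != 0 by apply: contra_neq x0; rewrite e => ->; rewrite mulr0.
have -> : varpi^-1 = a * x^-1 by rewrite e; field; rewrite w0 a0.
exact: (integersM hQ2).
Qed.

Lemma two_multiple : mult varpi 2%:R.
Proof.
apply: nonunit_multiple; first exact: (integers_nat hQ2).
by case=> _ _; exact: (half_notin_integers hQ2).
Qed.

Lemma multiple_expS m n x : (m <= n)%N -> mult (varpi ^+ n) x ->
  mult (varpi ^+ m) x.
Proof.
move=> mn; apply: (multiple_trans hQ2); exists (varpi ^+ (n - m)).
  by apply: (integersX hQ2); exact: integers_varpi.
by rewrite -exprD subnKC.
Qed.

Lemma multiple_integer d x : O d -> mult d x -> O x.
Proof. by move=> dO [a aO ->]; exact: (integersM hQ2). Qed.

Lemma unit_add_multiple x y : unit x -> mult varpi y -> unit (x + y).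
Proof.
move=> hx hy; apply: contrapT => nu.
have xyO : O (x + y).
  apply: (integersD hQ2); first by case: hx.
  by apply: multiple_integer hy; exact: integers_varpi.
apply: (multiple_unit hx).
by rewrite -[x](addrK y); apply: (multipleB hQ2) => //; exact: nonunit_multiple.
Qed.

Lemma pigeonhole_mod2 (u : nat -> F) : (forall i, O (u i)) ->
  exists i j, (i < j)%N /\ mult 2%:R (u i - u j).
Proof.
move=> uO; have [m [e [eO he]]] := integers_mod2_basis hQ2 F.
have [f hf] := choice (fun i => he (u i) (uO i)).
pose g (i : 'I_(#|{ffun 'I_m -> bool}|.+1)) := f i.
have : ~~ injectiveb g.
  by apply/negP => /injectiveP /leq_card; rewrite card_ord ltnn.
move=> /injectivePn [i [j ij gij]].
have H (a b : nat) : f a = f b -> mult 2%:R (u a - u b).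
  move=> fab; have := multipleB hQ2 (hf a) (hf b).
  by rewrite fab; congr (mult _ _); ring.
have : (i < j)%N || (j < i)%N by rewrite -neq_ltn.
case/orP => h; [exists i, j | exists j, i]; split => //; exact: H.
Qed.

Lemma pigeonhole_residue (u : nat -> F) : (forall i, O (u i)) ->
  exists i j, (i < j)%N /\ mult varpi (u i - u j).
Proof.
move=> /pigeonhole_mod2 [i [j [ij h]]]; exists i, j; split=> //.
exact: (multiple_trans hQ2 two_multiple).
Qed.

(** By finiteness of O/2O two powers of varpi agree modulo 2, and their difference is the smaller
    power times a unit. This bounds the ramification. *)
Lemma varpiX_multiple2 : exists2 i, (0 < i)%N & mult 2%:R (varpi ^+ i).
Proof.
have [|i [j [ij h]]] := pigeonhole_mod2 (u := fun i => varpi ^+ i).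
  by move=> i; apply: (integersX hQ2); exact: integers_varpi.
have wO := integers_varpi.
exists i.+1 => //; rewrite exprS; apply: (multipleMl hQ2) => //.
have u1 : unit (1 - varpi ^+ (j - i)).
  apply: unit_add_multiple; first exact: int_unit1.
  apply: (multipleN hQ2); apply: (@multiple_expS 1 (j - i));
    first by rewrite subn_gt0.
  exact: (multiple_self hQ2).
have -> : varpi ^+ i = (1 - varpi ^+ (j - i))^-1 * (varpi ^+ i - varpi ^+ j).
  rewrite -{2}(subnKC (ltnW ij)) exprD; field.
  by case: u1.
by apply: (multipleMl hQ2) => //; case: u1.
Qed.

Lemma unit_varpiX m : unit (varpi ^+ m) -> m = 0%N.
Proof.
case: m => // m [_ _]; rewrite exprS invfM => h; case: varpi_nonunit.
rewrite -[varpi^-1]mulr1 -(mulVf (expf_neq0 m w0)) mulrA.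
by apply: (integersM hQ2) => //; apply: (integersX hQ2); exact: integers_varpi.
Qed.

(** If 2^m / x is integral and 2 divides varpi^i, then varpi^M divides x only for M <= i m; the
    largest such M leaves a unit as cofactor. *)
Lemma integer_varpiX_unit x : O x -> x != 0 ->
  exists m u, unit u /\ x = varpi ^+ m * u.
Proof.
move=> xO x0.
have [i i0 hi] := varpiX_multiple2.
have [m hm] := integers_scale hQ2 x^-1.
pose P M := `[< mult (varpi ^+ M) x >].
have P0 : exists M, P M by exists 0%N; apply/asboolP; exists x;
  rewrite ?expr0 ?mul1r.
have Pb M : P M -> (M <= i * m)%N.
  move=> /asboolP hM; rewrite leqNgt; apply/negP => lt.
  have h2 : mult (varpi ^+ M) (2%:R ^+ m).
    by have := multipleMl hQ2 hm hM; rewrite mulfVK.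
  have h3 : mult (2%:R ^+ m) (varpi ^+ (i * m)).
    rewrite exprM; elim: (m) => [|n IH]; first by rewrite !expr0;
      exact: (multiple_self hQ2).
    by rewrite !exprS; exact: (multipleMM hQ2).
  have [a aO ea] := multiple_trans hQ2 h2 h3.
  have e1 : 1 = varpi * (varpi ^+ (M - i * m).-1 * a).
    apply: (mulfI (expf_neq0 (i * m) w0));
      rewrite mulr1 {1}ea !mulrA -exprSr -exprD.
    by congr (_ ^+ _ * _); lia.
  apply: (multiple_unit int_unit1); exists (varpi ^+ (M - i * m).-1 * a) => //.
  by apply: (integersM hQ2) => //; apply: (integersX hQ2); exact: integers_varpi.
case: (ex_maxnP P0 Pb) => M /asboolP [a aO ea] Mmax.
exists M, a; split=> //; apply: contrapT => nu.
have [b bO eb] := nonunit_multiple aO nu.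
have : P M.+1 by apply/asboolP; exists b; rewrite // exprSr -mulrA -eb.
by move/Mmax; rewrite ltnn.
Qed.

Lemma varpi_unit_decomp x : x != 0 -> exists k : int, unit (x / varpi ^ k).
Proof.
move=> x0; have [m hm] := integers_scale hQ2 x.
have t0 := fieldext_two_neq0 hQ2 F.
have [|a [u [uu eu]]] := integer_varpiX_unit hm;
  first by rewrite mulf_neq0 ?expf_neq0.
have [||b [v [vu ev]]] := @integer_varpiX_unit (2%:R ^+ m).
- by apply: (integersX hQ2); exact: (integers_nat hQ2).
- by rewrite expf_neq0.
have ex : x = varpi ^ (a%:Z - b%:Z) * (u / v).
  apply: (mulfI (expf_neq0 m t0)); rewrite eu ev expfzDr // -exprnN.
  by rewrite -exprnP; field; rewrite (expf_neq0 b w0) andbT; case: vu.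
exists (a%:Z - b%:Z); rewrite ex mulrC mulKf ?expfz_neq0 //.
by apply: int_unitM => //; exact: int_unitV.
Qed.

(** At x = 0 no k qualifies and the default 0 is taken, which keeps [valuationV] free of a
    hypothesis. *)
Definition valuation x : int := xget 0 [set k : int | unit (x / varpi ^ k)].
Local Notation val := valuation.

Lemma valuationP x : x != 0 -> unit (x / varpi ^ val x).
Proof. by move=> /varpi_unit_decomp [k hk]; rewrite /val;
  case: xgetP => [y -> //|/(_ k)]. Qed.

Lemma unit_varpiXz (k : int) : unit (varpi ^ k) -> k = 0.
Proof.
case: k => [m /unit_varpiX -> //|m].
by rewrite NegzE -exprnN => /int_unitV; rewrite invrK => /unit_varpiX.
Qed.

Lemma valuation_unique x k : unit (x / varpi ^ k) -> val x = k.
Proof.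
move=> h; have x0 : x != 0 by case: h => h _ _; apply: contra_neq h => ->;
  rewrite mul0r.
apply/eqP; rewrite -subr_eq0; apply/eqP/unit_varpiXz.
have -> : varpi ^ (val x - k) = (x / varpi ^ k) / (x / varpi ^ val x).
  rewrite expfzDr // -invr_expz; move: (expfz_neq0 (val x) w0) (expfz_neq0 k w0).
  by move: (varpi ^ val x) (varpi ^ k) => a b a0 b0; field; rewrite x0 a0 b0.
by apply: int_unitM => //; apply: int_unitV; exact: valuationP.
Qed.

Lemma valuationM x y : x != 0 -> y != 0 -> val (x * y) = val x + val y.
Proof.
move=> x0 y0; apply: valuation_unique.
have -> : x * y / varpi ^ (val x +
  val y) = (x / varpi ^ val x) * (y / varpi ^ val y).
  by rewrite expfzDr // mulf_div.
by apply: int_unitM; exact: valuationP.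
Qed.

Lemma valuation1 : val 1 = 0.
Proof. by apply: valuation_unique; rewrite expr0z divr1; exact: int_unit1. Qed.

Lemma valuationV x : val x^-1 = - val x.
Proof.
have [->|x0] := eqVneq x 0; last first.
  by have := valuationM x0 (_ : x^-1 != 0);
    rewrite divff // valuation1 invr_eq0 => /(_ x0); lia.
rewrite invr0; have -> : val 0 = 0 :> int; last by rewrite oppr0.
by rewrite /val; case: xgetP => // k _ [/negP]; rewrite mul0r eqxx.
Qed.

Lemma valuationXz x (k : int) : x != 0 -> val (x ^ k) = k * val x.
Proof.
move=> x0; apply: valuation_unique.
have -> : x ^ k / varpi ^ (k * val x) = (x / varpi ^ val x) ^ k.
  by rewrite expfzMl exprz_inv -invr_expz exprz_exp [_ * k]mulrC.
have hu := valuationP x0; case: k => n.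
  rewrite -exprnP; elim: n => [|n IH]; first by rewrite expr0; exact: int_unit1.
  by rewrite exprS; exact: int_unitM.
rewrite NegzE -exprnN; apply: int_unitV.
elim: n => [|n IH]; first by rewrite expr1.
by rewrite exprS; exact: int_unitM.
Qed.

Lemma valuation_varpi : val varpi = 1.
Proof. by apply: valuation_unique; rewrite expr1z divff //; exact: int_unit1. Qed.

Lemma valuation_unit x : unit x -> val x = 0.
Proof. by move=> h; apply: valuation_unique; rewrite expr0z divr1. Qed.

Lemma multiple_valuation m x : x != 0 -> (m%:Z <= val x) -> mult (varpi ^+ m) x.
Proof.
move=> x0 h; have [u0 uO uV] := valuationP x0.
exists (varpi ^ (val x - m%:Z) * (x / varpi ^ val x)).
  apply: (integersM hQ2) => //.
  have -> : val x - m%:Z = `|(val x - m%:Z)|%N%:Z by lia.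
  by rewrite -exprnP; apply: (integersX hQ2); exact: integers_varpi.
by rewrite exprnP mulrA -expfzDr // addrC subrK mulrC divfK ?expfz_neq0.
Qed.

Lemma valuation_multiple m x : x != 0 -> mult (varpi ^+ m) x -> m%:Z <= val x.
Proof.
move=> x0 [a aO ea].
have a0 : a != 0 by apply: contra_neq x0; rewrite ea => ->; rewrite mulr0.
have [n [u [uu eu]]] := integer_varpiX_unit aO a0.
have u0 : u != 0 by case: uu.
rewrite ea eu mulrA -exprD valuationM ?expf_neq0 //.
by rewrite !exprnP !valuationXz // valuation_varpi (valuation_unit uu); lia.
Qed.

Lemma integer_valuation x : x != 0 -> O x <-> 0 <= val x.
Proof.
move=> x0; split=> h.
  by apply: (@valuation_multiple 0) => //; exists x; rewrite ?expr0 ?mul1r.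
by have [a aO] := multiple_valuation x0 (h : 0%N%:Z <= _);
  rewrite expr0 mul1r => ->.
Qed.

Lemma multiple_all_eq0 x : (forall m, mult (varpi ^+ m) x) -> x = 0.
Proof.
move=> H; apply/eqP; apply: contrapT => /negP x0.
by have := valuation_multiple x0 (H `|val x|.+1); lia.
Qed.

Lemma multiple_prime x : O x -> mult varpi (x ^+ 2) -> mult varpi x.
Proof.
move=> xO h; apply: nonunit_multiple => // -[x0 _ xV].
apply: (@multiple_unit (x ^+ 2)) => //; rewrite expr2.
by apply: int_unitM; split.
Qed.

End LocalField.

(** * Completeness, Hensel's lemma and the unramified quadratic symbol *)
Section Completeness.
Variables (R : realType) (Q2 : fieldType) (abs2 : Q2 -> R).
Hypothesis hQ2 : is_Q2 abs2.
Variables (F : fieldExtType Q2).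
Local Notation O := (integers abs2 (F := F)).
Local Notation mult := (multiple abs2).

Lemma Q2_series (a : nat -> Q2) : (forall j, abs2 (a j) <= 1) ->
  exists l, forall n, abs2 (l - \sum_(j < n) 2%:R ^+ j * a j) <= 2^-1 ^+ n.
Proof.
move=> ha; pose S n := \sum_(j < n) 2%:R ^+ j * a j.
have h2 n : abs2 (2%:R ^+ n) = 2^-1 ^+ n by rewrite (abs2X hQ2) (abs2_2 hQ2).
have p2 n : 0 <= 2^-1 ^+ n :> R by rewrite exprn_ge0 // invr_ge0 ler0n.
have hS n k : abs2 (S (n + k)%N - S n) <= 2^-1 ^+ n.
  elim: k => [|k IH]; first by rewrite addn0 subrr (abs2_0 hQ2).
  rewrite addnS /S big_ord_recr /= -/(S _) addrAC.
  apply: le_trans (abs2_ultra hQ2 _ _) _; rewrite ge_max IH /=.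
  rewrite (abs2M hQ2) h2 (le_trans (_ : _ <= 2^-1 ^+ (n + k))) //.
    by rewrite ler_piMr.
  by rewrite exprD ler_piMr // exprn_ile1 ?invr_ge0 ?ler0n
    // invf_le1 ?ler1n ?ltr0n.
have hS' m n : (n <= m)%N -> abs2 (S m - S n) <= 2^-1 ^+ n.
  by move=> /subnKC <-; exact: hS.
have small (e : R) : 0 < e -> exists n, 2^-1 ^+ n < e.
  move=> e0; exists (Num.bound e^-1).
  rewrite exprVn invf_plt ?posrE ?exprn_gt0 ?ltr0n //.
  have e1 : 0 <= e^-1 by rewrite invr_ge0 ltW.
  apply: lt_le_trans (archi_boundP e1) _.
  by rewrite -natrX ler_nat ltnW // ltn_expl.
have [|l hl] := abs2_complete hQ2 (u := S).
  move=> e e0; have [n hn] := small e e0; exists n => m k nm nk.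
  have -> : S m - S k = (S m - S n) - (S k - S n) by ring.
  by apply: (abs2_add_lt hQ2); rewrite ?(abs2N hQ2) (le_lt_trans _ hn) // hS'.
exists l => n; apply/ler_addgt0Pr => e e0.
have [n0 hn0] := hl e e0; pose k := maxn n0 n.
have -> : l - S n = - (S k - l) + (S k - S n) by ring.
apply: le_trans (abs2_ultra hQ2 _ _) _; rewrite ge_max (abs2N hQ2); apply/andP;
  split.
  by rewrite (le_trans (ltW (hn0 k (leq_maxl _ _)))) // lerDr.
by rewrite (le_trans (hS' _ _ (leq_maxr _ _))) // lerDl ltW.
Qed.

(** Every integer is a combination of the e_i with digits 0 and 1, plus twice an integer. Carrying
    the latter to the next term, as in binary addition, splits the series into one 2-adic series for
    each e_i. *)
Lemma integers_series (x : nat -> F) : (forall j, O (x j)) ->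
  exists2 s, O s & forall n, mult (2%:R ^+ n) (s - \sum_(j < n) 2%:R ^+ j * x j).
Proof.
move=> xO; have [m [e [eO he]]] := integers_mod2_basis hQ2 F.
have H (y : F) : exists p : {ffun 'I_m -> bool} * F, O y ->
   O p.2 /\ y = \sum_i (p.1 i)%:R * e i + 2%:R * p.2.
  case: (pselect (O y)) => [/he [eps [a aO ea]]|h];
    last by exists ([ffun=> true], 0).
  by exists (eps, a) => _; split; rewrite //= -ea; ring.
have [f hf] := choice H.
(* [r k] is the carry into position k, and [eps k] are the digits left there. *)
pose r := fix r k := if k is k'.+1 then (f (r k' + x k')).2 else 0.
pose eps k := (f (r k + x k)).1.
have rO k : O (r k).
  elim: k => [|k IH] /=; first exact: (integers0 hQ2).
  by case: (hf (r k + x k)) => //; exact: (integersD hQ2).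
have rS k : r k + x k = \sum_i (eps k i)%:R * e i + 2%:R * r k.+1.
  by case: (hf (r k + x k)) => //; exact: (integersD hQ2).
have pow2A n : (2%:R ^+ n)%:A = 2%:R ^+ n :> F.
  by rewrite -[_%:A]/(in_alg F _) rmorphXn rmorph_nat.
pose A i n : Q2 := \sum_(j < n) 2%:R ^+ j * (eps j i)%:R.
have partial n : \sum_(j < n) 2%:R ^+ j * x j = \sum_i A i n *: e i +
  2%:R ^+ n * r n.
  elim: n => [|n IH].
    rewrite big_ord0 /= mulr0 addr0 big1 // => i _.
    by rewrite /A big_ord0 scale0r.
  rewrite big_ord_recr IH.
  have -> : \sum_i A i n.+1 *: e i
     = \sum_i A i n *: e i + 2%:R ^+ n * \sum_i (eps n i)%:R * e i.
    rewrite mulr_sumr -big_split; apply: eq_bigr => i _ /=.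
    rewrite /A big_ord_recr /= scalerDl; congr (_ + _).
    by rewrite -scalerA scaler_nat -mulr_algl pow2A mulr_natl.
  have -> : x n = \sum_i (eps n i)%:R * e i + 2%:R * r n.+1 - r n
    by rewrite -rS addrAC subrr add0r.
  by rewrite exprSr -[nat_of_ord ord_max]/n
    -[Algebra.Algebra_add__canonical__Monoid_Law _ _ _]/(_ + _); ring.
have beps (b : bool) : abs2 b%:R <= 1.
  by case: b; rewrite ?(abs2_1 hQ2) ?(abs2_0 hQ2).
have [l hl] := choice (fun i => Q2_series (fun j => beps (eps j i))).
have hmul n : mult (2%:R ^+ n) (\sum_i l i *: e i - \sum_(j < n) 2%:R ^+ j * x j).
  rewrite partial opprD addrA; apply: (multipleB hQ2); last by exists (r n).
  rewrite -sumrB; apply: (multiple_sum hQ2) => i _; rewrite -scalerBl.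
  have t0 : (2%:R : Q2) ^+ n != 0 by rewrite expf_neq0 // (Q2_natr_eq0 hQ2).
  exists (((l i - A i n) / 2%:R ^+ n) *: e i).
    apply: (integersZ hQ2) => //;
      rewrite (abs2M hQ2) (abs2V hQ2) (abs2X hQ2) (abs2_2 hQ2).
    by rewrite ler_pdivrMr ?exprn_gt0 ?invr_gt0 ?ltr0n // mul1r; exact: hl.
  by rewrite -pow2A mulr_algl scalerA mulrC divfK.
exists (\sum_i l i *: e i) => //.
have [a aO] := hmul 0%N; rewrite big_ord0 subr0 expr0 mul1r => -> //.
Qed.

End Completeness.

Section Hensel.
Variables (R : realType) (Q2 : fieldType) (abs2 : Q2 -> R).
Hypothesis hQ2 : is_Q2 abs2.
Variables (F : fieldExtType Q2) (varpi : F).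
Hypothesis hvarpi : is_uniformizer abs2 varpi.
Local Notation O := (integers abs2 (F := F)).
Local Notation unit := (int_units abs2 (F := F)).
Local Notation mult := (multiple abs2).
Local Notation val := (valuation abs2 varpi).
Implicit Types x y : F.
Let w0 := uniformizer_neq0 hvarpi.
Let wO := integers_varpi hvarpi.
Let multS := multiple_expS hQ2 hvarpi.

(** Iterating s |-> e + c s^2 from 0 stays in varpi O, where it is contracting: the difference of
    two squares gains the factor s_(n+1) + s_n. *)
Lemma hensel_quadratic k (e c : F) : mult (varpi ^+ k.+1) e -> O c ->
  exists2 s, mult (varpi ^+ k.+1) s & s = e + c * s ^+ 2.
Proof.
move=> he cO; pose s := fix s n := if n is n'.+1 then e + c * s n' ^+ 2 else 0.
have hs n : mult (varpi ^+ k.+1) (s n).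
  elim: n => [|n IH] /=; first exact: (multiple0 hQ2).
  apply: (multipleD hQ2) => //; apply: (multipleMl hQ2) => //.
  rewrite expr2; apply: (multipleMl hQ2) => //.
  by apply: (multiple_integer hQ2) IH; exact: (integersX hQ2).
have hs1 n : mult varpi (s n) by apply: (@multS 1 k.+1).
have hd n : mult (varpi ^+ n) (s n.+1 - s n).
  elim: n => [|n IH].
    by rewrite expr0; exists (s 1%N - s 0%N); rewrite ?mul1r //;
      apply: (integersB hQ2);
      apply: (multiple_integer hQ2) (hs1 _).
  have -> : s n.+2 - s n.+1 = c * ((s n.+1 + s n) * (s n.+1 - s n)).
    by rewrite -[s n.+2]/(e + c * s n.+1 ^+ 2) -{2}[s n.+1]/(e + c * s n ^+ 2);
      ring.
  by apply: (multipleMl hQ2) => //; rewrite exprS; apply: (multipleMM hQ2) => //;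
    exact: (multipleD hQ2).
have hd' n m : mult (varpi ^+ n) (s (n + m)%N - s n).
  elim: m => [|m IH]; first by rewrite addn0 subrr; exact: (multiple0 hQ2).
  rewrite addnS -(subrKA (s (n + m)%N)); apply: (multipleD hQ2) => //.
  by apply: multS (hd _); exact: leq_addr.
have [i i0 hi] := varpiX_multiple2 hQ2 hvarpi.
have hij j : mult (2%:R ^+ j) (varpi ^+ (i * j)).
  rewrite exprM; elim: j => [|j IH]; first by rewrite !expr0;
    exact: (multiple_self hQ2).
  by rewrite !exprS; exact: (multipleMM hQ2).
have h2j j : mult (varpi ^+ j) (2%:R ^+ j).
  elim: j => [|j IH]; first by rewrite !expr0; exact: (multiple_self hQ2).
  by rewrite !exprS; apply: (multipleMM hQ2) => //;
    exact: (two_multiple hQ2 hvarpi).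
(* Convergence is available for series in powers of 2 only, hence the subsequence of indices i j:
   there the differences are divisible by 2^j, since 2 divides varpi^i. *)
have hx j : exists x, O x /\ s (i * j.+1)%N - s (i * j)%N = 2%:R ^+ j * x.
  have := hd' (i * j)%N i;
    rewrite -mulnSr => /(multiple_trans hQ2 (hij j)) [x xO ex].
  by exists x.
have [x xP] := choice hx.
have [l lO hl] := integers_series hQ2 (fun j => (xP j).1).
have tele n : \sum_(j < n) 2%:R ^+ j * x j = s (i * n)%N.
  elim: n => [|n IH]; first by rewrite big_ord0 muln0.
  by rewrite big_ord_recr IH /= -(xP n).2 addrC subrK.
have hl' n : mult (varpi ^+ n) (l - s (i * n)%N).
  by rewrite -tele; exact: (multiple_trans hQ2 (h2j n)).
exists l.
  by rewrite -[l](subrK (s (i * k.+1)%N)); exact: (multipleD hQ2).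
apply/eqP; rewrite -subr_eq0; apply/eqP/(multiple_all_eq0 hQ2 hvarpi) => n.
set t := s (i * n)%N.
have -> : l - (e + c * l ^+ 2) = (l - t) - c * ((l +
  t) * (l - t)) - (s (i * n).+1 - t).
  by rewrite /= -/t; ring.
have ni : (n <= i * n)%N by rewrite leq_pmull.
apply: (multipleB hQ2); last exact: multS ni (hd _).
apply: (multipleB hQ2); first exact: hl'.
apply: (multipleMl hQ2) => //; apply: (multipleMl hQ2); last exact: hl'.
apply: (integersD hQ2) => //.
exact: (multiple_integer hQ2) (hs1 _).
Qed.

(** With s = 1 + 4e and u = 1 + 2x the equation u^2 = s becomes x = e - x^2. In the exponent i + i +
    M.+1 the two i's pay for the factor 4. *)
Lemma near1_square M : exists M', forall s, mult (varpi ^+ M') (s - 1) ->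
  exists2 u, mult (varpi ^+ M) (u - 1) & s = u ^+ 2.
Proof.
have [i i0 hi] := varpiX_multiple2 hQ2 hvarpi.
exists (i + i + M.+1)%N => s hs.
have [e he es] : exists2 e, mult (varpi ^+ M.+1) e & s - 1 = 2%:R * 2%:R * e.
  have : mult (2%:R * 2%:R * varpi ^+ M.+1) (s - 1).
    apply: (multiple_trans hQ2 _ hs); rewrite !exprD.
    by apply: (multipleMM hQ2);
      [exact: (multipleMM hQ2) | exact: (multiple_self hQ2)].
  case=> a aO ea; exists (varpi ^+ M.+1 * a); [by exists a | by rewrite mulrA].
have [x hx ex] := @hensel_quadratic M e (-1) he (integersN hQ2 (integers1 hQ2 F)).
exists (1 + 2%:R * x).
  rewrite addrAC subrr add0r; apply: (multipleMl hQ2);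
    first exact: (integers_nat hQ2).
  exact: multS (leqnSn _) hx.
have {}es : s = 1 + 2%:R * 2%:R * e by rewrite -es; ring.
have ee : e = x + x ^+ 2 by rewrite {1}ex; ring.
by rewrite es ee; ring.
Qed.

(** A unit has finite order d modulo varpi. For d odd, x^(d+1) is a square congruent to x; for d
    even, d can be halved, because in characteristic 2 a square equal to 1 has root 1. *)
Lemma residue_sqrt x : O x -> exists2 p, O p & mult varpi (p ^+ 2 - x).
Proof.
move=> xO; case: (pselect (unit x)) => [ux|/(nonunit_multiple hvarpi xO) h];
  last first.
  exists 0; first exact: (integers0 hQ2).
  by rewrite expr0n sub0r; exact: (multipleN hQ2).
have [i [j [ij h]]] := pigeonhole_residue hQ2 hvarpi (fun i => integersX hQ2 i xO).
have {ij h} [d d0 hd] : exists2 d, (0 < d)%N & mult varpi (x ^+ d - 1).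
  exists (j - i)%N; first by rewrite subn_gt0.
  have -> : x ^+ (j - i) - 1 = - ((x ^+ i)^-1 * (x ^+ i - x ^+ j)).
    rewrite -{2}(subnKC (ltnW ij)) exprD; field.
    by rewrite expf_neq0 //; case: ux.
  apply: (multipleN hQ2); apply: (multipleMl hQ2) => //.
  by rewrite -exprVn; apply: (integersX hQ2); case: ux.
elim/ltn_ind: d d0 hd => d IH d0 hd.
case od: (odd d).
  exists (x ^+ (d./2).+1); first exact: (integersX hQ2).
  rewrite -exprM.
  have -> : ((d./2).+1 * 2 = d.+1)%N by lia.
  have -> : x ^+ d.+1 - x = x * (x ^+ d - 1) by rewrite exprS; ring.
  exact: (multipleMl hQ2).
apply: (IH d./2); [lia | lia |].
have xd : x ^+ d = (x ^+ d./2) ^+ 2 by rewrite -exprM; congr (_ ^+ _); lia.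
apply: (multiple_prime hQ2 hvarpi).
  by apply: (integersB hQ2); [exact: (integersX hQ2) | exact: (integers1 hQ2)].
have -> : (x ^+ d./2 - 1) ^+ 2 = (x ^+ d - 1) - 2%:R * (x ^+ d./2 - 1)
  by rewrite xd; ring.
apply: (multipleB hQ2) => //; rewrite mulrC; apply: (multipleMl hQ2).
  by apply: (integersB hQ2); [exact: (integersX hQ2) | exact: (integers1 hQ2)].
exact: (two_multiple hQ2 hvarpi).
Qed.

(* In the finite residue field x |-> x^2 + x is additive and kills 1, hence it
   is not surjective: an infinite chain of preimages of 1 would contradict the
   pigeonhole principle. *)
Lemma artin_schreier_nonsurjective :
  exists2 c, O c & forall x, O x -> ~ mult varpi (x ^+ 2 + x - c).
Proof.
apply: contrapT => nex.
have H (c : F) : exists x, O c -> O x /\ mult varpi (x ^+ 2 + x - c).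
  case: (pselect (O c)) => [cO|h]; last by exists 0.
  apply: contrapT => nx; apply: nex; exists c => // x xO h; apply: nx.
  by exists x.
have [f hf] := choice H.
pose u n := iter n f 1.
have uO n : O (u n).
  elim: n => [|n IH]; first exact: (integers1 hQ2).
  by case: (hf (u n) IH).
have uS n : mult varpi (u n.+1 ^+ 2 + u n.+1 - u n) by case: (hf (u n) (uO n)).
have two x : O x -> mult varpi (2%:R * x).
  by move=> xO; rewrite mulrC; apply: (multipleMl hQ2) => //;
    exact: (two_multiple hQ2 hvarpi).
have step a b : mult varpi (u a.+1 - u b.+1) -> mult varpi (u a - u b).
  move=> h; have -> : u a - u b = (u a.+1 - u b.+1) * (u a.+1 + u b.+1 + 1)
     - (u a.+1 ^+ 2 + u a.+1 - u a) + (u b.+1 ^+ 2 + u b.+1 - u b) by ring.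
  apply: (multipleD hQ2) => //; apply: (multipleB hQ2) => //.
  rewrite mulrC; apply: (multipleMl hQ2) => //.
  by apply: (integersD hQ2); [exact: (integersD hQ2) | exact: (integers1 hQ2)].
have step0 n : mult varpi (u n.+1) -> mult varpi (u n).
  move=> h; have -> : u n = (u n.+1 + 1) * u n.+1 - (u n.+1 ^+ 2 + u n.+1 - u n)
    by ring.
  apply: (multipleB hQ2) => //; apply: (multipleMl hQ2) => //.
  by apply: (integersD hQ2) => //; exact: (integers1 hQ2).
have [i [j [ij h]]] := pigeonhole_residue hQ2 hvarpi uO.
have {i j ij h} [d h] : exists d, mult varpi (u 0%N - u d.+1).
  exists (j - i).-1; rewrite prednK ?subn_gt0 //.
  elim: i j ij h => [|i IH] [//|j] ij h; first by rewrite subn0.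
  by rewrite subSS; apply: IH => //; exact: step.
have {}h : mult varpi (u d).
  have -> : u d = (u d.+1 - u 0%N) * (u d.+1 + 2%:R) + 2%:R * 1
       - (u d.+1 ^+ 2 + u d.+1 - u d) by rewrite (erefl : u 0%N = 1);
         move: (u d.+1) (u d) => a b; ring.
  apply: (multipleB hQ2) => //; apply: (multipleD hQ2).
    rewrite mulrC; apply: (multipleMl hQ2).
      by apply: (integersD hQ2) => //; exact: (integers_nat hQ2).
    by rewrite -opprB; exact: (multipleN hQ2).
  by apply: two; exact: (integers1 hQ2).
have {}h : mult varpi (u 0%N) by elim: d h => // d IH /step0.
exact: (multiple_unit hQ2 hvarpi (int_unit1 hQ2 F)) h.
Qed.

(** With t = 1 + 4c the norm form of F(sqrt t) in the basis 1, (1 + sqrt t)/2 is p^2 + p q - c q^2.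
    By the choice of c it does not vanish modulo varpi on primitive vectors, so norms have even
    valuation. A unit b is a norm: p is a square root of b modulo varpi and q is the correction. *)
Lemma unramified_unit : exists t, [/\ unit t,
    forall b, unit b -> hilbert t b
  & forall a, a != 0 -> hilbert a t -> exists k : int, val a = 2 * k].
Proof.
have [c cO hc] := artin_schreier_nonsurjective.
have t0 := fieldext_two_neq0 hQ2 F.
pose t := 1 + 2%:R * 2%:R * c.
have normE p q : (p + q / 2%:R) ^+ 2 - t * (q / 2%:R) ^+ 2 = p ^+ 2 +
  p * q - c * q ^+ 2.
  by rewrite /t; field.
(* the norm form is anisotropic modulo varpi *)
have valN y : y ^+ 2 + y - c != 0 /\ exists k, val (y ^+ 2 + y - c) = 2 * k.
  case: (pselect (O y)) => [yO|nyO].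
    have u : unit (y ^+ 2 + y - c).
      apply: contrapT => /(nonunit_multiple hvarpi) h; apply: (hc y) => //;
        apply: h.
      by apply: (integersB hQ2) => //; apply: (integersD hQ2) => //;
        exact: (integersX hQ2).
    by split; [case: u | exists 0; rewrite (valuation_unit hQ2 hvarpi u)].
  have y0 : y != 0 by apply: contra_notN nyO => /eqP ->; exact: (integers0 hQ2).
  have hy : val y < 0 by rewrite ltNge;
    apply/negP => /(integer_valuation hQ2 hvarpi y0).
  have yV : mult varpi y^-1.
    apply: (@multiple_valuation _ _ _ hQ2 _ _ hvarpi 1); rewrite ?invr_eq0 //.
    by rewrite (valuationV hQ2 hvarpi); lia.
  have yVO : O y^-1 by exact: (multiple_integer hQ2) yV.
  have u : unit (1 + y^-1 * (1 - c * y^-1)).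
    apply: (unit_add_multiple hQ2 hvarpi); first exact: (int_unit1 hQ2).
    rewrite mulrC; apply: (multipleMl hQ2) => //; apply: (integersB hQ2).
      exact: (integers1 hQ2).
    exact: (integersM hQ2).
  have -> : y ^+ 2 + y - c = y ^+ 2 * (1 + y^-1 * (1 - c * y^-1)) by field.
  have un0 : 1 + y^-1 * (1 - c * y^-1) != 0 by case: u.
  split; first by rewrite mulf_neq0 // expf_neq0.
  exists (val y); rewrite (valuationM hQ2 hvarpi) ?expf_neq0 //.
  by rewrite (valuation_unit hQ2 hvarpi u) addr0 exprnP (valuationXz hQ2 hvarpi).
have ut : unit t.
  apply: (unit_add_multiple hQ2 hvarpi); first exact: (int_unit1 hQ2).
  rewrite -mulrA mulrC; apply: (multipleMl hQ2);
    last exact: (two_multiple hQ2 hvarpi).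
  by apply: (integersM hQ2) => //; exact: (integers_nat hQ2).
have tn0 : t != 0 by case: ut.
exists t; split=> // [b ub|a a0 /asboolP [x [y [z [nz ez]]]]].
  have [b0 bO bV] := ub.
  have [p pO hp] := residue_sqrt bO.
  have up2 : unit (p ^+ 2).
    by rewrite -[p ^+ 2](subrK b) addrC; apply: (unit_add_multiple hQ2 hvarpi).
  have p0 : p != 0 by case: up2; rewrite expf_eq0.
  have pV : O p^-1.
    case: up2 => _ _ h; have -> : p^-1 = p * (p ^+ 2)^-1 by field.
    exact: (integersM hQ2).
  have h1 : mult (varpi ^+ 1) ((b - p ^+ 2) / p).
    rewrite mulrC; apply: (multipleMl hQ2) => //.
    by rewrite -opprB; exact: (multipleN hQ2).
  (* The equation b = p^2 + p q - c q^2 solved for its linear occurrence of q. *)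
  have [q _ eq_q] := hensel_quadratic h1 (integersM hQ2 cO pV).
  apply/asboolP; exists (q / 2%:R), 1, (p + q / 2%:R); split.
    by case=> _ /eqP; rewrite oner_eq0.
  rewrite expr1n mulr1; apply/eqP; rewrite [eqbRHS]addrC -subr_eq normE; apply/eqP.
  have : q * p = (b - p ^+ 2) + c * q ^+ 2 by rewrite {1}eq_q; field.
  by rewrite [q * p]mulrC => ->; ring.
have [x0|x0] := eqVneq x 0.
  have y0 : y != 0.
    apply: contra_notN nz => /eqP y0; move: ez;
      rewrite x0 y0 expr0n /= !mulr0 addr0.
    by move=> /eqP; rewrite expf_eq0 => /andP [_ /eqP ->].
  have [+ _] := valN ((z / y - 1) / 2%:R);
    rewrite -(inj_eq (mulfI (expf_neq0 2 t0))) mulr0 => /eqP; case.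
  have -> : 2%:R ^+ 2 * (((z / y - 1) / 2%:R) ^+ 2 +
    (z / y - 1) / 2%:R - c) = z ^+ 2 / y ^+ 2 - t.
    by rewrite /t; field; rewrite ?t0 ?y0.
  by rewrite ez x0 expr0n /= mulr0 add0r mulfK ?expf_neq0 // subrr.
have ea : a = (z / x) ^+ 2 - t * (y / x) ^+ 2.
  have e : z ^+ 2 - t * y ^+ 2 = a * x ^+ 2 by rewrite ez; ring.
  by apply: (mulIf (expf_neq0 2 x0)); rewrite -e; field; rewrite x0.
(* Coordinates of (z + y sqrt t)/x in the basis 1, (1 + sqrt t)/2; the case x = 0, excluded above,
   would make t a square. *)
pose q := 2%:R * (y / x); pose p := z / x - y / x.
have {}ea : a = p ^+ 2 + p * q - c * q ^+ 2.
  by rewrite -normE ea /p /q; field; rewrite ?x0 ?t0.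
have [q0|q0] := eqVneq q 0.
  have {}ea : a = p ^+ 2 by rewrite ea q0; ring.
  exists (val p); rewrite ea exprnP (valuationXz hQ2 hvarpi) //.
  by apply: contra_neq a0; rewrite ea => ->; rewrite expr0n.
have [n0 [k hk]] := valN (p / q).
exists (val q + k).
have -> : a = q ^+ 2 * ((p / q) ^+ 2 + p / q - c) by rewrite ea; field.
rewrite (valuationM hQ2 hvarpi) ?expf_neq0 // hk exprnP (valuationXz hQ2 hvarpi) //.
lia.
Qed.

(** Separability of F^x in multiplicative form, which will bound the dimension of a smooth
    irreducible representation. The approximants are powers of varpi times combinations of the e_i
    with natural coefficients. *)
Lemma countable_approximation : exists (I : countType) (D : I -> F),
  forall M s, s != 0 -> exists i, D i != 0 /\ mult (varpi ^+ M) (s / D i - 1).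
Proof.
have [m [e [eO he]]] := integers_mod2_basis hQ2 F.
have approx n x : O x -> exists k : {ffun 'I_m -> nat},
    mult (2%:R ^+ n) (x - \sum_i (k i)%:R * e i).
  elim: n x => [|n IH] x xO.
    exists [ffun=> 0%N]; rewrite big1 => [|i _]; last by rewrite ffunE mul0r.
    by rewrite subr0; exists x; rewrite ?expr0 ?mul1r.
  have [eps [x' x'O ex]] := he x xO.
  have [k hk] := IH x' x'O.
  exists [ffun i => (eps i + 2 * k i)%N].
  have -> : \sum_i ([ffun i => (eps i + 2 * k i)%N] i)%:R * e i
      = \sum_i (eps i)%:R * e i + 2%:R * \sum_i (k i)%:R * e i.
    rewrite mulr_sumr -big_split; apply: eq_bigr => i _.
    rewrite ffunE natrD natrM mulrDl -mulrA; reflexivity.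
  rewrite opprD addrA ex -mulrBr exprS.
  by apply: (multipleMM hQ2) => //; exact: (multiple_self hQ2).
exists (int * {ffun 'I_m -> nat})%type, (fun p : int * {ffun 'I_m ->
  nat} => varpi ^ p.1 * \sum_i (p.2 i)%:R * e i).
move=> M s s0; have us := valuationP hQ2 hvarpi s0.
set u := s / _ in us; have [u0 uO uV] := us.
have [k hk] := approx M.+1 u uO.
set d := \sum_i _ in hk.
have {}hk : mult (varpi ^+ M.+1) (u - d).
  apply: (multiple_trans hQ2 _ hk).
  elim: M.+1 => [|j IH]; first by rewrite !expr0; exact: (multiple_self hQ2).
  by rewrite !exprS; apply: (multipleMM hQ2) => //;
    exact: (two_multiple hQ2 hvarpi).
have ud : unit d.
  rewrite -[d](subKr u); apply: (unit_add_multiple hQ2 hvarpi) => //.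
  by apply: (multipleN hQ2); apply: (@multS 1 M.+1).
have [d0 _ dV] := ud.
exists (val s, k); rewrite /= -/d mulf_neq0 ?expfz_neq0 //; split=> //.
have -> : s / (varpi ^ val s * d) - 1 = d^-1 * (u - d).
  by rewrite invfM mulrA -/u mulrBr mulVf // mulrC.
by apply: (multipleMl hQ2) => //; exact: multS (leqnSn _) hk.
Qed.

Lemma near1M M s t : mult (varpi ^+ M) (s - 1) -> mult (varpi ^+ M) (t - 1) ->
  mult (varpi ^+ M) (s * t - 1).
Proof.
move=> hs ht; have -> : s * t - 1 = s * (t - 1) + (s - 1) by ring.
apply: (multipleD hQ2) => //; apply: (multipleMl hQ2) => //.
rewrite -[s](subrK 1); apply: (integersD hQ2); last exact: (integers1 hQ2).
by apply: (multiple_integer hQ2) hs; exact: (integersX hQ2).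
Qed.

Lemma near1_unit M s : mult (varpi ^+ M.+1) (s - 1) -> unit s.
Proof.
move=> hs; rewrite -[s](subrK 1) addrC; apply: (unit_add_multiple hQ2 hvarpi).
  exact: (int_unit1 hQ2).
exact: (@multS 1 M.+1).
Qed.

Lemma near1V M s : mult (varpi ^+ M.+1) (s - 1) -> mult (varpi ^+ M.+1) (s^-1 - 1).
Proof.
move=> hs; have [s0 _ sV] := near1_unit hs.
have -> : s^-1 - 1 = - (s^-1 * (s - 1)) by field.
by apply: (multipleN hQ2); exact: (multipleMl hQ2).
Qed.

Lemma near1Xz M s (k : int) : mult (varpi ^+ M.+1) (s - 1) ->
  mult (varpi ^+ M.+1) (s ^ k - 1).
Proof.
move=> hs; case: k => n.
  elim: n => [|n IH]; first by rewrite expr0z subrr; exact: (multiple0 hQ2).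
  by rewrite -exprnP (exprS s); exact: near1M hs IH.
rewrite NegzE -exprnN; apply: near1V.
elim: n => [|n IH]; first by rewrite expr1.
by rewrite (exprS s); exact: near1M.
Qed.

Lemma near1_prod M (I : Type) (r : seq I) (P : pred I) (f : I -> F) :
  (forall i, P i -> mult (varpi ^+ M) (f i - 1)) ->
  mult (varpi ^+ M) (\prod_(i <- r | P i) f i - 1).
Proof.
move=> H; apply: (big_ind (fun z => mult (varpi ^+ M) (z - 1))) => //.
  by rewrite subrr; exact: (multiple0 hQ2).
by move=> s t; exact: near1M.
Qed.

End Hensel.

(** * The torus action of an sl2-triple *)
Section SL2.
Variables (F : fieldType) (N : nat).
Hypothesis char0 : forall n, (n%:R == 0 :> F) = (n == 0%N).
Local Notation M := 'M[F]_N.+1.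
Implicit Types (A B : M) (t s : F) (m : 'I_N.+1 -> int).

Lemma char0_intr_eq0 (n : int) : (n%:~R == 0 :> F) = (n == 0).
Proof.
have H k : ((Posz k)%:~R == 0 :> F) = (Posz k == 0) by rewrite -pmulrn char0.
by case: n => n; rewrite ?NegzE ?mulrNz ?oppr_eq0 H.
Qed.

Lemma char0_intr_inj (a b : int) : a%:~R = b%:~R :> F -> a = b.
Proof. by move=> /eqP;
  rewrite -subr_eq0 -rmorphB char0_intr_eq0 subr_eq0 => /eqP. Qed.

Definition mexp n A t : M := \sum_(k < n) (t ^+ k / k`!%:R) *: A ^+ k.

Definition Hdiag m : M := diag_mx (\row_j (m j)%:~R).

Definition tdiag m t : M := diag_mx (\row_j (t ^ m j)).

Lemma mulmx_diagl (f : 'I_N.+1 ->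
  F) A i j : (diag_mx (\row_j f j) * A) i j = f i * A i j.
Proof. by rewrite -[_ * A]/(_ *m A) mul_diag_mx !mxE. Qed.

Lemma mulmx_diagr (f : 'I_N.+1 ->
  F) A i j : (A * diag_mx (\row_j f j)) i j = A i j * f j.
Proof. by rewrite -[A * _]/(A *m _) mul_mx_diag !mxE. Qed.

Lemma weight_entry m A (n : int) : Hdiag m * A - A * Hdiag m = n%:~R *: A ->
  forall i j, A i j != 0 -> m i = m j + n.
Proof.
move=> h i j Aij; have := congr1 (fun B : M => B i j) h.
rewrite mxE [X in _ + X]mxE mulmx_diagl mulmx_diagr mxE mulrC -mulrBr mulrC.
by move/(mulIf Aij); rewrite -rmorphB => /char0_intr_inj <-; ring.
Qed.

(** A nonzero entry (i, j) of A^k comes from a chain of k indices below i along which f decreases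
    strictly, and at most N of the N.+1 indices lie below i. *)
Lemma weight_nilpotent (f : 'I_N.+1 -> int) A :
  (forall i j, A i j != 0 -> f j < f i) -> A ^+ N.+1 = 0.
Proof.
move=> H.
have P k i j : (A ^+ k) i j != 0 -> (k <= #|[set l | (f l < f i)%R]%SET|)%N.
  elim: k i j => [//|k IH] i j; rewrite exprS -[A * _]/(A *m _) mxE.
  move=> h; have [l hl] : exists l, A i l * (A ^+ k) l j != 0.
    apply: contrapT => nex; move: h; rewrite big1 ?eqxx // => l _.
    by apply/eqP/negPn/negP => h; apply: nex; exists l.
  move: hl; rewrite mulf_eq0 negb_or => /andP [/H fl /IH kl].
  apply: leq_ltn_trans kl (proper_card _); apply/properP; split.
    by apply/fintype.subsetP => x; rewrite !inE => /lt_trans; apply.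
  by exists l; rewrite !inE ?ltxx.
apply/matrixP=> i j; rewrite [RHS]mxE; apply/eqP/negPn/negP => /P.
have : (#|[set l | (f l < f i)%R]%SET| < #|[set: 'I_N.+1]%SET|)%N.
  apply: proper_card; apply/properP; split; first exact: finset.subsetT.
  by exists i; rewrite !inE ?ltxx.
by rewrite cardsT card_ord => h1 h2; have := leq_trans h1 h2; rewrite ltnn.
Qed.

Lemma mexp_widen n A t : A ^+ N.+1 = 0 -> (N.+1 <= n)%N ->
  mexp n A t = mexp N.+1 A t.
Proof.
move=> A0 /subnKC <-; rewrite /mexp big_split_ord /= [X in _ + X]big1 ?addr0 //.
by move=> i _; rewrite (exprD A) A0 mul0r scaler0.
Qed.

Lemma fact_neq0 k : (k`!%:R : F) != 0.
Proof. by rewrite char0 -lt0n fact_gt0. Qed.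

Lemma mexp_shift n A t :
  \sum_(k < n.+1) (t ^+ k / k`!%:R * k%:R) *: A ^+ k.-1 = t *: mexp n A t.
Proof.
rewrite big_ord_recl /= mulr0 scale0r add0r /mexp scaler_sumr.
apply: eq_bigr => i _; rewrite scalerA; congr (_ *: _).
rewrite /bump add1n factS natrM exprS; move: (negbT (char0 i.+1)) (fact_neq0 i).
by move: (i.+1%:R : F) (i`!%:R : F) => a f a0 f0; field; rewrite a0 f0.
Qed.

Lemma mexp_shift2 n A t :
  \sum_(k < n.+2) (t ^+ k / k`!%:R * (k * k.-1)%:R) *: A ^+ k.-1
    = t ^+ 2 *: (A * mexp n A t).
Proof.
rewrite big_ord_recl /= mulr0 scale0r add0r big_ord_recl /= mulr0 scale0r add0r.
rewrite /mexp mulr_sumr scaler_sumr.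
apply: eq_bigr => i _; rewrite -scalerAr -exprS scalerA; congr (_ *: _).
rewrite /bump !add1n /= !factS !natrM !exprS expr0 mulr1.
move: (negbT (char0 i.+1)) (negbT (char0 i.+2)) (fact_neq0 i).
move: (i.+1%:R : F) (i.+2%:R : F) (i`!%:R : F) => a b f a0 b0 f0.
by field; rewrite a0 b0 f0.
Qed.

(** This is exp(t A) B exp(-t A) = B + t [A, B], all further brackets being zero. The exponential is
    lengthened by vanishing terms so that shifting the summation index loses nothing. *)
Lemma mexp_comm1 A B (c : F) t : A ^+ N.+1 = 0 -> A * B - B * A = c *: A ->
  mexp N.+1 A t * B = (B + (t * c) *: A) * mexp N.+1 A t.
Proof.
move=> A0 h.
have e k : A ^+ k * B = B * A ^+ k + (k%:R * c) *: A ^+ k.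
  elim: k => [|k IH]; first by rewrite !expr0 mul1r mulr1 mul0r scale0r addr0.
  rewrite {1}exprS -mulrA IH mulrDr mulrA.
  have -> : A * B = B * A + c *: A by rewrite -h addrC subrK.
  rewrite mulrDl -mulrA -exprS -!scalerAr -!scalerAl -exprS -addrA -scalerDl.
  by congr (_ + _ *: _); rewrite -natr1; ring.
rewrite -(@mexp_widen N.+2) //.
have e1 : mexp N.+2 A t * B = B * mexp N.+2 A t +
   c *: (A * \sum_(k < N.+2) (t ^+ k / k`!%:R * k%:R) *: A ^+ k.-1).
  rewrite /mexp mulr_suml !mulr_sumr scaler_sumr -big_split;
    apply: eq_bigr => k _ /=.
  rewrite -scalerAl e scalerDr -!scalerAr; congr (_ + _).
  case: k => -[|k] hk /=; first by rewrite !(mul0r, mulr0, scale0r, scaler0).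
  by rewrite -exprS !scalerA; congr (_ *: _); ring.
rewrite e1 mexp_shift (@mexp_widen N.+2) // mulrDl -!scalerAl -scalerAr scalerA.
by rewrite [c * t]mulrC.
Qed.

(** Here exp(t ad A) B ends with the second bracket: [A, B] = -H and [A, H] = 2A, so the quadratic
    term is -t^2 A. *)
Lemma mexp_comm2 A B m t : A ^+ N.+1 = 0 -> A * B - B * A = - Hdiag m ->
  Hdiag m * A - A * Hdiag m = - (2%:R *: A) ->
  mexp N.+1 A t * B = (B - t *: Hdiag m - t ^+ 2 *: A) * mexp N.+1 A t.
Proof.
move=> A0 h1 h2; set H := Hdiag m in h1 h2 *.
have AB : A * B = B * A - H by rewrite -h1 addrC subrK.
have AH : A * H = H * A + 2%:R *: A.
  by rewrite -[2%:R *: A]opprK -h2 opprB addrC subrK.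
have e k : A ^+ k * B =
  B * A ^+ k - k%:R *: (H * A ^+ k.-1) - (k * k.-1)%:R *: A ^+ k.-1.
  elim: k => [|k IH]; first by rewrite !expr0 mul1r mulr1 !scale0r !subr0.
  rewrite {1}exprS -mulrA IH !mulrBr mulrA AB mulrBl -!scalerAr !mulrA AH.
  case: k {IH} => [|k] /=.
    by rewrite !expr0 !expr1 !mulr1 mul0n !scale0r scale1r !subr0.
  rewrite mulrDl -!scalerAl -!mulrA -!exprS !scalerDr scalerA.
  have -> : ((k.+2 * k.+1)%N%:R : F) = k.+1%:R * 2%:R + (k.+1 * k)%N%:R.
    by rewrite !natrM -!natr1; ring.
  rewrite -[k.+2%:R]natr1; set U := B * _; set V := H * _; set W := A ^+ _;
    move: U V W => U V W.
  by apply/matrixP => i j; rewrite !mxE; ring.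
have w3 : mexp N.+3 A t = mexp N.+1 A t by apply: mexp_widen => //; lia.
have w2 : mexp N.+2 A t = mexp N.+1 A t by apply: mexp_widen => //; lia.
rewrite -[in LHS]w3.
have e1 : mexp N.+3 A t * B = B * mexp N.+3 A t
   - H * (\sum_(k < N.+3) (t ^+ k / k`!%:R * k%:R) *: A ^+ k.-1)
   - (\sum_(k < N.+3) (t ^+ k / k`!%:R * (k * k.-1)%:R) *: A ^+ k.-1).
  rewrite /mexp mulr_suml !mulr_sumr -!sumrB; apply: eq_bigr => k _ /=.
  by rewrite -scalerAl e !scalerBr -!scalerAr !scalerA.
rewrite e1 mexp_shift mexp_shift2 w3 w2.
by rewrite !mulrBl -!scalerAl -!scalerAr.
Qed.

Section Triple.
Variables (m : 'I_N.+1 -> int) (E Fm : M).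
Local Notation H := (Hdiag m).
Hypothesis HE : H * E - E * H = 2%:~R *: E.
Hypothesis HF : H * Fm - Fm * H = (-2)%:~R *: Fm.
Hypothesis EF : E * Fm - Fm * E = H.

Lemma triple_nilpotentE : E ^+ N.+1 = 0.
Proof. by apply: (@weight_nilpotent m) => i j /(weight_entry HE) ->;
  rewrite ltrDl. Qed.

Lemma triple_nilpotentF : Fm ^+ N.+1 = 0.
Proof.
apply: (@weight_nilpotent (fun i => - m i)) => i j /(weight_entry HF) ->.
by rewrite ltrN2 gtrDl.
Qed.

Definition mexpw t := mexp N.+1 E t * mexp N.+1 Fm (- t^-1) * mexp N.+1 E t.

Lemma mexpw_H t : t != 0 -> mexpw t * H = - (H * mexpw t).
Proof.
move=> t0; rewrite /mexpw; set x := mexp N.+1 E t; set s := - t^-1;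
  set y := mexp _ Fm s.
have HE' : E * H - H * E = (- 2%:R) *: E.
  by rewrite -opprB HE scaleNr.
have xH : x * H = (H + (t * - 2%:R) *: E) * x.
  exact: mexp_comm1 triple_nilpotentE HE'.
have xE : x * E = E * x.
  rewrite /x; have := @mexp_comm1 E E 0 t triple_nilpotentE.
  by rewrite mulr0 scale0r addr0; apply; rewrite subrr.
have yH : y * H = (H + (s * 2%:R) *: Fm) * y.
  apply: mexp_comm1 triple_nilpotentF _.
  by rewrite -opprB HF -scaleNr -mulrNz opprK.
have yE : y * E = (E - s *: H - s ^+ 2 *: Fm) * y.
  apply: mexp_comm2 triple_nilpotentF _ _; first by rewrite -EF opprB.
  by rewrite HF mulrNz scaleNr.
have ts : t * s = -1 by rewrite /s mulrN divff.
(* Since t s = -1, the middle exponential reverses the sign of H and fixes the multiple of E that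
   the outer ones add and remove. *)
have key : y * (H + (t * - 2%:R) *: E) = (- H + (t * - 2%:R) *: E) * y.
  rewrite mulrDr yH -scalerAr yE scalerAl -mulrDl; congr (_ * _).
  have e1 : t * - 2%:R * s = 2%:R by rewrite mulrAC ts; ring.
  have e2 : t * - 2%:R * s ^+ 2 = s * 2%:R.
    by rewrite expr2 mulrA [t * - 2%:R * s]mulrAC ts; ring.
  rewrite !scalerBr !scalerA e1 e2.
  by move: H (s *2%:R) (t * - 2%:R) => Z a b; apply/matrixP => i j; rewrite !mxE;
    ring.
rewrite -mulrA xH mulrA -[_ * y * _]mulrA key [x * (_ * y)]mulrA mulrDr mulrN xH.
rewrite -scalerAr xE scalerAl -mulNr -mulrDl.
have -> : - (H + (t * - 2%:R) *: E) + (t * - 2%:R) *: E = - H.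
  by rewrite opprD subrK.
by rewrite !mulNr !mulrA.
Qed.

Lemma mexpw_entry t i j : t != 0 -> mexpw t i j != 0 -> m j = - m i.
Proof.
move=> t0 wij; have := congr1 (fun B : M => B i j) (mexpw_H t0).
rewrite mulmx_diagr [RHS]mxE mulmx_diagl mulrC -mulNr -rmorphN => /(mulIf wij).
exact: char0_intr_inj.
Qed.

End Triple.

Lemma tdiag_mexp m A (n : int) s u k : s != 0 ->
  (forall i j, A i j != 0 -> m i = m j + n) ->
  tdiag m s * mexp k A u = mexp k A (s ^ n * u) * tdiag m s.
Proof.
move=> s0 H.
have e1 : tdiag m s * A = s ^ n *: (A * tdiag m s).
  apply/matrixP => i j; rewrite mulmx_diagl [RHS]mxE mulmx_diagr.
  have [->|/H ->] := eqVneq (A i j) 0; first by rewrite mulr0 mul0r mulr0.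
  by rewrite expfzDr //; ring.
have e l : tdiag m s * A ^+ l = (s ^ n) ^+ l *: (A ^+ l * tdiag m s).
  elim: l => [|l IH]; first by rewrite !expr0 mul1r mulr1 scale1r.
  rewrite (exprS A) mulrA e1 -scalerAl -[in LHS]mulrA IH -scalerAr scalerA mulrA.
  by rewrite (exprS (s ^ n)).
rewrite /mexp mulr_sumr mulr_suml; apply: eq_bigr => i _.
by rewrite -scalerAr e -scalerAl scalerA exprMn; congr (_ *: _); ring.
Qed.

Lemma mexpw_tdiag m (E Fm : M) t :
  Hdiag m * E - E * Hdiag m = 2%:~R *: E ->
  Hdiag m * Fm - Fm * Hdiag m = (-2)%:~R *: Fm ->
  E * Fm - Fm * E = Hdiag m -> t != 0 ->
  mexpw E Fm t = tdiag m t * mexpw E Fm 1.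
Proof.
(* Conjugation by t^(floor(m/2)) multiplies E by t although t need not be a
   square. *)
move=> HE HF EF t0; pose g i := (m i %/ 2)%Z.
have gE i j : E i j != 0 -> g i = g j + 1 by move/(weight_entry HE); rewrite /g;
  lia.
have gF i j : Fm i j != 0 -> g i = g j + (-1) by move/(weight_entry HF);
  rewrite /g; lia.
have conj : tdiag g t * mexpw E Fm 1 = mexpw E Fm t * tdiag g t.
  rewrite /mexpw !mulrA (tdiag_mexp _ _ t0 gE) -2![in LHS]mulrA [tdiag g t *
    _]mulrA.
  rewrite (tdiag_mexp _ _ t0 gF) -[in LHS]mulrA (tdiag_mexp _ _ t0 gE) !mulrA.
  by rewrite expr1z mulr1 invr1 mulrN1 -invr_expz expr1z.
apply/matrixP => i j; rewrite mulmx_diagl.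
have := congr1 (fun B : M => B i j) conj.
rewrite mulmx_diagl mulmx_diagr.
have [->|w0] := eqVneq (mexpw E Fm 1 i j) 0.
  by rewrite !mulr0 => /esym/eqP;
    rewrite mulf_eq0 (negbTE (expfz_neq0 _ t0)) orbF => /eqP.
have mj := mexpw_entry HE HF EF (oner_neq0 F) w0.
(* Because m j = - m i, rounding down gives g i - g j = m i whether m i is even or odd. *)
move=> h; apply: (mulIf (expfz_neq0 (g j) t0)); rewrite -h mulrAC -expfzDr //.
by congr (_ ^ _ * _); rewrite /g; lia.
Qed.

End SL2.

(** * Simply-laced root systems *)
Section Roots.
Variables (R : realType) (r : nat) (Phi : seq 'rV[R]_r) (Delta : 'I_r -> 'rV[R]_r).
Hypothesis hr : (2 <= r)%N.
Hypothesis hPhi : is_root_system Phi.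
Hypothesis hirr : irreducible_roots Phi.
Hypothesis hlaced : simply_laced Phi.
Hypothesis hDelta : is_base Phi Delta.
Implicit Types a b v : 'rV[R]_r.

Lemma dotE a b : dot a b = \sum_i a 0 i * b 0 i.
Proof. by rewrite /dot mxE; apply: eq_bigr => i _; rewrite mxE. Qed.

Lemma dotC a b : dot a b = dot b a.
Proof. by rewrite !dotE; apply: eq_bigr => i _; rewrite mulrC. Qed.

Lemma dotDl a b v : dot (a + b) v = dot a v + dot b v.
Proof. by rewrite /dot mulmxDl mxE. Qed.

Lemma dotZl k a b : dot (k *: a) b = k * dot a b.
Proof. by rewrite /dot -scalemxAl mxE. Qed.

Lemma dotDr a b v : dot v (a + b) = dot v a + dot v b.
Proof. by rewrite ![dot v _]dotC dotDl. Qed.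

Lemma dotZr k a b : dot a (k *: b) = k * dot a b.
Proof. by rewrite ![dot a _]dotC dotZl. Qed.

Lemma dotNl a b : dot (- a) b = - dot a b.
Proof. by rewrite -scaleN1r dotZl mulN1r. Qed.

Lemma dotNr a b : dot a (- b) = - dot a b.
Proof. by rewrite ![dot a _]dotC dotNl. Qed.

Lemma dot0l a : dot 0 a = 0. Proof. by rewrite -(scale0r 0) dotZl mul0r. Qed.

Lemma dot_suml (I : Type) (s : seq I) (f : I -> 'rV[R]_r) v :
  dot (\sum_(i <- s) f i) v = \sum_(i <- s) dot (f i) v.
Proof. by elim/big_rec2: _ => [|i x y _ <-]; rewrite ?dot0l // dotDl. Qed.

Lemma dot_sumr (I : Type) (s : seq I) (f : I -> 'rV[R]_r) v :
  dot v (\sum_(i <- s) f i) = \sum_(i <- s) dot v (f i).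
Proof. by rewrite dotC dot_suml; apply: eq_bigr => i _; rewrite dotC. Qed.

Lemma dot_gt0 a : a != 0 -> 0 < dot a a.
Proof.
move=> a0; rewrite dotE lt_neqAle sumr_ge0 ?andbT => [|i _];
  last by rewrite -expr2 sqr_ge0.
apply: contra_neq a0 => /esym/eqP; rewrite psumr_eq0 => [/allP h|i _];
  last by rewrite -expr2 sqr_ge0.
apply/rowP => i; rewrite mxE.
by have := h i (mem_index_enum _); rewrite /= mulf_eq0 orbb => /eqP.
Qed.

Lemma root_neq0 a : a \in Phi -> a != 0.
Proof. by move=> h; apply: contraNneq (roots_neq0 hPhi) => <-. Qed.

Lemma dot_root_neq0 a : a \in Phi -> dot a a != 0.
Proof. by move=> /root_neq0/dot_gt0/lt0r_neq0. Qed.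

Lemma cartanE v a : cartan v a = 2 / dot a a * dot v a.
Proof. by rewrite /cartan /coroot dotZr. Qed.

Lemma cartan_self a : a \in Phi -> cartan a a = 2.
Proof. by move=> /dot_root_neq0 h; rewrite cartanE divfK. Qed.

Lemma cartanNl v a : cartan (- v) a = - cartan v a.
Proof. by rewrite /cartan dotNl. Qed.

Lemma root_opp a : a \in Phi -> - a \in Phi.
Proof.
move=> ha; have := roots_refl hPhi ha ha.
by rewrite cartan_self // scaler_nat mulr2n opprD addrA subrr sub0r.
Qed.

Lemma cartanNr v a : cartan v (- a) = - cartan v a.
Proof. by rewrite !cartanE !(dotNl, dotNr) opprK mulrN. Qed.

Lemma cartan_int v a : cartan v a \is a Num.int ->
  cartan v a = (Num.floor (cartan v a))%:~R.
Proof. by move=> h; rewrite floorK. Qed.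

Lemma base_root i : Delta i \in Phi. Proof. by case: hDelta. Qed.

Lemma root_base_coords a : a \in Phi ->
  exists k : 'I_r -> int, a = \sum_i (k i)%:~R *: Delta i.
Proof.
case: hDelta => _ _ h /h [k [->|->]]; first by exists (fun i => (k i)%:Z).
exists (fun i => - (k i)%:Z); rewrite -sumrN; apply: eq_bigr => i _.
by rewrite mulrNz scaleNr -pmulrn.
Qed.

(** All roots have the same length, so taking coroots multiplies every root by one and the same
    scalar. *)
Lemma coroot_base_coords a (k : 'I_r -> int) : a \in Phi ->
  a = \sum_i (k i)%:~R *: Delta i ->
  coroot a = \sum_i (k i)%:~R *: coroot (Delta i).
Proof.
move=> ha e; rewrite /coroot [X in _ *: X = _]e scaler_sumr; apply: eq_bigr => i _.
by rewrite !scalerA mulrC (hlaced (base_root i) ha).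
Qed.

Lemma cartan_base_coords v a (k : 'I_r -> int) : a \in Phi ->
  a = \sum_i (k i)%:~R *: Delta i ->
  cartan v a = \sum_i (k i)%:~R * cartan v (Delta i).
Proof.
move=> ha e; rewrite /cartan (coroot_base_coords ha e) dot_sumr.
by apply: eq_bigr => i _; rewrite dotZr.
Qed.

Definition cartan_base i j : int := Num.floor (cartan (Delta j) (Delta i)).

Lemma cartan_baseE i j : cartan (Delta j) (Delta i) = (cartan_base i j)%:~R.
Proof. by apply: cartan_int; apply: (roots_int hPhi); exact: base_root. Qed.

Lemma even_coroot_latticeP (k : 'I_r -> int) :
  even_coroot_lattice Phi (\sum_i (k i)%:~R *: coroot (Delta i)) <->
  forall j, exists m, \sum_i k i * cartan_base i j = 2 * m.
Proof.
have e v : dot v (\sum_i (k i)%:~R *: coroot (Delta i)) =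
  \sum_i (k i)%:~R * cartan v (Delta i).
  by rewrite dot_sumr; apply: eq_bigr => i _; rewrite dotZr.
have eD j : dot (Delta j) (\sum_i (k i)%:~R *: coroot (Delta i))
    = (\sum_i k i * cartan_base i j)%:~R.
  rewrite e rmorph_sum; apply: eq_bigr => i _.
  by rewrite cartan_baseE -rmorphM.
split=> [[_ H] j|H].
  have [m hm] := H _ (base_root j); exists m; move: hm; rewrite eD.
  by rewrite -[2 : R]/((2 : int)%:~R) -rmorphM => /intr_inj.
split.
  exists r, k, (fun i => coroot (Delta i)); split=> // i.
  by exists (Delta i) => //; exact: base_root.
move=> a ha; have [l el] := root_base_coords ha; have [m hm] := choice H.
exists (\sum_j l j * m j); rewrite {1}el dot_suml rmorph_sum mulr_sumr.
apply: eq_bigr => j _; rewrite dotZl eD hm !rmorphM /=.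
by rewrite mulrCA.
Qed.

(** The matrix [B] of simple coroots is invertible because simple roots are independent, and its
    inverse gives the dual basis. These weights later recover the coordinates of a torus element. *)
Lemma fundamental_weight i : exists2 om, om \in (weight_lattice Phi : set _) &
  forall l, cartan om (Delta l) = (i == l)%:R.
Proof.
pose B : 'M[R]_r := \matrix_(l, j) coroot (Delta l) 0 j.
have Bu : B \in unitmx.
  rewrite -row_free_unit -kermx_eq0; apply/rowV0P => v /sub_kermxP vB.
  have f : free (codom Delta) by case: hDelta.
  apply/rowP => l; rewrite mxE.
  have hs : size (codom Delta) = r by rewrite size_codom card_ord.
  have := @freeP _ _ _ (tcast hs (in_tuple (codom Delta))).
  rewrite val_tcast => /(_ f) h.
  have h0 : forall i, v 0 i * (2 / dot (Delta i) (Delta i)) = 0.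
    apply: h.
    have e : v *m B = \sum_i (v 0 i * (2 / dot (Delta i) (Delta i))) *: Delta i.
      apply/rowP => j; rewrite mxE summxE; apply: eq_bigr => p _.
      by rewrite !mxE mulrA.
    rewrite -[RHS]vB e; apply: eq_bigr => p _; congr (_ *: _).
    by rewrite (nth_map p) ?size_enum_ord // nth_ord_enum.
  have := h0 l; move/eqP;
    rewrite !mulf_eq0 invr_eq0 (negbTE (dot_root_neq0 (base_root l))).
  by rewrite pnatr_eq0 !orbF => /eqP.
pose om := (delta_mx 0 i : 'rV[R]_r) *m (invmx B)^T.
have oml l : cartan om (Delta l) = (i == l)%:R.
  have -> : cartan om (Delta l) = (om *m B^T) 0 l.
    by rewrite /cartan dotE mxE; apply: eq_bigr => j _; rewrite !mxE.
  by rewrite /om -mulmxA -trmx_mul mulmxV // trmx1 mulmx1 mxE eqxx eq_sym.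
exists om => //; rewrite inE => a ha; have [k ek] := root_base_coords ha.
rewrite (cartan_base_coords _ ha ek); apply: rpred_sum => l _.
by rewrite oml rpredM // ?rpred_nat // intr_int.
Qed.

(** Rank at least 2 supplies a root outside {al, -al}, and irreducibility then a root neither
    proportional nor orthogonal to al. With equal lengths the Cartan integer lies strictly between
    -2 and 2, and a change of sign makes it -1. *)
Lemma root_pair_cartanN1 : exists a b, [/\ a \in Phi, b \in Phi & cartan b a = -1].
Proof.
pose p0 : 'I_r := Ordinal (ltnW hr); pose p1 : 'I_r := Ordinal hr.
pose al := Delta p0.
have hal : al \in Phi by exact: base_root.
have ne (k : R) : Delta p1 <> k *: al.
  move=> e; have f : free (codom Delta) by case: hDelta.
  have hs : size (codom Delta) = r by rewrite size_codom card_ord.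
  have := @freeP _ _ _ (tcast hs (in_tuple (codom Delta))).
  rewrite val_tcast => /(_ f) /(_ (fun i =>
    if i == p1 then 1 else if i == p0 then - k else 0)) h.
  have nthD i : (codom Delta)`_(nat_of_ord i) = Delta i.
    by rewrite (nth_map i) ?size_enum_ord // nth_ord_enum.
  suff /h /(_ p1) : \sum_(i < r) (if i == p1 then 1 else if i == p0 then - k else
    0) *:
      (codom Delta)`_i = 0 by rewrite eqxx => /eqP; rewrite oner_eq0.
  under eq_bigr => i _ do rewrite nthD.
  rewrite (bigD1 p1) //= (bigD1 p0) //= big1 => [|i].
    by rewrite e scale1r scaleNr addr0 subrr.
  by move=> /andP [/negbTE -> /negbTE ->]; rewrite scale0r.
have [||a [b [ha hb Aa nAb dab]]] := hirr (A := [set v | v = al \/ v = - al]).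
- by exists al => //; left.
- exists (Delta p1); first exact: base_root.
  by case=> h; [apply: (ne 1); rewrite scale1r | apply: (ne (-1));
    rewrite scaleN1r].
have [nba nbNa] : b - a != 0 /\ b + a != 0.
  split; apply/eqP => h; apply: nAb; rewrite /=.
    by move/eqP: h; rewrite subr_eq0 => /eqP ->.
  have -> : b = - a by apply/eqP; rewrite -addr_eq0 h.
  by case: Aa => ->; rewrite ?opprK; [right|left].
have L0 : 0 < dot a a by apply: dot_gt0; exact: root_neq0.
have hbb : dot b b = dot a a := hlaced hb ha.
have u1 : dot b a < dot a a.
  have := dot_gt0 nba; rewrite !(dotDl, dotDr, dotNl, dotNr) hbb [dot a b]dotC; lra.
have u2 : - dot a a < dot b a.
  have := dot_gt0 nbNa; rewrite !(dotDl, dotDr, dotNl, dotNr) hbb [dot a b]dotC;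
    lra.
have ci : cartan b a \is a Num.int by exact: (roots_int hPhi).
have c2 : cartan b a < 2 by rewrite cartanE mulrAC ltr_pdivrMr // ltr_pM2l.
have cN2 : -2 < cartan b a.
  by rewrite cartanE mulrAC ltr_pdivlMr // mulNr -mulrN ltr_pM2l.
have c0 : cartan b a != 0.
  by rewrite cartanE !mulf_eq0 invr_eq0 (gt_eqF L0) pnatr_eq0 dotC (negbTE dab).
move: (cartan_int ci); set n := Num.floor _ => en.
rewrite en in c2 cN2 c0.
have {}c2 : n < 2 by rewrite -(ltr_int R).
have {}cN2 : - 2 < n by rewrite -(ltr_int R).
rewrite intr_eq0 in c0.
have [n1|n1] : n = 1 \/ n = -1 by lia.
  exists (- a), b; split=> //; first exact: root_opp.
  by rewrite cartanNr en n1.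
by exists a, b; split=> //; rewrite en n1.
Qed.

End Roots.

(** * Schur's lemma in countable dimension *)
Lemma realType_uncountable (R : realType) : ~ countable [set: R].
Proof.
move=> cR.
have c01 : countable ([set` `[0%R, 1%R]] : set R).
  by apply: sub_countable cR; exact: subset_card_le.
have := countable_lebesgue_measure0 c01.
rewrite lebesgue_measure_itv /= lte_fin ltr01 oppr0 adde0 => /eqP.
by rewrite eqe oner_eq0.
Qed.

Section PolynomialAction.
Variables (K : fieldType) (W : lmodType K) (phi : {linear W -> W}).
Implicit Types (p q : {poly K}) (w : W).

Definition pact p w : W := \sum_(i < size p) p`_i *: iter i phi w.

Lemma pact_widen n p w : (size p <= n)%N ->
  pact p w = \sum_(i < n) p`_i *: iter i phi w.
Proof.
move=> /subnKC <-; rewrite big_split_ord /= [X in _ = _ + X]big1 ?addr0 // => i _.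
by rewrite nth_default ?scale0r // leq_addr.
Qed.

Lemma pactZ k p w : pact (k *: p) w = k *: pact p w.
Proof.
rewrite (@pact_widen (size p)) ?size_scale_leq // /pact scaler_sumr.
by apply: eq_bigr => i _; rewrite coefZ scalerA.
Qed.

Lemma pactD p q w : pact (p + q) w = pact p w + pact q w.
Proof.
pose n := maxn (size p) (size q).
rewrite (@pact_widen n) ?size_polyD // (@pact_widen n p) ?leq_maxl
  // (@pact_widen n q) ?leq_maxr //.
by rewrite -big_split; apply: eq_bigr => i _; rewrite coefD scalerDl.
Qed.

Lemma pact0 w : pact 0 w = 0.
Proof. by rewrite /pact size_poly0 big_ord0. Qed.

Lemma pact_sum (I : Type) (s : seq I) (f : I -> {poly K}) w :
  pact (\sum_(i <- s) f i) w = \sum_(i <- s) pact (f i) w.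
Proof. by elim/big_rec2: _ => [|i x y _ <-]; rewrite ?pact0 // pactD. Qed.

Lemma iter_linear_sum n (I : Type) (s : seq I) (k : I -> K) (f : I -> W) :
  iter n phi (\sum_(i <- s) k i *: f i) = \sum_(i <- s) k i *: iter n phi (f i).
Proof.
elim: n => [|n IH] //=; rewrite IH linear_sum; apply: eq_bigr => i _.
by rewrite linearZ.
Qed.

Lemma pact_0r p : pact p 0 = 0.
Proof.
have i0 n : iter n phi 0 = 0 by elim: n => //= n ->; rewrite linear0.
by rewrite /pact big1 // => i _; rewrite i0 scaler0.
Qed.

Lemma pact_linear p (I : Type) (s : seq I) (k : I -> K) (f : I -> W) :
  pact p (\sum_(i <- s) k i *: f i) = \sum_(i <- s) k i *: pact p (f i).
Proof.
rewrite /pact; under eq_bigr => i _ do rewrite iter_linear_sum scaler_sumr.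
rewrite exchange_big /=; apply: eq_bigr => i _; rewrite scaler_sumr.
by apply: eq_bigr => j _; rewrite !scalerA mulrC.
Qed.

Lemma iterSB n k w : iter n phi (phi w - k *: w) =
  iter n.+1 phi w - k *: iter n phi w.
Proof. by elim: n => [|n IH] //=; rewrite IH linearB linearZ. Qed.

Lemma pact_mulXsubC p k w : pact (p * ('X - k%:P)) w = pact p (phi w - k *: w).
Proof.
rewrite (@pact_widen (size p).+1); last first.
  by rewrite (leq_trans (size_polyMleq _ _)) // size_XsubC addn2.
rewrite mulrBr; under eq_bigr => i _ do rewrite coefB coefMX coefMC scalerBl.
rewrite sumrB big_ord_recl eqxx scale0r add0r [X in _ - X]big_ord_recr /=.
rewrite nth_default // mul0r scale0r addr0 -sumrB; apply: eq_bigr => i _ /=.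
by rewrite iterSB scalerBr scalerA.
Qed.

End PolynomialAction.

Section Schur.
Variables (R : realType) (W : lmodType R[i]) (phi : {linear W -> W}).
Local Notation C := R[i].
Implicit Types (w : W) (k : C).

(** Over an algebraically closed field p(phi) is a nonzero scalar times a product of factors phi -
    k, each of them injective. *)
Lemma pact_injective : (forall k w, phi w = k *: w -> w = 0) ->
  forall (p : {poly C}) w, p != 0 -> pact phi p w = 0 -> w = 0.
Proof.
move=> inj p; have [n] := ubnP (size p); elim: n p => // n IH p hn w p0.
have [s1|s1] := leqP (size p) 1.
  rewrite (size1_polyC s1) (@pact_widen _ _ _ 1) ?size_polyC_leq1
    // big_ord1 coefC /=.
  move/eqP; rewrite scaler_eq0 => /orP [h|/eqP //].
  by case/negP: p0; rewrite (size1_polyC s1) polyC_eq0.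
have /closed_rootP [k /factor_theorem [q eq]] : size p != 1%N
  by rewrite neq_ltn s1 orbT.
have q0 : q != 0 by apply: contra_neq p0; rewrite eq => ->; rewrite mul0r.
rewrite eq pact_mulXsubC => /(IH q) h.
apply: (inj k); apply/eqP; rewrite -subr_eq0; apply/eqP/h => //.
by move: hn; rewrite eq size_Mmonic ?monicXsubC // size_XsubC addn2 ltnS.
Qed.

(* The vectors (phi - k)^-1 w0 are linearly independent and there are too many
   of them for a space of countable dimension. *)
Lemma schur_countable (e : nat -> W) w0 : w0 <> 0 ->
  (forall w, exists n (a : 'I_n -> C), w = \sum_i a i *: e i) ->
  (forall k, (forall w, phi w = k *: w -> w = 0) ->
    exists u, phi u - k *: u = w0) ->
  exists k w, w <> 0 /\ phi w = k *: w.
Proof.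
move=> w00 span surj; apply: contrapT => nex.
have inj k w : phi w = k *: w -> w = 0.
  by move=> h; apply: contrapT => w1; apply: nex; exists k, w.
have [u hu] := choice (fun x : R =>
  surj (real_complex R x) (inj (real_complex R x))).
have [N hN] := choice (fun x : R => span (u x)).
(* Uncountably many vectors [u x] and countably many spans of finite initial segments of [e]: one
   span, of dimension at most n, contains infinitely many of them, and any n.+1 are dependent. *)
have [n hn] : exists n, infinite_set [set x | N x = n].
  apply: contrapT => /forallNP h; apply: (@realType_uncountable R).
  have -> : [set: R] = \bigcup_(n in [set: nat]) [set x | N x = n].
    by apply/seteqP; split=> // x _; exists (N x).
  apply: bigcup_countable => // n _; apply: finite_set_countable.
  by apply: contrapT; exact: h.
have [B BN cB] := infinite_set_fset n.+1 hn.
pose lam (i : 'I_n.+1) : R := nth 0 (finmap.enum_fset B) i.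
have lamN i : N (lam i) = n.
  by apply: BN => /=; apply: mem_nth; exact: leq_trans (ltn_ord i) cB.
have lam_inj : injective lam.
  move=> i j /eqP; rewrite nth_uniq ?finmap.fset_uniq ?(leq_trans (ltn_ord _) cB)
    // => /eqP.
  exact: val_inj.
have /choice [A hA] i : exists a : 'I_n -> C, u (lam i) = \sum_j a j *: e j.
  by have := hN (lam i); rewrite lamN.
pose M : 'M[C]_(n.+1, n) := \matrix_(i, j) A i j.
have [a aM a0] : exists2 a : 'rV[C]_n.+1, a *m M = 0 & a != 0.
  have : kermx M != 0.
    by rewrite kermx_eq0 /row_free; apply/eqP => h; have := rank_leq_col M;
      rewrite h ltnn.
  by move=> /rowV0Pn [a /sub_kermxP h1 h2]; exists a.
have dep : \sum_i a 0 i *: u (lam i) = 0.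
  under eq_bigr => i _ do rewrite hA scaler_sumr.
  rewrite exchange_big big1 //= => j _.
  under eq_bigr => i _ do rewrite scalerA.
  rewrite -scaler_suml.
  have := congr1 (fun B : 'rV_n => B 0 j) aM; rewrite !mxE.
  under eq_bigr => i _ do rewrite mxE.
  by move=> ->; rewrite scale0r.
pose Q i : {poly C} := \prod_(j < n.+1 | j != i) ('X - (real_complex R (lam j))%:P).
have QE i : \prod_(j < n.+1) ('X - (real_complex R (lam j))%:P) =
  Q i * ('X - (real_complex R (lam i))%:P).
  by rewrite (bigD1 i) //= mulrC.
(* Clearing denominators turns the dependence into a polynomial in phi that kills [w0], hence the
   zero polynomial. Evaluating it at [lam i] isolates [a 0 i]. *)
have Q0 : \sum_i a 0 i *: Q i = 0.
  apply: contrapT => /eqP h; apply: w00; apply: (pact_injective inj h).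
  have e' i : pact phi (a 0 i *: Q i) w0 =
      a 0 i *: pact phi (\prod_(j < n.+1) ('X - (real_complex R (lam j))%:P)) (u
        (lam i)).
    by rewrite pactZ -(hu (lam i)) (QE i) pact_mulXsubC.
  rewrite pact_sum (eq_bigr _ (fun i _ => e' i)).
  by rewrite -pact_linear dep pact_0r.
move/eqP: a0; apply; apply/rowP => i; rewrite mxE.
have := congr1 (fun p => p.[(real_complex R (lam i))]) Q0;
  rewrite horner0 horner_sum (bigD1 i) //=.
rewrite big1 ?addr0 => [|j ji]; last first.
  by rewrite hornerZ horner_prod (bigD1 i) 1?eq_sym
    //= hornerXsubC subrr mul0r mulr0.
rewrite hornerZ => /eqP; rewrite mulf_eq0 => /orP [/eqP //|].
rewrite horner_prod => /prodf_eq0 [j ji]; rewrite hornerXsubC subr_eq0.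
by rewrite (inj_eq (fmorph_inj (real_complex R))) => /eqP /lam_inj ij;
  rewrite ij eqxx in ji.
Qed.

End Schur.

(** * The torus and its cover *)
Section Generated.
Variables (T : Type) (one : T) (mul : T -> T -> T) (inv : T -> T).
Local Notation gen := (generated one mul inv).
Implicit Types S : set T.

Lemma generated_ind S (P : T -> Prop) : P one ->
  (forall x y, P x -> P y -> P (mul x y)) -> (forall x, P x -> P (inv x)) ->
  (forall x, S x -> P x) -> forall x, gen S x -> P x.
Proof. by move=> P1 PM PV PS x; apply: smallest_sub. Qed.

Lemma generated_sub S x : S x -> gen S x.
Proof. by move=> Sx A [_ SA]; exact: SA. Qed.

Lemma generated_one S : gen S one. Proof. by move=> A [[]]. Qed.

Lemma generated_mul S x y : gen S x -> gen S y -> gen S (mul x y).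
Proof. by move=> hx hy A hA; case: (hA) => -[_ AM _] _; apply: AM;
  [exact: hx | exact: hy]. Qed.

Lemma generated_inv S x : gen S x -> gen S (inv x).
Proof. by move=> hx A hA; case: (hA) => -[_ _ AV] _; apply: AV; exact: hx. Qed.

End Generated.

Section Cover.
Variables (R : realType) (Q2 : fieldType) (abs2 : Q2 -> R).
Hypothesis hQ2 : is_Q2 abs2.
Variables (F : fieldExtType Q2) (varpi : F).
Hypothesis hvarpi : is_uniformizer abs2 varpi.
Variable r : nat.
Hypothesis hr : (2 <= r)%N.
Variable Phi : seq 'rV[R]_r.
Hypothesis hPhi : is_root_system Phi.
Hypothesis hirr : irreducible_roots Phi.
Hypothesis hlaced : simply_laced Phi.
Variable Delta : 'I_r -> 'rV[R]_r.
Hypothesis hDelta : is_base Phi Delta.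
Variables (N : nat) (wt : 'I_N.+1 -> 'rV[R]_r) (c : 'rV[R]_r -> 'rV[R]_r -> int).
Variable X : 'rV[R]_r -> 'M[F]_N.+1.
Hypothesis hX : is_chevalley_rep Phi wt c X.
Variables (Gt : topologicalGroupType) (pr : Gt -> 'M[F]_N.+1) (zeta : Gt).
Variable xt : 'rV[R]_r -> F -> Gt.
Hypothesis hGt : is_metaplectic_cover abs2 varpi Phi c X pr zeta xt.
Local Notation unit := (int_units abs2 (F := F)).
Local Notation mult := (multiple abs2).
Local Notation val := (valuation abs2 varpi).
Local Notation M := 'M[F]_N.+1.
Implicit Types (a b : 'rV[R]_r) (t u : F) (s : 'I_r -> F) (g : Gt).

Lemma fieldext_char0 n : (n%:R == 0 :> F) = (n == 0%N).
Proof. by rewrite -(rmorph_nat (in_alg F)) fmorph_eq0 (Q2_natr_eq0 hQ2). Qed.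

Definition weight_pairing a j : int := Num.floor (cartan (wt j) a).
Local Notation m := weight_pairing.

Lemma weight_pairingE a j : a \in Phi -> cartan (wt j) a = (m a j)%:~R.
Proof.
move=> ha; apply: cartan_int.
have : (weight_lattice Phi : set _) (wt j).
  rewrite -(chev_wt hX); exists 1%N, (fun=> 1), (fun=> wt j).
  by split; [move=> i; exists j | rewrite big_ord1 scale1r].
exact.
Qed.

Lemma weight_pairing_base a (k : 'I_r -> int) j : a \in Phi ->
  a = \sum_i (k i)%:~R *: Delta i -> m a j = \sum_i k i * m (Delta i) j.
Proof.
move=> ha e; apply: (@intr_inj R).
rewrite -weight_pairingE // (cartan_base_coords hlaced hDelta _ ha e) rmorph_sum.
apply: eq_bigr => i _; rewrite weight_pairingE ?rmorphM //.
exact: (base_root hDelta).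
Qed.

Lemma coroot_mxE a : coroot_mx F wt a = Hdiag F (m a). Proof. by []. Qed.

Lemma chevalley_HE a : a \in Phi ->
  Hdiag F (m a) * X a - X a * Hdiag F (m a) = 2%:~R *: X a.
Proof.
move=> ha; have := chev_weight hX ha ha; rewrite coroot_mxE => ->.
by rewrite (cartan_self hPhi ha) -[2 : R]/((2 : int)%:~R) intrKfloor.
Qed.

Lemma chevalley_HF a : a \in Phi ->
  Hdiag F (m a) * X (- a) - X (- a) * Hdiag F (m a) = (-2)%:~R *: X (- a).
Proof.
move=> ha; have := chev_weight hX ha (root_opp hPhi ha); rewrite coroot_mxE => ->.
by rewrite cartanNl (cartan_self hPhi ha) -[2 : R]/((2 : int)%:~R) -rmorphN
  intrKfloor.
Qed.

Lemma chevalley_EF a : a \in Phi -> X a * X (- a) - X (- a) * X a = Hdiag F (m a).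
Proof. by move=> ha; rewrite (chev_opp hX ha). Qed.

Lemma xt0 a : a \in Phi -> xt a 0 = 1%g.
Proof.
move=> ha; apply: (mulgI (xt a 0)).
by rewrite (xtD hGt _ _ ha) addr0 mulg1.
Qed.

Lemma xtN a t : a \in Phi -> (xt a t * xt a (- t))%g = 1%g.
Proof. by move=> ha; rewrite (xtD hGt _ _ ha) subrr xt0. Qed.

(** The addition law of the root subgroups is inherited from the cover rather than derived from the
    exponential. *)
Lemma xrootN a t : a \in Phi -> xroot X a t * xroot X a (- t) = 1.
Proof.
move=> ha; rewrite -!(cover_lift hGt) // -(cover_mul hGt) xtN //.
exact: (cover_one hGt).
Qed.

Lemma hroot_tdiag a t : a \in Phi -> t != 0 -> hroot X a t = tdiag (m a) t.
Proof.
move=> ha t0; have hNa := root_opp hPhi ha.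
have w u : u != 0 -> wroot X a u = tdiag (m a) u * wroot X a 1.
  exact: (mexpw_tdiag fieldext_char0 (chevalley_HE ha) (chevalley_HF ha)
    (chevalley_EF ha)).
rewrite /hroot w // -mulrA.
suff -> : wroot X a 1 * wroot X a (-1) = 1 by rewrite mulr1.
rewrite /wroot invrN invr1 opprK -!mulrA.
rewrite [xroot X a 1 * (xroot X a (-1) * _)]mulrA xrootN // mul1r.
have e1 : xroot X (- a) (-1) * xroot X (- a) 1 = 1.
  by have := xrootN (-1) hNa; rewrite opprK.
rewrite [xroot X (- a) (-1) * _]mulrA e1 mul1r.
by rewrite xrootN.
Qed.

(** The product of the h_(alpha_i)(s_i), see [prod_hroot], in a form whose multiplicativity asks
    nothing of s. *)
Definition torus_pt s : M := diag_mx (\row_j \prod_i s i ^ m (Delta i) j).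

Lemma torus_ptM s s' : torus_pt s * torus_pt s' = torus_pt (fun i => s i * s' i).
Proof.
apply/matrixP => i j; rewrite mulmx_diagl !mxE.
case: (i == j); rewrite ?mulr0n ?mulr1n ?mulr0 // -big_split.
by apply: eq_bigr => l _; rewrite expfzMl.
Qed.

Lemma torus_pt1 : torus_pt (fun=> 1) = 1.
Proof.
apply/matrixP=> i j; rewrite !mxE big1 // => l _; exact: exp1rz.
Qed.

Lemma eq_torus_pt s s' : s =1 s' -> torus_pt s = torus_pt s'.
Proof. by move=> e; congr torus_pt; exact: funext. Qed.

Lemma torus_ptV s : (forall i, s i != 0) ->
  (torus_pt s)^-1 = torus_pt (fun i => (s i)^-1).
Proof.
move=> s0.
have e : torus_pt s * torus_pt (fun i => (s i)^-1) = 1.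
  by rewrite torus_ptM -torus_pt1; apply: eq_torus_pt => i; rewrite divff.
have e' : torus_pt (fun i => (s i)^-1) * torus_pt s = 1.
  by rewrite torus_ptM -torus_pt1; apply: eq_torus_pt => i; rewrite mulVf.
have u : torus_pt s \is a GRing.unit by apply/unitrP;
  exists (torus_pt (fun i => (s i)^-1)).
by rewrite -[LHS]mulr1 -e mulKr.
Qed.

Lemma hroot_torus_pt a t (k : 'I_r -> int) : a \in Phi -> t != 0 ->
  a = \sum_i (k i)%:~R *: Delta i -> hroot X a t = torus_pt (fun i => t ^ k i).
Proof.
move=> ha t0 e; rewrite hroot_tdiag //; congr diag_mx; apply/rowP => j;
  rewrite !mxE.
rewrite (weight_pairing_base _ ha e).
transitivity (\prod_i t ^ (k i * m (Delta i) j)).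
  elim/big_rec2: _ => [|i x y _ <-]; first by rewrite expr0z.
  by rewrite expfzDr.
by apply: eq_bigr => i _; rewrite exprz_exp.
Qed.

Lemma prod_hroot s : (forall i, s i != 0) ->
  \prod_(i < r) hroot X (Delta i) (s i) = torus_pt s.
Proof.
move=> s0.
have e1 i : hroot X (Delta i) (s i) = torus_pt (fun l => if l == i then s i else 1).
  rewrite hroot_tdiag ?(base_root hDelta) //; congr diag_mx; apply/rowP => j.
  rewrite !mxE (bigD1 i) //= eqxx big1 ?mulr1 // => l /negbTE ->.
  by rewrite exp1rz.
rewrite (eq_bigr _ (fun i _ => e1 i)).
suff H (q : seq 'I_r) : \prod_(i <- q) torus_pt (fun l => if l == i then s i else 1)
   = torus_pt (fun l => \prod_(i <- q) if l == i then s i else 1).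
  rewrite H; apply: eq_torus_pt => l;
    rewrite (bigD1 l) //= eqxx big1 ?mulr1 // => i.
  by rewrite eq_sym => /negbTE ->.
elim: q => [|i q IH].
  by rewrite big_nil -torus_pt1; apply: eq_torus_pt => l; rewrite big_nil.
rewrite big_cons IH torus_ptM; apply: eq_torus_pt => l; by rewrite big_cons.
Qed.

(** This is where simple connectedness enters: the i-th fundamental weight is an integral
    combination of weights of the representation, so s_i is a monomial in the diagonal entries.
    Besides uniqueness of s it shows that s is near 1 when the matrix is. *)
Lemma torus_coordinate i : exists (n : nat) (k : 'I_n -> int) (q : 'I_n -> 'I_N.+1),
  forall s, (forall l, s l != 0) -> s i = \prod_p (torus_pt s) (q p) (q p) ^ k p.
Proof.
have [om omL hom] := fundamental_weight hPhi hlaced hDelta i.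
have : Zspan (range wt) om by rewrite (chev_wt hX); exact: set_mem omL.
case=> n [k [w [hw eom]]].
have hw' p : exists j, wt j = w p by have [j _ e] := hw p; exists j.
have [q hq] := choice hw'.
exists n, k, q => s s0.
have e l : \sum_p m (Delta l) (q p) * k p = (i == l)%:Z.
  apply: (@intr_inj R); rewrite -[RHS](hom l) eom rmorph_sum /cartan dot_suml.
  apply: eq_bigr => p _; rewrite dotZl rmorphM /= [LHS]mulrC; congr (_ * _).
  by rewrite -weight_pairingE ?(base_root hDelta) // hq.
under eq_bigr => p _ do rewrite mxE eqxx mulr1n mxE.
transitivity (\prod_p \prod_l s l ^ (m (Delta l) (q p) * k p)); last first.
  apply: eq_bigr => p _.
  elim/big_rec2: _ => [|l x y _ ->]; first by rewrite exp1rz.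
  by rewrite expfzMl exprz_exp.
rewrite exchange_big /=.
transitivity (\prod_l s l ^ (i == l)%:Z).
  rewrite (bigD1 i) //= eqxx expr1z big1 ?mulr1 // => l.
  by rewrite eq_sym => /negbTE ->; rewrite expr0z.
apply: eq_bigr => l _; rewrite -e.
elim/big_rec2: _ => [|p x y _ <-]; first by rewrite expr0z.
by rewrite expfzDr.
Qed.

Lemma torus_pt_inj s s' : (forall i, s i != 0) -> (forall i, s' i != 0) ->
  torus_pt s = torus_pt s' -> s =1 s'.
Proof.
move=> s0 s0' e i; have [n [k [q h]]] := torus_coordinate i.
by rewrite (h s) // e -(h s').
Qed.

Lemma torus_overP (A : set F) : A 1 -> (forall t, A t -> t != 0) ->
  (forall t u, A t -> A u -> A (t * u)) -> (forall t, A t -> A t^-1) ->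
  forall x, torus_over Phi X A x <-> exists s, (forall i,
    A (s i)) /\ x = torus_pt s.
Proof.
move=> A1 A0 AM AV x.
have AX t (k : int) : A t -> A (t ^ k).
  move=> At; have An n : A (t ^+ n) by elim: n => [|n IH];
    rewrite ?expr0 ?exprS //; exact: AM.
  by case: k => n; [exact: An | rewrite NegzE -exprnN; apply: AV; exact: An].
split=> [|[s [As ->]]].
  move: x; apply: (generated_ind (P :=
    fun x => exists s, (forall i, A (s i)) /\ x = torus_pt s)).
  - by exists (fun=> 1); rewrite torus_pt1.
  - move=> _ _ [s [As ->]] [s' [As' ->]]; exists (fun i => s i * s' i).
    by split; [move=> i; exact: AM | rewrite torus_ptM].
  - move=> _ [s [As ->]]; exists (fun i => (s i)^-1); split; first by move=> i;
    exact: AV.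
    by rewrite torus_ptV // => i; exact: A0.
  - move=> _ [a [t [ha At ->]]]; have [k ek] := root_base_coords hDelta ha.
    exists (fun i => t ^ k i); split; first by move=> i; exact: AX.
    by apply: hroot_torus_pt => //; exact: A0.
rewrite -prod_hroot; last by move=> i; exact: A0.
elim/big_ind: _; first exact: generated_one.
  by move=> ? ?; exact: generated_mul.
move=> i _; apply: generated_sub; exists (Delta i), (s i).
by split=> //; exact: (base_root hDelta).
Qed.

Lemma torusP x : torus Phi X x <-> exists s, (forall i, s i != 0) /\ x = torus_pt s.
Proof.
apply: torus_overP => //=; first exact: oner_neq0.
  by move=> t u; exact: mulf_neq0.
by move=> t; rewrite invr_eq0.
Qed.

Lemma T0P x : T0 abs2 Phi X x <-> exists s, (forall i,
  unit (s i)) /\ x = torus_pt s.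
Proof.
apply: torus_overP; first exact: (int_unit1 hQ2).
- by move=> t [].
- exact: (int_unitM hQ2).
- exact: int_unitV.
Qed.

(** * Commutators in the cover and bilinearity of the Hilbert symbol *)

Local Notation htl := (htilde xt).
Local Notation wtl := (wtilde xt).

Lemma conj_mulg (g x y : Gt) :
  (g * (x * y) * g^-1 = (g * x * g^-1) * (g * y * g^-1))%g.
Proof. by rewrite !mulgA mulgVK. Qed.

(* The Hilbert symbol in additive notation: hsym t u holds when (t, u) = -1. *)
Definition hsym t u : bool := ~~ hilbert t u.

Definition zpow (z : bool) : Gt := if z then zeta else 1%g.

Lemma zpowD z z' : zpow (z (+) z') = (zpow z * zpow z')%g.
Proof. by case: z z' => -[]; rewrite /= ?mulg1 ?mul1g // (zeta_sqr hGt). Qed.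

Lemma zpow_sqr z : (zpow z * zpow z)%g = 1%g.
Proof. by rewrite -zpowD addbb. Qed.

Lemma zpow_central z g : (zpow z * g)%g = (g * zpow z)%g.
Proof. by case: z; rewrite /= ?mulg1 ?mul1g // (zeta_central hGt). Qed.

Lemma zpow_inj : injective zpow.
Proof. by case=> -[] //= e; case: (zeta_neq1 hGt). Qed.

Lemma zpow_neq z z' g : (zpow z * g)%g = (zpow z' * g)%g -> z = z'.
Proof. by move/mulIg/zpow_inj. Qed.

(** The commutator of x and y is the sign z. It is a relation since general elements of the cover
    have no such sign; z is additive in x and in y. *)
Definition comz (z : bool) (x y : Gt) : Prop := (x * y = zpow z * (y * x))%g.

Lemma comz_sym z x y : comz z x y -> comz z y x.
Proof. by rewrite /comz => ->; rewrite mulgA zpow_sqr mul1g. Qed.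

Lemma comzMr z z' x y y' : comz z x y -> comz z' x y' ->
  comz (z (+) z') x (y * y')%g.
Proof.
rewrite /comz => e e'; rewrite mulgA e -mulgA -[(y * x * y')%g]mulgA e'.
by rewrite [(y * (zpow z' * _))%g]mulgA -(zpow_central z' y) zpowD -!mulgA.
Qed.

Lemma comzMl z z' x x' y : comz z x y -> comz z' x' y ->
  comz (z (+) z') (x * x')%g y.
Proof. by move=> /comz_sym h /comz_sym h'; apply: comz_sym; exact: comzMr. Qed.

Lemma comz_zpow z' x : comz false (zpow z') x.
Proof. by rewrite /comz /= mul1g zpow_central. Qed.

Lemma comz1r x : comz false x 1%g. Proof. by rewrite /comz /= mulg1 !mul1g. Qed.

Lemma comz_prodr (I : Type) (q : seq I) (z : I -> bool) x (f : I -> Gt) :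
  (forall i, comz (z i) x (f i)) ->
  comz (\big[addb/false]_(i <- q) z i) x (\big[*%g/1%g]_(i <- q) f i)%g.
Proof. by move=> H; elim/big_rec2: _ => [|i y w _ IH];
  [exact: comz1r | exact: comzMr]. Qed.

Lemma comz_unique z z' x y : comz z x y -> comz z' x y -> z = z'.
Proof. by rewrite /comz => -> /zpow_neq. Qed.

Lemma comz_commute x y : comz false x y <-> commute x y.
Proof. by rewrite /comz /= mul1g. Qed.

Lemma htildeM_zpow a t u : a \in Phi -> t != 0 -> u != 0 ->
  (htl a t * htl a u)%g = (zpow (hsym t u) * htl a (t * u)%R)%g.
Proof. by move=> ha t0 u0; rewrite (htildeM hGt) // /hsym; case: (hilbert t u). Qed.

Let prM := cover_mul hGt.

Lemma prV x : pr x * pr (x^-1)%g = 1 /\ pr (x^-1)%g * pr x = 1.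
Proof. by rewrite -!prM mulgV mulVg (cover_one hGt). Qed.

Lemma pr_inv x : pr (x^-1)%g = (pr x)^-1.
Proof.
have [e1 e2] := prV x; have u : pr x \is a GRing.unit by apply/unitrP;
  exists (pr (x^-1)%g).
by rewrite -[RHS]mulr1 -e1 mulKr.
Qed.

Lemma pr_eq x y : pr x = pr y -> exists z, x = (zpow z * y)%g.
Proof.
move=> e; have : pr (x * y^-1)%g = 1 by rewrite prM e; case: (prV y).
move/(cover_ker hGt) => [h|h]; [exists false | exists true];
  rewrite /= -h -mulgA mulVg mulg1 //.
Qed.

Lemma pr_zpow z : pr (zpow z) = 1.
Proof. by apply/(cover_ker hGt); case: z; [right|left]. Qed.

Lemma pr_wtilde a t : a \in Phi -> pr (wtl a t) = wroot X a t.
Proof.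
by move=> ha; rewrite /wtilde !prM !(cover_lift hGt) //; exact: (root_opp hPhi).
Qed.

Lemma pr_htilde a t : a \in Phi -> pr (htl a t) = hroot X a t.
Proof. by move=> ha; rewrite /htilde prM !pr_wtilde. Qed.

Lemma wtildeN b t : b \in Phi -> (wtl b t * wtl b (- t)%R)%g = 1%g.
Proof.
move=> hb; have hNb := root_opp hPhi hb.
rewrite /wtilde invrN opprK -!mulgA [(xt b t * (xt b (- t) * _))%g]mulgA xtN
  // mul1g.
have e1 : (xt (- b)%R (- t^-1)%R * xt (- b)%R (t^-1)%R)%g = 1%g.
  by have := xtN (- t^-1)%R hNb; rewrite opprK.
by rewrite [(xt (- b)%R _ * (xt (- b)%R _ * _))%g]mulgA e1 mul1g xtN.
Qed.

Lemma htilde1 b : b \in Phi -> htl b 1 = 1%g. Proof. exact: wtildeN. Qed.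

(* Conjugating xt b u can only introduce a sign, which disappears on writing
   u as a double. *)
Lemma htilde_conj_xt a b t u : a \in Phi -> b \in Phi -> t != 0 ->
  (htl a t * xt b u * (htl a t)^-1)%g = xt b (t ^ Num.floor (cartan b a) * u).
Proof.
move=> ha hb t0; set n := Num.floor _.
have two0 : (2%:R : F) != 0 by rewrite fieldext_char0.
have conj v : exists z,
  (htl a t * xt b v * (htl a t)^-1)%g = (zpow z * xt b (t ^ n * v))%g.
  apply: pr_eq; rewrite 2!prM pr_inv pr_htilde // !(fun w => cover_lift hGt w hb).
  have hu : hroot X a t \is a GRing.unit.
    rewrite -pr_htilde //; have [e1 e2] := prV (htl a t).
    by apply/unitrP; exists (pr ((htl a t)^-1)%g).
  apply: (mulIr hu); rewrite divrK // hroot_tdiag //.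
  apply: (@tdiag_mexp _ _ (m a) (X b) n t v N.+1) => // i j.
  have := chev_weight hX ha hb; rewrite coroot_mxE => h.
  exact: (weight_entry fieldext_char0 h).
have [z hz] := conj (u / 2%:R).
have eu : u = u / 2%:R + u / 2%:R by field.
rewrite {1}eu -(xtD hGt) //.
rewrite conj_mulg hz -mulgA [(xt b _ * _)%g]mulgA -zpow_central !mulgA zpow_sqr
  mul1g (xtD hGt) //.
by rewrite -mulrDr -eu.
Qed.

Lemma htilde_conj_wtilde a b t u : a \in Phi -> b \in Phi -> t != 0 -> u != 0 ->
  (htl a t * wtl b u * (htl a t)^-1)%g = wtl b (t ^ Num.floor (cartan b a) * u).
Proof.
move=> ha hb t0 u0; rewrite /wtilde !conj_mulg !htilde_conj_xt ?(root_opp hPhi) //.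
rewrite cartanNl; have -> : Num.floor (- cartan b a) = - Num.floor (cartan b a).
  by rewrite (cartan_int (roots_int hPhi ha hb)) -rmorphN !intrKfloor.
rewrite -invr_expz invfM mulrN //.
Qed.

(** Conjugation by h~_a(t) multiplies the argument of w~_b by t^n, so it sends h~_b(u) = w~_b(u)
    w~_b(-1) to h~_b(t^n u) h~_b(t^n)^-1. The multiplication law of h~_b evaluates this quotient. *)
Lemma htilde_comm a b t u : a \in Phi -> b \in Phi -> t != 0 -> u != 0 ->
  comz (hsym u (t ^ Num.floor (cartan b a))) (htl a t) (htl b u).
Proof.
move=> ha hb t0 u0; set n := Num.floor _.
have tn0 : t ^ n != 0 by exact: expfz_neq0.
have e : (htl a t * htl b u * (htl a t)^-1 =
  htl b (t ^ n * u)%R * (htl b (t ^ n))^-1)%g.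
  rewrite {2}/htilde conj_mulg !htilde_conj_wtilde ?oppr_eq0 ?oner_eq0
    // -/n mulrN1.
  apply: (mulIg (htl b (t ^ n))); rewrite mulgVK.
  rewrite {1 2}/htilde mulrC -mulgA; congr (_ * _)%g.
  rewrite mulgA; have := wtildeN (- t ^ n)%R hb.
  by rewrite opprK => ->; rewrite mul1g.
have e2 : htl b (t ^ n * u)%R =
  (zpow (hsym u (t ^ n)) * (htl b u * htl b (t ^ n)))%g.
  by rewrite htildeM_zpow // mulgA zpow_sqr mul1g mulrC.
apply: (mulIg (htl a t)^-1%g); rewrite /comz e e2.
move: (htl b u) (htl b (t ^ n)) (htl a t) (zpow _) => p q w z.
by rewrite -!mulgA !mulgV.
Qed.

Lemma hsymC t u : hsym t u = hsym u t.
Proof.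
suff H (v w : F) : hilbert v w -> hilbert w v.
  by rewrite /hsym; congr negb; apply/idP/idP; exact: H.
rewrite /hilbert => /asboolP [x [y [z [nz e]]]]; apply/asboolP; exists y, x, z.
split; last by rewrite addrC.
by move=> [y0 x0 z0]; apply: nz; rewrite x0 y0 z0.
Qed.

(** When the Cartan integer of b and a is -1, the symbol (v, w) is the commutator of h~_a(w^-1) with
    h~_b(v), and commutators with central values are multiplicative. *)
Lemma hsymMl t u w : t != 0 -> u != 0 -> w != 0 ->
  hsym (t * u) w = hsym t w (+) hsym u w.
Proof.
move=> t0 u0 w0; have [a [b [ha hb ab]]] :=
  root_pair_cartanN1 hr hPhi hirr hlaced hDelta.
have n1 : Num.floor (cartan b a) = -1.
  by rewrite ab -[-1 : R]/((-1 : int)%:~R) intrKfloor.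
have wV0 : w^-1 != 0 by rewrite invr_eq0.
have cm v : v != 0 -> comz (hsym v w) (htl a w^-1) (htl b v).
  by move=> v0; have := htilde_comm ha hb wV0 v0;
    rewrite n1 -invr_expz expr1z invrK.
have e : htl b (t * u) = (zpow (hsym t u) * (htl b t * htl b u))%g.
  by rewrite htildeM_zpow // mulgA zpow_sqr mul1g.
apply: (comz_unique (cm _ (mulf_neq0 t0 u0))); rewrite e -[X in comz X]addFb.
by apply: comzMr (comzMr (cm _ t0) (cm _ u0)); apply: comz_sym; exact: comz_zpow.
Qed.

Lemma hsym_sqr t u : u != 0 -> hsym (t ^+ 2) u = false.
Proof.
move=> u0; apply/negbTE/negPn/asboolP; exists 1, 0, t; split; last by ring.
by case=> /eqP; rewrite oner_eq0.
Qed.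

Lemma hsym1 u : u != 0 -> hsym 1 u = false.
Proof. by move=> u0; rewrite -(expr1n F 2) hsym_sqr. Qed.

Lemma hsymV t u : t != 0 -> u != 0 -> hsym t^-1 u = hsym t u.
Proof.
move=> t0 u0; have : hsym (t * t^-1) u = false by rewrite divff // hsym1.
by rewrite hsymMl ?invr_eq0 //; case: (hsym t u) (hsym t^-1 u) => -[].
Qed.

Lemma hsymXz t u (k : int) : t != 0 -> u != 0 ->
  hsym (t ^ k) u = odd `|k| && hsym t u.
Proof.
move=> t0 u0; have H n : hsym (t ^+ n) u = odd n && hsym t u.
  elim: n => [|n IH]; first by rewrite expr0 hsym1.
  by rewrite exprS hsymMl ?expf_neq0 // IH /=; case: (odd n) (hsym t u) => -[].
by case: k => n; rewrite ?NegzE -?exprnN ?hsymV ?expf_neq0 // H.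
Qed.

Lemma hsym_prod u (I : Type) (q : seq I) (f : I -> F) : u != 0 ->
  (forall i, f i != 0) ->
  hsym (\prod_(i <- q) f i) u = \big[addb/false]_(i <- q) hsym (f i) u.
Proof.
move=> u0 f0; elim: q => [|i q IH]; first by rewrite !big_nil hsym1.
rewrite !big_cons hsymMl // ?IH //.
by elim/big_ind: _ => //; [exact: oner_neq0 | exact: mulf_neq0].
Qed.

Local Notation hti i t := (htl (Delta i) t).
Local Notation C := (cartan_base Delta).
Let hD := base_root hDelta.

Definition Htilde s : Gt := (\big[*%g/1%g]_(i < r) hti i (s i))%g.

Lemma pr_Htilde s : (forall i, s i != 0) -> pr (Htilde s) = torus_pt s.
Proof.
move=> s0; rewrite -prod_hroot // /Htilde.
elim/big_rec2: _ => [|i x y _ <-]; first exact: (cover_one hGt).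
by rewrite prM pr_htilde.
Qed.

Lemma TtildeP x : Ttilde Phi X pr x <->
  exists s z, (forall i, s i != 0) /\ x = (zpow z * Htilde s)%g.
Proof.
rewrite /Ttilde /= torusP; split=> [[s [s0 e]]|[s [z [s0 ->]]]].
  by have [z ez] := pr_eq (etrans e (esym (pr_Htilde s0))); exists s, z.
by exists s; split=> //; rewrite prM pr_zpow mul1r pr_Htilde.
Qed.

Lemma T0tildeP x : T0tilde abs2 Phi X pr x <->
  exists s z, (forall i, unit (s i)) /\ x = (zpow z * Htilde s)%g.
Proof.
have u0 s : (forall i, unit (s i)) -> forall i, s i != 0 by move=> h i; case: (h i).
rewrite /T0tilde /= T0P; split=> [[s [/[dup] us /u0 s0 e]]|[s [z [us ->]]]].
  by have [z ez] := pr_eq (etrans e (esym (pr_Htilde s0))); exists s, z.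
by exists s; split=> //; rewrite prM pr_zpow mul1r pr_Htilde //; exact: u0.
Qed.

Lemma Htilde_inj s s' z z' : (forall i, s i != 0) -> (forall i, s' i != 0) ->
  (zpow z * Htilde s)%g = (zpow z' * Htilde s')%g -> s =1 s'.
Proof.
move=> s0 s0' /(congr1 pr); rewrite !prM !pr_zpow !mul1r !pr_Htilde //.
exact: torus_pt_inj.
Qed.

(* The value at the torus element with coordinates s of the root character
   attached to the j-th simple root. *)
Definition root_char s j : F := \prod_i s i ^ C i j.

Lemma root_char_neq0 s j : (forall i, s i != 0) -> root_char s j != 0.
Proof.
move=> s0; rewrite /root_char; elim/big_ind: _ => [||i _].
- exact: oner_neq0.
- exact: mulf_neq0.
- exact: expfz_neq0.
Qed.

Lemma Htilde_comm s j t : (forall i, s i != 0) -> t != 0 ->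
  comz (hsym (root_char s j) t) (Htilde s) (hti j t).
Proof.
move=> s0 t0; rewrite hsym_prod //; last by move=> i; exact: expfz_neq0.
apply: comz_sym; apply: comz_prodr => i; apply: comz_sym.
by rewrite hsymC; apply: htilde_comm.
Qed.

Lemma HtildeM s s' : (forall i, s i != 0) -> (forall i, s' i != 0) ->
  exists z, (Htilde s * Htilde s')%g = (zpow z * Htilde (fun i => s i * s' i)%R)%g.
Proof.
move=> s0 s0'; apply: pr_eq; rewrite prM !pr_Htilde ?torus_ptM // => i.
by rewrite mulf_neq0.
Qed.

(** Both the reordering of the factors and their pairwise multiplication produce only symbols
    involving some s_i. *)
Lemma HtildeM_trivial s s' : (forall i, s i != 0) -> (forall i, s' i != 0) ->
  (forall i u, u != 0 -> hsym (s i) u = false) ->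
  (Htilde s * Htilde s')%g = Htilde (fun i => s i * s' i)%R.
Proof.
move=> s0 s0' hs; rewrite /Htilde -prodgM_commute; last first.
  move=> i j _ _; apply/comz_commute.
  have := htilde_comm (hD i) (hD j) (s0 i) (s0' j).
  by rewrite hsymC hsymXz // hs // andbF.
by apply: eq_bigr => i _; rewrite htildeM_zpow // hs // mul1g.
Qed.

(** * Topology of the covering torus near 1 *)

Lemma nbhs1_mul (U : set Gt) : nbhs (1%g : Gt) U ->
  exists2 V : set Gt, nbhs (1%g : Gt) V & forall x y, V x -> V y -> U (x * y)%g.
Proof.
move=> hU; have hU' : nbhs ((1%g : Gt) * 1)%g U by rewrite mulg1.
have [[A B] /= [hA hB] sub] := @mulg_continuous Gt (1%g, 1%g) U hU'.
exists (A `&` B); first exact: filterI.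
by move=> x y [Ax _] [_ By]; exact: (sub (x, y)).
Qed.

Lemma nbhs1_inv (U : set Gt) : nbhs (1%g : Gt) U ->
  nbhs (1%g : Gt) [set x | U (x^-1)%g].
Proof.
move=> hU; have hU' : nbhs ((1%g : Gt)^-1)%g U by rewrite invg1.
exact: (@invg_continuous Gt 1%g U hU').
Qed.

Let near M t := mult (varpi ^+ M) (t - 1).

Lemma near_le M M' t : (M <= M')%N -> near M' t -> near M t.
Proof. exact: (multiple_expS hQ2 hvarpi). Qed.

Lemma torus_pt_congruent1 M s : (forall i, near M.+1 (s i)) ->
  congruent1 abs2 varpi M.+1 (torus_pt s).
Proof.
move=> hs i j; rewrite !mxE; case: (i == j); rewrite ?mulr0n ?mulr1n.
  by apply: (near1_prod hQ2 hvarpi) => l _; apply: (near1Xz hQ2 hvarpi); exact: hs.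
by rewrite subrr; exact: (multiple0 hQ2).
Qed.

(* On squares of squares htilde is multiplicative, so it is continuous at 1 as
   the square of a local section of pr. *)
Lemma Htilde_near (U : set Gt) : nbhs (1%g : Gt) U ->
  exists M, forall s, (forall i, near M.+1 (s i)) -> U (Htilde s).
Proof.
move=> /nbhs1_mul [V hV VU].
have [n hn] := cover_open hGt hV.
have [K2 hK2] := near1_square hQ2 hvarpi 0.
pose K := (n + K2).+1.
have [M hM] := near1_square hQ2 hvarpi K.
exists M => s hs.
have hs' i : exists u, near K u /\ s i = u ^+ 2.
  by have [u h1 h2] := hM (s i) (near_le (leqnSn _) (hs i)); exists u.
have [u hu] := choice hs'.
have u0 i : u i != 0 by case: (near1_unit hQ2 hvarpi (hu i).1).
have usq i w : w != 0 -> hsym (u i) w = false.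
  have [v _ ->] := hK2 (u i) (near_le (leqW (leq_addl _ _)) (hu i).1).
  exact: hsym_sqr.
have [y Vy ey] : (pr @` V) (torus_pt u).
  apply: hn; split.
    by rewrite -(cover_range hGt) -pr_Htilde //; exists (Htilde u).
  move=> i j; apply: (multiple_expS hQ2 hvarpi) (_ : (n <= K)%N) _;
    first by rewrite leqW ?leq_addr.
  by apply: torus_pt_congruent1 => l; exact: (hu l).1.
have [z ez] := pr_eq (etrans ey (esym (pr_Htilde u0))).
(* The lift y agrees with H~(u) up to a sign, which disappears in the square. *)
have -> : Htilde s = (y * y)%g; last exact: VU.
rewrite ez -mulgA [(Htilde u * _)%g]mulgA -zpow_central !mulgA zpow_sqr mul1g
  HtildeM_trivial //.
by congr Htilde; apply: funext => i; rewrite (hu i).2 expr2.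
Qed.

(** The coordinates of x are near 1 because they are monomials in the entries of pr x. If x were
    zeta H~(s), then zeta would be the product of the small elements x and H~(s)^-1, against the
    discreteness of the kernel. *)
Lemma Ttilde_small M : exists2 U : set Gt, nbhs (1%g : Gt) U &
  forall x, U x -> Ttilde Phi X pr x ->
    exists2 s, (forall i, near M.+1 (s i)) & x = Htilde s.
Proof.
have [V1 hV1 V1z] := nbhs1_mul (cover_discrete hGt).
pose V := V1 `&` [set x | V1 (x^-1)%g].
have hV : nbhs (1%g : Gt) V by apply: filterI => //; exact: nbhs1_inv.
have [M1 hM1] := Htilde_near hV.
pose L := maxn M M1.
exists (V `&` [set x | congruent1 abs2 varpi L.+1 (pr x)]).
  by apply: filterI => //; exact: (cover_continuous hGt).
move=> x [[V1x _] cx] /TtildeP [s [z [s0 ex]]].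
have ns i : near L.+1 (s i).
  have [n [k [q ->]]] := torus_coordinate i; last exact: s0.
  apply: (near1_prod hQ2 hvarpi) => p _; apply: (near1Xz hQ2 hvarpi).
  have := cx (q p) (q p); rewrite eqxx.
  by rewrite ex prM pr_zpow mul1r pr_Htilde.
exists s; first by move=> i; apply: near_le (ns i); rewrite ltnS leq_maxl.
have [_ V1s] : V (Htilde s).
  by apply: hM1 => i; apply: near_le (ns i); rewrite ltnS leq_maxr.
case: z ex => /= ex; last by rewrite ex mul1g.
by have := V1z _ _ V1x V1s; rewrite ex mulgK.
Qed.

(** Dividing the coordinates by suitable approximants from a countable set leaves factors near 1,
    which [Htilde_near] lifts into U. *)
Lemma Ttilde_countable (U : set Gt) : nbhs (1%g : Gt) U ->
  exists (I : countType) (f : I -> Gt), (forall i, Ttilde Phi X pr (f i)) /\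
    forall x, Ttilde Phi X pr x ->
      exists i y, [/\ U y, Ttilde Phi X pr y & x = (f i * y)%g].
Proof.
move=> hU; have [M hM] := Htilde_near hU.
have [I [D hD']] := countable_approximation hQ2 hvarpi.
(* Index families with a vanishing approximant define no torus element and are sent to 1. *)
pose good (p : bool * {ffun 'I_r -> I}) := [forall i, D (p.2 i) != 0].
pose f p := if good p then (zpow p.1 * Htilde (fun i => D (p.2 i)))%g else 1%g.
exists (bool * {ffun 'I_r -> I})%type, f; split.
  move=> p; rewrite /f; case: ifP => [/forallP h|_].
    by apply/TtildeP; exists (fun i => D (p.2 i)), p.1.
  by rewrite /Ttilde /= (cover_one hGt); exact: generated_one.
move=> x /TtildeP [s [z [s0 ->]]].
have [e he] := choice (fun i => hD' M.+1 (s i) (s0 i)).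
have D0 i : D (e i) != 0 by case: (he i).
pose s' i := s i / D (e i).
have s'0 i : s' i != 0 by rewrite mulf_neq0 ?invr_eq0.
have [w hw] := HtildeM D0 s'0.
exists (z (+) w, [ffun i => e i]), (Htilde s'); split.
- by apply: hM => i; case: (he i).
- by apply/TtildeP; exists s', false; rewrite /= mul1g.
rewrite /f /good; have -> : [forall i, D ([ffun i => e i] i) != 0].
  by apply/forallP => i; rewrite ffunE.
have -> : (fun i => D ((z (+) w, [ffun i => e i]).2 i)) = (fun i => D (e i)).
  by apply: funext => i; rewrite /= ffunE.
rewrite -mulgA hw mulgA -zpowD /= -addbA addbb addbF.
by congr (_ * Htilde _)%g; apply: funext => i; rewrite /s' mulrC divfK.
Qed.

(** * The lattice of even cocharacters and the centre *)

Lemma valuation_prod (I : Type) (q : seq I) (f : I -> F) : (forall i, f i != 0) ->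
  val (\prod_(i <- q) f i) = \sum_(i <- q) val (f i).
Proof.
move=> f0; elim: q => [|i q IH]; first by rewrite !big_nil (valuation1 hQ2 hvarpi).
rewrite !big_cons (valuationM hQ2 hvarpi) // ?IH //.
by elim/big_ind: _ => //; [exact: oner_neq0 | exact: mulf_neq0].
Qed.

Lemma valuation_root_char s j : (forall i, s i != 0) ->
  val (root_char s j) = \sum_i val (s i) * C i j.
Proof.
move=> s0; rewrite valuation_prod => [|i]; last exact: expfz_neq0.
by apply: eq_bigr => i _; rewrite (valuationXz hQ2 hvarpi) // mulrC.
Qed.

Lemma ytildeE k : ytilde varpi xt Delta k = Htilde (fun i => varpi ^ k i).
Proof. by []. Qed.

Lemma comz_Htilde_commute x : (forall j t, t != 0 -> commute x (hti j t)) ->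
  forall y, Ttilde Phi X pr y -> commute x y.
Proof.
move=> H _ /TtildeP [s [z [s0 ->]]]; apply: commuteM.
  by apply/comz_commute/comz_sym; exact: comz_zpow.
by apply: commute_prod => i _; exact: H.
Qed.

Lemma varpiXz_neq0 (k : int) : varpi ^ k != 0.
Proof. exact: expfz_neq0 _ (uniformizer_neq0 hvarpi). Qed.

(** Evenness of k makes each simple root character a square at this element, so all its symbols are
    trivial. *)
Lemma ytilde_central k : even_coroot_lattice Phi (\sum_i (k i)%:~R *: coroot (Delta
  i)) ->
  forall y, Ttilde Phi X pr y -> commute (ytilde varpi xt Delta k) y.
Proof.
move=> /(even_coroot_latticeP hPhi hDelta) hk.
apply: comz_Htilde_commute => j t t0; apply/comz_commute; rewrite ytildeE.
have k0 i : varpi ^ k i != 0 by exact: varpiXz_neq0.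
have -> : false = hsym (root_char (fun i => varpi ^ k i) j) t;
  last exact: Htilde_comm.
have [d hd] := hk j.
have -> : root_char (fun i => varpi ^ k i) j = (varpi ^ d) ^+ 2.
  rewrite exprnP exprz_exp mulrC -hd /root_char.
  elim/big_rec2: _ => [|i x y _ ->]; first by rewrite expr0z.
  by rewrite exprz_exp expfzDr // (uniformizer_neq0 hvarpi).
by rewrite hsym_sqr.
Qed.

Local Notation even k :=
  (even_coroot_lattice Phi (\sum_i (k i)%:~R *: coroot (Delta i))).
Local Notation Y := (mu2Ytilde varpi Phi zeta xt Delta).
Local Notation TT := (Ttilde Phi X pr).
Local Notation T0t := (T0tilde abs2 Phi X pr).
Local Notation ZT0 := (ZT0tilde abs2 Phi X pr).

Lemma ytildeM k l : exists z,
  (ytilde varpi xt Delta k * ytilde varpi xt Delta l)%g =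
  (zpow z * ytilde varpi xt Delta (fun i => k i + l i))%g.
Proof.
have [i|i|z e] := @HtildeM (fun i => varpi ^ k i) (fun i => varpi ^ l i);
  rewrite ?varpiXz_neq0 //.
exists z; rewrite !ytildeE e; congr (_ * Htilde _)%g; apply: funext => i.
by rewrite expfzDr // (uniformizer_neq0 hvarpi).
Qed.

Lemma even0 : even (fun=> 0).
Proof.
apply/(even_coroot_latticeP hPhi hDelta) => j; exists 0.
by rewrite big1 // => i _; rewrite mul0r.
Qed.

Lemma evenD k l : even k -> even l -> even (fun i => k i + l i).
Proof.
move=> /(even_coroot_latticeP hPhi hDelta) hk /(even_coroot_latticeP hPhi hDelta)
  hl.
apply/(even_coroot_latticeP hPhi hDelta) => j.
have [d hd] := hk j; have [e he] := hl j; exists (d + e).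
by rewrite mulrDr -hd -he -big_split; apply: eq_bigr => i _; rewrite mulrDl.
Qed.

Lemma evenN k : even k -> even (fun i => - k i).
Proof.
move=> /(even_coroot_latticeP hPhi hDelta) hk.
apply/(even_coroot_latticeP hPhi hDelta) => j.
have [d hd] := hk j; exists (- d).
by rewrite mulrN -hd -sumrN; apply: eq_bigr => i _; rewrite mulNr.
Qed.

Lemma even_double k : even (fun i => k i * 2).
Proof.
apply/(even_coroot_latticeP hPhi hDelta) => j; exists (\sum_i k i * C i j).
by rewrite mulr_sumr; apply: eq_bigr => i _; ring.
Qed.

Lemma ytilde0 : ytilde varpi xt Delta (fun=> 0) = 1%g.
Proof. by rewrite /ytilde big1 // => i _; rewrite expr0z; exact: htilde1. Qed.

Lemma mu2YtildeP x : Y x <-> exists k z,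
  even k /\ x = (zpow z * ytilde varpi xt Delta k)%g.
Proof.
split=> [|[k [z [hk ->]]]].
  move: x; apply: generated_ind.
  - by exists (fun=> 0), false; rewrite ytilde0 mulg1; split=> //; exact: even0.
  - move=> _ _ [k [z [hk ->]]] [l [w [hl ->]]].
    have [v e] := ytildeM k l.
    exists (fun i => k i + l i), (z (+) w (+) v); split; first exact: evenD.
    rewrite !zpowD -!mulgA -e [RHS]mulgA -mulgA; congr (_ * _)%g.
    by rewrite !mulgA -zpow_central.
  - move=> _ [k [z [hk ->]]].
    have [v e] := ytildeM k (fun i => - k i).
    exists (fun i => - k i), (z (+) v); split; first exact: evenN.
    apply: mulg1_eq; rewrite [(zpow (z (+) v) * _)%g]zpow_central -!mulgA.
    rewrite [(ytilde _ _ _ k * _)%g]mulgA e.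
    have -> : (fun i => k i - k i) = (fun=> 0) by apply: funext => i; rewrite subrr.
    by rewrite ytilde0 mulg1 -!zpowD; case: (z) (v) => -[].
  - move=> y [->|[k [hk ->]]].
      by exists (fun=> 0), true; rewrite ytilde0 mulg1; split=> //; exact: even0.
    by exists k, false; rewrite mul1g.
apply: generated_mul; last by apply: generated_sub; right; exists k.
by case: z; [apply: generated_sub; left | exact: generated_one].
Qed.

(** By bilinearity and triviality on units (a, t) = (varpi, t)^(val a), and (varpi, t) = -1 because
    varpi has odd valuation. *)
Lemma unramified_hsym : exists t0, [/\ unit t0,
   forall b : F, unit b -> hsym t0 b = false
 & forall a : F, a != 0 -> hsym a t0 = odd `|val a|].
Proof.
have [t [ut ht hv]] := unramified_unit hQ2 hvarpi.
have t0 : t != 0 by case: ut.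
exists t; split=> // [b ub|a a0]; first by rewrite /hsym ht.
have va := valuationP hQ2 hvarpi a0.
have w0 := uniformizer_neq0 hvarpi.
have ea : a = varpi ^ val a * (a / varpi ^ val a)
  by rewrite mulrC divfK ?varpiXz_neq0.
have van0 : a / varpi ^ val a != 0 by case: va.
rewrite {1}ea hsymMl ?varpiXz_neq0 // [X in _ (+) X]hsymC {2}/hsym ht // addbF.
rewrite hsymXz //.
have -> : hsym varpi t = true; last by rewrite andbT.
apply/negP => /(hv _ w0) [k]; rewrite (valuation_varpi hQ2 hvarpi); lia.
Qed.

(** * Cosets of Z(T~) T0~ detected by an unramified unit *)

Section Unramified.
Variable t0 : F.
Hypothesis ut0 : unit t0.
Hypothesis ht0 : forall b : F, unit b -> hsym t0 b = false.
Hypothesis hvt0 : forall a : F, a != 0 -> hsym a t0 = odd `|val a|.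

Let t0n : t0 != 0. Proof. by case: ut0. Qed.

Lemma comz_unramified s z j : (forall i, s i != 0) ->
  comz (odd `|\sum_i val (s i) * C i j|) (zpow z * Htilde s)%g (hti j t0).
Proof.
move=> s0; rewrite -valuation_root_char // -hvt0 ?root_char_neq0
  // -[X in comz X]addFb.
by apply: comzMl; [exact: comz_zpow | exact: Htilde_comm].
Qed.

Lemma comz_Ttilde x j : TT x -> exists z, comz z x (hti j t0).
Proof.
move=> /TtildeP [s [z [s0 ->]]].
by exists (odd `|\sum_i val (s i) * C i j|); exact: comz_unramified.
Qed.

(** Commutation with the j-th element says that the valuations of the coordinates pair evenly with
    alpha_j. They then define an element of Y~, and dividing by it leaves unit coordinates. *)
Lemma commute_unramified_decomp x : TT x -> (forall j, commute x (hti j t0)) ->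
  exists y g, [/\ Y y, T0t g & x = (y * g)%g].
Proof.
move=> /TtildeP [s [z [s0 ex]]] H.
have hk : even (fun i => val (s i)).
  apply/(even_coroot_latticeP hPhi hDelta) => j.
  have := comz_unique (comz_unramified z j s0); rewrite -ex => /(_ false).
  move/(_ (iffRL (comz_commute _ _) (H j))); set v := \sum_i _ => h.
  by exists (v %/ 2)%Z; lia.
set k := fun i => val (s i) in hk.
have k0 i : varpi ^ k i != 0 by exact: varpiXz_neq0.
exists (ytilde varpi xt Delta k), ((ytilde varpi xt Delta k)^-1 * x)%g; split.
- by apply/mu2YtildeP; exists k, false; rewrite mul1g.
- rewrite /T0tilde /= T0P; exists (fun i => (varpi ^ k i)^-1 * s i); split.
    by move=> i; rewrite mulrC; apply: (valuationP hQ2 hvarpi).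
  rewrite prM pr_inv ytildeE pr_Htilde // torus_ptV
    // ex prM pr_zpow mul1r pr_Htilde //.
  by rewrite torus_ptM.
- by rewrite mulVKg.
Qed.

Lemma Ttilde_T0tilde x : T0t x -> TT x.
Proof.
by move=> /T0tildeP [s [z [us ->]]]; apply/TtildeP; exists s, z; split=> // i;
  case: (us i).
Qed.

Lemma Ttilde_mu2Ytilde x : Y x -> TT x.
Proof.
move=> /mu2YtildeP [k [z [_ ->]]]; apply/TtildeP; rewrite ytildeE.
by exists (fun i => varpi ^ k i), z; split=> // i; exact: varpiXz_neq0.
Qed.

Lemma mu2Ytilde_central x y : Y x -> TT y -> commute x y.
Proof.
move=> /mu2YtildeP [k [z [hk ->]]] Ty; apply/commute_sym/commuteM.
  by apply/comz_commute/comz_sym; exact: comz_zpow.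
exact/commute_sym/ytilde_central.
Qed.

Lemma T0tilde_commute x j : T0t x -> commute x (hti j t0).
Proof.
move=> /T0tildeP [s [z [us ->]]]; have s0 i : s i != 0 by case: (us i).
apply/comz_commute; have := comz_unramified z j s0; rewrite big1 // => i _.
by rewrite (valuation_unit hQ2 hvarpi) ?mul0r.
Qed.

Lemma Ttilde_htilde j t : t != 0 -> TT (hti j t).
Proof.
move=> tn0; rewrite /Ttilde /= pr_htilde //; apply: generated_sub.
by exists (Delta j), t.
Qed.

Lemma ZT0tildeP x : ZT0 x <-> TT x /\ forall j, commute x (hti j t0).
Proof.
split=> [[z [y [[Tz hz] T0y ->]]]|[Tx hx]].
  split.
    rewrite /Ttilde /= prM; apply: generated_mul => //.
    exact: Ttilde_T0tilde T0y.
  move=> j; apply/commute_sym/commuteM; apply/commute_sym.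
    by apply: hz; exact: Ttilde_htilde.
  exact: T0tilde_commute.
have [y [t [Yy T0t' ->]]] := commute_unramified_decomp Tx hx.
exists y, t; split=> //; split; first exact: Ttilde_mu2Ytilde.
by move=> w Tw; exact: mu2Ytilde_central.
Qed.

Lemma ZT0tilde_decomp x : ZT0 x -> exists y g, [/\ Y y, T0t g & x = (y * g)%g].
Proof. by move=> /ZT0tildeP [Tx hx]; exact: commute_unramified_decomp. Qed.

Lemma mu2Ytilde_T0tilde x : Y x -> T0t x -> exists z, x = zpow z.
Proof.
move=> /mu2YtildeP [k [z [_ ->]]] /T0tildeP [s [z' [us e]]].
have s0 i : s i != 0 by case: (us i).
have es := Htilde_inj (fun i => varpiXz_neq0 (k i)) s0 e.
exists z; suff -> : k = (fun=> 0) by rewrite ytilde0 mulg1.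
by apply: funext => i; apply: (unit_varpiXz hQ2 hvarpi); rewrite es.
Qed.

Lemma TRtilde_radical s : (forall i, unit (s i)) ->
  (forall i (b : F), unit b -> hsym (s i) b = false) ->
  TRtilde abs2 Phi X xt Delta (Htilde s).
Proof.
move=> us hs; have s0 i : s i != 0 by case: (us i).
exists s; split=> //; rewrite /TR /torus_over.
elim/big_ind: _; first exact: generated_one.
  by move=> ? ?; exact: generated_mul.
move=> i _; apply: generated_sub; exists (Delta i), (s i); split=> //.
by split=> // b /(hs i)/negbFE.
Qed.

Lemma htilde_unramified_TRtilde j : TRtilde abs2 Phi X xt Delta (hti j t0).
Proof.
have -> : hti j t0 = Htilde (fun i => if i == j then t0 else 1).
  rewrite /Htilde (big_only1 j) ?eqxx // => i /negbTE -> _.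
  exact: htilde1.
apply: TRtilde_radical => [i|i b ub]; case: (i == j) => //;
  first exact: (int_unit1 hQ2).
  exact: ht0.
by apply: hsym1; case: ub.
Qed.

Lemma htilde_unramified_T0tilde j : T0t (hti j t0).
Proof.
rewrite /T0tilde /= pr_htilde //; apply: generated_sub.
by exists (Delta j), t0.
Qed.

(** Coordinates close to 1 are squares, hence in R. So T_R contains a neighborhood of 1 in T~, which
    makes sections built from tau smooth. *)
Lemma Ttilde_small_TRtilde : exists2 U : set Gt, nbhs (1%g : Gt) U &
  forall x, U x -> TT x -> TRtilde abs2 Phi X xt Delta x /\ T0t x.
Proof.
have [M hM] := near1_square hQ2 hvarpi 0.
have [U hU US] := Ttilde_small M; exists U => // x Ux Tx.
have [s hs ->] := US x Ux Tx.
have us i : unit (s i) by exact: (near1_unit hQ2 hvarpi) (hs i).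
split; last by apply/T0tildeP; exists s, false; rewrite mul1g.
apply: TRtilde_radical => // i b ub.
have [u _ ->] := hM _ (near_le (leqnSn _) (hs i)).
by apply: hsym_sqr; case: ub.
Qed.

(** * Extension of characters from the even lattice to the torus *)

Definition monomial (K : fieldType) (d : 'I_r -> K) (k : 'I_r -> int) : K :=
  \prod_i d i ^ k i.

Lemma monomialD (K : fieldType) (d : 'I_r -> K) k l : (forall i, d i != 0) ->
  monomial d (fun i => k i + l i) = monomial d k * monomial d l.
Proof.
move=> d0; rewrite -big_split; apply: eq_bigr => i _ /=.
by rewrite expfzDr.
Qed.

Lemma monomialMz (K : fieldType) (d : 'I_r -> K) k (q : int) :
  monomial d (fun i => k i * q) = monomial d k ^ q.
Proof.
rewrite /monomial; elim/big_rec2: _ => [|i x y _ ->]; first by rewrite exp1rz.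
by rewrite expfzMl exprz_exp.
Qed.

Lemma monomial_neq0 (K : fieldType) (d : 'I_r -> K) k : (forall i, d i != 0) ->
  monomial d k != 0.
Proof.
move=> d0; rewrite /monomial; elim/big_ind: _ => [||i _].
- exact: oner_neq0.
- exact: mulf_neq0.
- exact: expfz_neq0.
Qed.

(* A character of a lattice between 2 Z^r and Z^r extends to Z^r: extract
   square roots, one coordinate at a time. *)
Lemma lattice_character_extension (K : numClosedFieldType)
    (L : ('I_r -> int) -> Prop) (psi : ('I_r -> int) -> K) :
  L (fun=> 0) ->
  (forall k l, L k -> L l -> L (fun i => k i + l i)) ->
  (forall k, L k -> L (fun i => - k i)) ->
  (forall k, L (fun i => k i * 2)) ->
  (forall k, L k -> psi k != 0) ->
  (forall k l, L k -> L l -> psi (fun i => k i + l i) = psi k * psi l) ->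
  exists2 d : 'I_r -> K, (forall i, d i != 0) & forall k, L k ->
    psi k = monomial d k.
Proof.
move=> L0 LD LN L2 psi0 psiD.
have psi_0 : psi (fun=> 0) = 1.
  by apply: (mulfI (psi0 _ L0)); rewrite mulr1 -psiD.
have LM k (q : nat) : L k ->
  L (fun i => k i * q%:Z) /\ psi (fun i => k i * q%:Z) = psi k ^+ q.
  move=> Lk; elim: q => [|q [Lq eq]].
    have -> : (fun i => k i * 0%N%:Z) = (fun=> 0) by apply: funext => i;
      rewrite mulr0.
    by rewrite psi_0.
  have -> : (fun i => k i * q.+1%:Z) = (fun i => k i + k i * q%:Z).
    by apply: funext => i; rewrite intS mulrDr mulr1.
  by split; [exact: LD | rewrite psiD // eq exprS].
have LMz k (q : int) : L k ->
  L (fun i => k i * q) /\ psi (fun i => k i * q) = psi k ^ q.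
  move=> Lk; case: q => q; first exact: LM.
  have [Lq eq] := LM k q.+1 Lk.
  have e : (fun i => k i * Negz q) = (fun i => - (k i * q.+1%:Z)).
    by apply: funext => i; rewrite NegzE mulrN.
  split; rewrite e; first exact: LN.
  apply: (mulfI (psi0 _ Lq)); rewrite -psiD //; last exact: LN.
  rewrite NegzE -exprnN eq divff ?expf_neq0 ?psi0 // -psi_0.
  by congr psi; apply: funext => i; rewrite subrr.
suff H n : (n <= r)%N -> exists2 d : 'I_r -> K, (forall i, d i != 0) &
    forall k, L k -> (forall i : 'I_r, (n <= i)%N -> k i = 0) ->
      psi k = monomial d k.
  have [d d0 hd] := H r (leqnn r); exists d => // k Lk; apply: hd => // i.
  by rewrite leqNgt ltn_ord.
elim: n => [|n IH] hn.
  exists (fun=> 1) => [i|k Lk k0]; first exact: oner_neq0.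
  have -> : k = (fun=> 0) by apply: funext => i; exact: k0.
  by rewrite psi_0 /monomial big1 // => i _; rewrite expr0z.
have [d d0 hd] := IH (ltnW hn).
pose i0 : 'I_r := Ordinal hn.
pose supp k := forall i : 'I_r, (n.+1 <= i)%N -> k i = 0 :> int.
(* e generates the group of i0-th coordinates of elements of L supported on the first n.+1 indices;
   since L contains 2 Z^r, e is 1 or 2. The value of the new character at i0 is then an e-th root
   chosen so that it agrees with psi at l. *)
have [l [e [e0 Ll sl le hdv]]] : exists l (e : nat), [/\ (0 < e)%N, L l, supp l,
  l i0 = e%:Z
    & forall k, L k -> supp k -> exists q, k i0 = q * e%:Z].
  pose dl (i : 'I_r) : int := (i == i0)%:Z.
  have sdl q : supp (fun i => dl i * q).
    move=> i hi; rewrite /dl; case: eqP => [e|_]; last by rewrite mul0r.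
    by move: hi; rewrite e ltnn.
  case: (pselect (exists2 l, L l /\ supp l & odd `|l i0|)) => [[l [Ll sl] ol]|nex].
    exists (fun i => l i + dl i * (- (l i0 %/ 2)%Z) * 2), 1%N; split=> //.
    - apply: LD => //; exact: (L2 (fun i => dl i * _)).
    - by move=> i hi; rewrite sl // (sdl _ i hi).
    - rewrite /dl eqxx; lia.
    - by move=> k _ _; exists (k i0); rewrite mulr1.
  exists (fun i => dl i * 2), 2%N; split=> //.
  - by rewrite /dl eqxx.
  - move=> k Lk sk; exists (k i0 %/ 2)%Z.
    have : ~ odd `|k i0| by move=> ok; apply: nex; exists k.
    lia.
pose x := psi l / monomial d (fun i => if i == i0 then 0 else l i).
pose d' i := if i == i0 then e.-root x else d i.
have x0 : x != 0 by rewrite mulf_neq0 ?invr_eq0 ?monomial_neq0 ?psi0.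
have d'0 i : d' i != 0.
  by rewrite /d'; case: ifP => // _; rewrite rootC_eq0.
have mono_d' k : k i0 = 0 -> monomial d' k = monomial d k.
  move=> k0; apply: eq_bigr => i _; rewrite /d'; case: eqP => // ->.
  by rewrite k0 !expr0z.
have psil : psi l = monomial d' l.
  have -> : monomial d' l = e.-root x ^ l i0 * monomial d' (fun i =>
    if i == i0 then 0 else l i).
    rewrite /monomial (bigD1 i0) //= {1}/d' eqxx; congr (_ * _).
    rewrite [RHS](bigD1 i0) //= eqxx expr0z mul1r; apply: eq_bigr => i /negbTE ->.
    by [].
  rewrite mono_d' ?eqxx // le -exprnP rootCK // /x divfK //.
  exact: monomial_neq0.
exists d' => // k Lk sk; have [q hq] := hdv k Lk sk.
have [Lq eq] := LMz l (- q) Ll.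
pose k' i := k i + l i * - q.
have Lk' : L k' by exact: LD.
have k'0 : k' i0 = 0 by rewrite /k' hq le; ring.
have ek : psi k' = monomial d' k'.
  rewrite mono_d' //; apply: hd => // i; rewrite leq_eqVlt => /orP [/eqP ni|hi].
    by have -> : i = i0 by exact: val_inj.
  by rewrite /k' sk // sl // mul0r.
move: ek; rewrite psiD // eq monomialD // monomialMz -psil.
by move/(mulIf (expfz_neq0 _ (psi0 _ Ll))).
Qed.

(** Triviality at zeta makes psi multiplicative in the exponent k of y~(varpi). The extension
    depends only on the valuations of the coordinates, which vanish on T0. *)
Lemma unramified_extension (psi : Gt -> R[i]) :
  (forall y, Y y -> psi y != 0) ->
  (forall x y, Y x -> Y y -> psi (x * y)%g = psi x * psi y) ->
  psi zeta = 1 ->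
  exists chi : M -> R[i],
    is_unramified abs2 Phi X chi /\
    forall y, Y y -> chi (pr y) = psi y.
Proof.
move=> psi0 psiM psiz.
have Yy k : even k -> Y (ytilde varpi xt Delta k).
  by move=> hk; apply/mu2YtildeP; exists k, false; rewrite mul1g.
have Yz z : Y (zpow z).
  by apply/mu2YtildeP; exists (fun=> 0), z; rewrite ytilde0 mulg1; split=> //;
    exact: even0.
have psi1 : psi 1%g = 1.
  have Y1 := Yz false; apply: (mulfI (psi0 _ Y1)); rewrite mulr1 -psiM //.
  by rewrite mulg1.
have psizp z : psi (zpow z) = 1 by case: z.
have [|k l hk hl|k hk|k|k hk|k l hk hl|d d0 hd] := @lattice_character_extension R[i]
   (fun k => even k) (fun k => psi (ytilde varpi xt Delta k)).
- exact: even0.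
- exact: evenD.
- exact: evenN.
- exact: even_double.
- by apply: psi0; exact: Yy.
- have [z e] := ytildeM k l.
  rewrite -psiM; [|exact: Yy|exact: Yy].
  rewrite e psiM ?psizp ?mul1r //; apply: Yy; exact: evenD.
pose coord (g : M) := xget (fun=> 1 : F) [set s : 'I_r ->
  F | (forall i, s i != 0) /\ g = torus_pt s].
have coordE s : (forall i, s i != 0) -> coord (torus_pt s) = s.
  move=> s0; rewrite /coord; case: xgetP => [s' -> [s'0 e]|/(_ s) nh];
    last by case: nh.
  by apply: funext => i; apply: torus_pt_inj.
exists (fun p => monomial d (fun i => val (coord p i))); split; first split.
- by move=> g _; exact: monomial_neq0.
- move=> _ _ /torusP [s [s0 ->]] /torusP [s' [s'0 ->]].
  rewrite torus_ptM !coordE // => [|i]; last by rewrite mulf_neq0.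
  rewrite -monomialD //; congr monomial; apply: funext => i.
  by rewrite (valuationM hQ2 hvarpi).
- move=> _ /T0P [s [us ->]]; rewrite coordE; last by move=> i; case: (us i).
  rewrite /monomial big1 // => i _.
  by rewrite (valuation_unit hQ2 hvarpi).
- move=> _ /mu2YtildeP [k [z [hk ->]]].
  have w0 i : varpi ^ k i != 0 by exact: varpiXz_neq0.
  rewrite psiM ?psizp ?mul1r; [|exact: Yz|exact: Yy].
  rewrite hd // prM pr_zpow mul1r ytildeE pr_Htilde // coordE //.
  congr monomial; apply: funext => i.
  by rewrite (valuationXz hQ2 hvarpi) ?(uniformizer_neq0 hvarpi)
    // (valuation_varpi hQ2 hvarpi) mulr1.
Qed.

(** * Representations of the covering torus *)

Section Representations.
Variable eta : Gt -> R[i].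
Hypothesis heta : is_eta varpi Phi zeta xt Delta eta.
Variables (V : lmodType R[i]) (tau : Gt -> {linear V -> V}).
Hypothesis htau : is_pseudo_spherical abs2 Phi X pr zeta xt Delta tau.
Implicit Types (v : V) (x y h q : Gt).

Local Notation taueta := (tau_eta abs2 varpi Phi X pr zeta xt Delta eta tau).

Let tau1 v : tau 1%g v = v.
Proof. by case: htau => -[[h _] _ _] _ _; exact: h. Qed.

Let tauM g h v : T0t g -> T0t h -> tau (g * h)%g v = tau g (tau h v).
Proof. by case: htau => -[[_ H] _ _] _ _; exact: H. Qed.

Let tau_zeta v : tau zeta v = - v.
Proof. by case: htau. Qed.

Definition sgnz (z : bool) : R[i] := if z then -1 else 1.

Lemma tau_zpow z v : tau (zpow z) v = sgnz z *: v.
Proof. by case: z; rewrite /= ?scaleN1r ?scale1r. Qed.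

Lemma zpow_mu2Ytilde z : Y (zpow z).
Proof.
apply/mu2YtildeP; exists (fun=> 0), z; rewrite ytilde0 mulg1; split=> //.
exact: even0.
Qed.

Lemma zpow_T0tilde z : T0t (zpow z).
Proof. by rewrite /T0tilde /= pr_zpow; exact: generated_one. Qed.

Lemma eta1 : eta 1%g = 1.
Proof.
have Y1 := zpow_mu2Ytilde false.
apply: (mulfI (eta_neq0 heta Y1)); rewrite mulr1 -(etaM heta) //.
by rewrite mulg1.
Qed.

Lemma eta_zpow z : eta (zpow z) = sgnz z.
Proof. by case: z; rewrite /= ?eta1 ?(eta_genuine heta). Qed.

Lemma mu2YtildeM x y : Y x -> Y y -> Y (x * y)%g.
Proof. by move=> hx hy; exact: generated_mul. Qed.

Lemma T0tildeM x y : T0t x -> T0t y -> T0t (x * y)%g.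
Proof. by move=> hx hy; rewrite /T0tilde /= prM; exact: generated_mul. Qed.

Lemma T0tildeV x : T0t x -> T0t (x^-1)%g.
Proof. by move=> hx; rewrite /T0tilde /= pr_inv; exact: generated_inv. Qed.

Lemma TtildeM x y : TT x -> TT y -> TT (x * y)%g.
Proof. by move=> hx hy; rewrite /Ttilde /= prM; exact: generated_mul. Qed.

Lemma TtildeV x : TT x -> TT (x^-1)%g.
Proof. by move=> hx; rewrite /Ttilde /= pr_inv; exact: generated_inv. Qed.

Lemma Ttilde1 : TT 1%g.
Proof. by rewrite /Ttilde /= (cover_one hGt); exact: generated_one. Qed.

Lemma mulg_mu2Ytilde_T0tilde_ZT0tilde y q : Y y -> T0t q -> ZT0 (y * q)%g.
Proof.
move=> Yy Tt; exists y, q; split=> //; split; first exact: Ttilde_mu2Ytilde.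
by move=> x Tx; exact: mu2Ytilde_central.
Qed.

(** Two decompositions differ by an element common to mu_2 Y~(varpi) and T0~, hence by a sign, on
    which eta and tau agree. *)
Lemma tau_etaE y q v : Y y -> T0t q -> taueta (y * q)%g v = eta y *: tau q v.
Proof.
move=> Yy Tt; rewrite /tau_eta;
  case: xgetP => [[y' q'] _ /= [Yy' Tt' e]|/(_ (y, q))]; last first.
  by case.
have e1 : (y'^-1 * y = q' * q^-1)%g.
  by apply: (mulgI y'); rewrite mulVKg mulgA -e mulgK.
have [|z hz] := @mu2Ytilde_T0tilde (y'^-1 * y)%g (generated_mul (generated_inv Yy')
  Yy).
  by rewrite e1; apply: T0tildeM => //; exact: T0tildeV.
have ey : y = (y' * zpow z)%g by rewrite -hz mulVKg.
have et : q' = (zpow z * q)%g by rewrite -hz e1 mulgVK.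
rewrite ey et (etaM heta) //; last exact: zpow_mu2Ytilde.
rewrite eta_zpow tauM //; last exact: zpow_T0tilde.
by rewrite tau_zpow scalerA.
Qed.

Lemma tau_etaM h h' v : ZT0 h -> ZT0 h' ->
  taueta (h * h')%g v = taueta h (taueta h' v).
Proof.
move=> /ZT0tilde_decomp [y [q [Yy Tt ->]]] /ZT0tilde_decomp [y' [q' [Yy' Tt' ->]]].
have -> : (y * q * (y' * q') = (y * y') * (q * q'))%g.
  have ct : commute y' q by apply: mu2Ytilde_central => //; exact: Ttilde_T0tilde.
  by rewrite !mulgA -[(y * q * y')%g]mulgA -ct !mulgA.
rewrite !tau_etaE //; [|exact: mu2YtildeM|exact: T0tildeM].
by rewrite (etaM heta) // tauM // linearZ scalerA.
Qed.

Lemma tau_eta_T0tilde q v : T0t q -> taueta q v = tau q v.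
Proof.
by move=> Tt; rewrite -{1}(mul1g q) (tau_etaE _ (zpow_mu2Ytilde false))
  // eta1 scale1r.
Qed.

Lemma tau_eta_linear h (k : R[i]) v v' : ZT0 h ->
  taueta h (k *: v + v') = k *: taueta h v + taueta h v'.
Proof.
move=> /ZT0tilde_decomp [y [q [Yy Tt ->]]].
by rewrite !tau_etaE // linearP scalerDr !scalerA mulrC.
Qed.

Lemma ZT0tilde_T0tilde q : T0t q -> ZT0 q.
Proof.
move=> Tt; rewrite -(mul1g q).
exact: mulg_mu2Ytilde_T0tilde_ZT0tilde (zpow_mu2Ytilde false) Tt.
Qed.

Lemma ZT0tilde_Ttilde x : ZT0 x -> TT x. Proof. by move=> /ZT0tildeP []. Qed.

Lemma ZT0tildeM x y : ZT0 x -> ZT0 y -> ZT0 (x * y)%g.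
Proof.
move=> /ZT0tildeP [Tx hx] /ZT0tildeP [Ty hy]; apply/ZT0tildeP.
split; first exact: TtildeM.
by move=> j; apply/commute_sym/commuteM; exact/commute_sym.
Qed.

Lemma ZT0tildeV x : ZT0 x -> ZT0 (x^-1)%g.
Proof.
move=> /ZT0tildeP [Tx hx]; apply/ZT0tildeP; split; first exact: TtildeV.
by move=> j; apply/commute_sym/commuteV/commute_sym.
Qed.

Lemma ZT0tildeMr x y : ZT0 y -> ZT0 (x * y)%g -> ZT0 x.
Proof. by move=> /ZT0tildeV hy hxy; rewrite -(mulgK y x); exact: ZT0tildeM. Qed.

Variables (W : lmodType R[i]) (pi : Gt -> {linear W -> W}).
Hypothesis hpi_smooth : is_smooth (Ttilde Phi X pr) pi.
Hypothesis hpi_irr : is_irreducible (Ttilde Phi X pr) pi.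
Implicit Types w : W.

Let pi1 w : pi 1%g w = w.
Proof. by case: hpi_irr => -[h _] _ _; exact: h. Qed.

Let piM g h w : TT g -> TT h -> pi (g * h)%g w = pi g (pi h w).
Proof. by case: hpi_irr => -[_ H] _ _; exact: H. Qed.

(** Irreducibility as an induction principle: a linear T~-stable property of one nonzero vector
    holds for all vectors. Below, properties not obviously stable are first quantified over all
    translates. *)
Lemma stable_subspace_full (S : set W) : S 0 -> (forall w w', S w -> S w' ->
  S (w + w')) ->
  (forall k w, S w -> S (k *: w)) -> (forall g w, TT g -> S w -> S (pi g w)) ->
  forall w0, S w0 -> w0 <> 0 -> forall w, S w.
Proof.
move=> S0 SD SZ Spi w0 Sw0 w00 w.
case: hpi_irr => _ _ /(_ S S0 SD SZ Spi) [e|->] //.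
by rewrite e in Sw0.
Qed.

Lemma iso_i_isotypic (chi : M -> R[i]) : is_unramified abs2 Phi X chi ->
  iso_i abs2 varpi Phi X pr zeta xt Delta eta tau chi pi ->
  exists2 w : W, isotypic_subspace T0t tau pi w & w <> 0.
Proof.
move=> [chi0 chiM chi1] [j [jinj jrange jpi]].
pose f v : Gt -> V := fun x => if pselect (ZT0 x) then taueta x v else 0.
have fE v x : ZT0 x -> f v x = taueta x v by rewrite /f; case: pselect.
have f0 v x : ~ ZT0 x -> f v x = 0 by rewrite /f; case: pselect.
have fInd v : Ind ZT0 TT taueta (f v).
  split=> [x nTx|h x Zh Tx|].
  - by apply: f0 => /ZT0tilde_Ttilde.
  - case: (pselect (ZT0 x)) => Zx.
      by rewrite !fE ?tau_etaM //; exact: ZT0tildeM.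
    have [y [q [Yy Tt eh]]] := ZT0tilde_decomp Zh.
    rewrite !f0 //; first by rewrite eh tau_etaE // linear0 scaler0.
    move=> Zhx; apply: Zx; rewrite -(mulKg h x).
    by apply: ZT0tildeM => //; exact: ZT0tildeV.
  (* Smoothness: a small translation lies in T_R, where tau is trivial. *)
  - have [U hU US] := Ttilde_small_TRtilde; exists U => // g x Ug Tg Tx.
    have [TRg T0g] := US g Ug Tg; have Zg := ZT0tilde_T0tilde T0g.
    case: (pselect (ZT0 x)) => Zx; last first.
      by rewrite !f0 // => /(ZT0tildeMr Zg).
    rewrite !fE //; last exact: ZT0tildeM.
    by rewrite tau_etaM // (tau_eta_T0tilde _ T0g); case: htau => _ _ ->.
have ex v : exists w, j w = f v.
  by have : range j (f v); [rewrite jrange | move=> [w _ e]; exists w].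
have [s hs] := choice ex.
have slin : linear s.
  move=> k v v'; apply: jinj; rewrite linearP !hs; apply: funext => x.
  rewrite /GRing.add /GRing.scale /=.
  case: (pselect (ZT0 x)) => Zx; last by rewrite !f0 // scaler0 addr0.
  by rewrite !fE // tau_eta_linear.
pose sl : {linear V -> W} := HB.pack s (GRing.isLinear.Build _ _ _ _ s slin).
have sinj : injective sl.
  move=> v v' /(congr1 j); rewrite /= !hs => /(congr1 (fun F => F 1%g)).
  have Z1 : ZT0 1%g := ZT0tilde_T0tilde (zpow_T0tilde false).
  by rewrite !fE // !(tau_eta_T0tilde _ (zpow_T0tilde false)) !tau1.
have [v0 v00] : exists v : V, v <> 0 by case: htau => -[].
exists (sl v0).
  exists 1%N, (fun=> sl), (fun=> v0); split=> [_|_ q v Tt|];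
    last by rewrite big_ord1.
    exact: sinj.
  apply: jinj; rewrite /= jpi ?hs; last exact: Ttilde_T0tilde Tt.
  have Zt := ZT0tilde_T0tilde Tt.
  apply: funext => x; rewrite chi1 // scale1r.
  case: (pselect (ZT0 x)) => Zx; last first.
    by rewrite !f0 // => /(ZT0tildeMr Zt).
  rewrite !fE ?tau_etaM ?(tau_eta_T0tilde _ Tt) //; exact: ZT0tildeM.
by move=> s0; apply: v00; apply: sinj; rewrite s0 linear0.
Qed.

(** * The central character of a representation containing tau *)

Section Embedding.
Variable f : {linear V -> W}.
Hypothesis finj : injective f.
Hypothesis fequiv : forall q v, T0t q -> f (tau q v) = pi q (f v).

Let v0_ex : exists v : V, v <> 0. Proof. by case: htau => -[]. Qed.

Let f_neq0 v : v <> 0 -> f v <> 0.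
Proof. by move=> v0 fv; apply: v0; apply: finj; rewrite fv linear0. Qed.

(** The (-1)-eigenspace of zeta is stable because zeta is central, and it contains the image of
    tau. *)
Lemma pi_zpow z w : pi (zpow z) w = sgnz z *: w.
Proof.
have Tz : TT zeta := Ttilde_T0tilde (zpow_T0tilde true).
case: z => /=; last by rewrite scale1r.
have [v v0] := v0_ex.
apply: (@stable_subspace_full [set w | pi zeta w = -1 *: w]) (f_neq0 v0) _.
- by rewrite /= linear0 scaler0.
- by move=> x y /= hx hy; rewrite linearD hx hy scalerDr.
- by move=> k x /= hx; rewrite linearZZ hx !scalerA mulrC.
- by move=> g x Tg /= hx; rewrite -piM // (zeta_central hGt) piM // hx linearZZ.
- by rewrite /= -(fequiv _ (zpow_T0tilde true)) tau_zeta scaleN1r linearN.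
Qed.

(** By smoothness w0 is fixed by a neighborhood of 1 in T~, and countably many translates of it
    cover T~. The orbit of w0 is thus countable, and it spans W. *)
Lemma pi_countable_span w0 : w0 <> 0 -> exists e : nat -> W,
  forall w, exists n (a : 'I_n -> R[i]), w = \sum_i a i *: e i.
Proof.
move=> w00; have [U hU hUw] := hpi_smooth w0.
have [I [s [Ts hs]]] := Ttilde_countable hU.
pose e n := if @unpickle I n is Some i then pi (s i) w0 else 0.
exists e => w.
have widen n m (a : 'I_n -> R[i]) : exists b : 'I_(n + m) -> R[i],
    \sum_i a i *: e i = \sum_i b i *: e i.
  exists (fun i : 'I_(n + m) => if fintype.split i is inl i' then a i' else 0).
  rewrite big_split_ord /= [X in _ = _ + X]big1 ?addr0.
    apply: eq_bigr => i _.
    by rewrite (unsplitK (inl i) : fintype.split (lshift m i) = _).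
  by move=> i _; rewrite (unsplitK (inr i) : fintype.split (rshift n i) =
    _) scale0r.
have orbit g : TT g -> exists n (a : 'I_n -> R[i]), pi g w0 = \sum_i a i *: e i.
  move=> Tg; have [i [y [Uy Ty ->]]] := hs g Tg.
  exists (pickle i).+1, (fun l => if l == ord_max then 1 else 0).
  rewrite big_ord_recr /= eqxx scale1r big1 => [|l _].
    by rewrite add0r /e pickleK piM // hUw.
  by rewrite -val_eqE /= ltn_eqF ?scale0r.
pose S := [set w : W | forall g, TT g -> exists n (a : 'I_n ->
  R[i]), pi g w = \sum_i a i *: e i].
have : S w; last by move/(_ _ Ttilde1); rewrite pi1.
apply: (@stable_subspace_full S) w00 _.
- move=> g Tg; exists 0%N, (fun=> 0); rewrite linear0 big_ord0 //.
- move=> x y Sx Sy g Tg; have [n [a ea]] := Sx g Tg; have [m [b eb]] := Sy g Tg.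
  have [a' ea'] := widen n m a; have [b' eb'] := widen m n b.
  rewrite linearD ea eb ea' eb'; move: b' {eb'}; rewrite addnC => b'.
  exists (n + m)%N, (fun i => a' i + b' i).
  by rewrite -big_split; apply: eq_bigr => i _; rewrite scalerDl.
- move=> k x Sx g Tg; have [n [a ea]] := Sx g Tg.
  exists n, (fun i => k * a i); rewrite linearZZ ea scaler_sumr.
  by apply: eq_bigr => i _; rewrite scalerA.
- by move=> g x Tg Sx h Th; rewrite -piM //; apply: Sx; exact: TtildeM.
- by [].
Qed.

(** The image of pi y - k is stable; if the map is injective, the image is nonzero, hence
    everything, which is the surjectivity that [schur_countable] requires. The eigenspace so found
    is stable too. *)
Lemma pi_central_scalar y : TT y -> (forall x, TT x -> commute y x) ->
  exists k, forall w, pi y w = k *: w.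
Proof.
move=> Ty cy; have [v v0] := v0_ex; have w00 := f_neq0 v0.
have [e he] := pi_countable_span w00.
have cpi g w : TT g -> pi y (pi g w) = pi g (pi y w).
  by move=> Tg; rewrite -!piM // cy.
have [k inj|k [w1 [w10 hw1]]] := schur_countable (phi := pi y) w00 he.
  pose S := [set w : W | exists u : W, pi y u - k *: u = w].
  have : S (f v); last by case=> u hu; exists u.
  have nz : pi y (f v) - k *: f v <> 0.
    by move/eqP; rewrite subr_eq0 => /eqP /inj; exact: w00.
  apply: (@stable_subspace_full S) nz _.
  - by exists 0; rewrite linear0 scaler0 subr0.
  - by move=> _ _ [u <-] [u' <-]; exists (u + u');
    rewrite linearD scalerDr opprD addrACA.
  - move=> l _ [u <-]; exists (l *: u).
    by rewrite linearZZ scalerBr !scalerA mulrC.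
  - by move=> g _ Tg [u <-]; exists (pi g u);
    rewrite cpi // [in RHS]linearB [in RHS]linearZZ.
  - by exists (f v).
exists k; apply: (@stable_subspace_full [set w | pi y w = k *: w]) w10.
- by rewrite /= linear0 scaler0.
- by move=> a b /= ha hb; rewrite linearD ha hb scalerDr.
- by move=> l a /= ha; rewrite linearZZ ha !scalerA mulrC.
- by move=> g a Tg /= ha; rewrite cpi // ha linearZZ.
- by [].
Qed.

(** [om] is the central character. Both [om] and eta are -1 at zeta, so their quotient is a
    character to which [unramified_extension] applies. *)
Lemma central_character_extension : exists2 chi : M ->
  R[i], is_unramified abs2 Phi X chi &
  forall y w, Y y -> pi y w = (chi (pr y) * eta y) *: w.
Proof.
have [v v0] := v0_ex; have w00 := f_neq0 v0.
have ex y : exists k, Y y -> forall w, pi y w = k *: w.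
  case: (pselect (Y y)) => [Yy|nY]; last by exists 0.
  have [|x Tx|k hk] := @pi_central_scalar y; last by exists k.
    exact: Ttilde_mu2Ytilde.
  exact: mu2Ytilde_central.
have [om hom] := choice ex.
have scal_inj (k l : R[i]) : k *: f v = l *: f v -> k = l.
  move/eqP; rewrite -subr_eq0 -scalerBl scaler_eq0 subr_eq0 => /orP [/eqP //|/eqP].
  by [].
have omM x y : Y x -> Y y -> om (x * y)%g = om x * om y.
  move=> Yx Yy; apply: scal_inj; rewrite -hom; last exact: mu2YtildeM.
  by rewrite piM ?hom ?scalerA //; exact: Ttilde_mu2Ytilde.
have om1 : om 1%g = 1.
  by apply: scal_inj; rewrite -hom ?pi1 ?scale1r //; exact: (zpow_mu2Ytilde false).
have om0 y : Y y -> om y != 0.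
  move=> Yy; have YV : Y (y^-1)%g by exact: generated_inv.
  by apply/eqP => o0; have := omM _ _ Yy YV; rewrite mulgV om1 o0 mul0r => /eqP;
    rewrite oner_eq0.
have omz : om zeta = -1.
  by apply: scal_inj; rewrite -hom;
    [exact: (pi_zpow true)|exact: (zpow_mu2Ytilde true)].
have [y Yy|x y Yx Yy||chi [hchi chiE]] :=
  @unramified_extension (fun y => om y / eta y).
- by rewrite mulf_neq0 ?invr_eq0 ?om0 // (eta_neq0 heta).
- by rewrite omM // (etaM heta) // mulf_div.
- by rewrite omz (eta_genuine heta) divff // oppr_eq0 oner_eq0.
- exists chi => // y w Yy; rewrite chiE // divfK ?hom //.
  exact: (eta_neq0 heta).
Qed.

(** * Averaging projection and Frobenius reciprocity *)

Section Twist.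
Variable chi : M -> R[i].
Hypothesis hchi : is_unramified abs2 Phi X chi.
Hypothesis chiE : forall y w, Y y -> pi y w = (chi (pr y) * eta y) *: w.

Let chi0 g : TT g -> chi (pr g) != 0.
Proof. by case: hchi => h _ _ Tg; exact: h. Qed.

Let chiM g h : TT g -> TT h -> chi (pr (g * h)%g) = chi (pr g) * chi (pr h).
Proof. by case: hchi => _ h' _ Tg Th; rewrite prM; exact: h'. Qed.

Let chi1 g : T0t g -> chi (pr g) = 1.
Proof. by case: hchi => _ _ h T0g; exact: h. Qed.

Definition twist g w : W := (chi (pr g))^-1 *: pi g w.

Lemma twistM g h w : TT g -> TT h -> twist (g * h)%g w = twist g (twist h w).
Proof.
move=> Tg Th; rewrite /twist piM // chiM // linearZZ scalerA invfM //.
Qed.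

Lemma twist_linear g (k : R[i]) w w' : twist g (k *: w + w') = k *: twist g w +
  twist g w'.
Proof. by rewrite /twist linearP scalerDr !scalerA mulrC. Qed.

Lemma twist0 g : twist g 0 = 0. Proof. by rewrite /twist linear0 scaler0. Qed.

Lemma twistE g w : TT g -> pi g w = chi (pr g) *: twist g w.
Proof. by move=> Tg; rewrite /twist scalerA divff ?scale1r // chi0. Qed.

Lemma twist_T0tilde g w : T0t g -> twist g w = pi g w.
Proof. by move=> Tg; rewrite /twist chi1 // invr1 scale1r. Qed.

Lemma twist_ZT0tilde h v : ZT0 h -> twist h (f v) = f (taueta h v).
Proof.
move=> /ZT0tilde_decomp [y [q [Yy Tq ->]]].
have Ty := Ttilde_mu2Ytilde Yy.
have Tq' := Ttilde_T0tilde Tq.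
rewrite twistM // (twist_T0tilde _ Tq) -fequiv //.
by rewrite /twist chiE // scalerA mulKf ?chi0 // tau_etaE // linearZZ.
Qed.

(* The elements hti j t0 act trivially on f V and by signs, not all trivial, on
   its translates by elements outside ZT0: averaging over them projects W onto
   f V. *)
Definition projection (s : seq 'I_r) w : W :=
  foldr (fun j w' => 2%:R^-1 *: (w' + pi (hti j t0) w')) w s.

Lemma projection_linear (s : seq 'I_r) (k : R[i]) w w' :
  projection s (k *: w + w') = k *: projection s w + projection s w'.
Proof.
elim: s => //= j s ->; rewrite linearP addrACA -scalerDr [LHS]scalerDr !scalerA.
by rewrite mulrC.
Qed.

Lemma projection0 (s : seq 'I_r) : projection s 0 = 0.
Proof. by elim: s => //= j s ->; rewrite linear0 addr0 scaler0. Qed.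

Let two0 : (2%:R : R[i]) != 0. Proof. by rewrite pnatr_eq0. Qed.

Lemma pi_htilde_translate j k v z : TT k -> comz z k (hti j t0) ->
  pi (hti j t0) (twist k (f v)) = sgnz z *: twist k (f v).
Proof.
move=> Tk /comz_sym hz; have Tj := Ttilde_htilde j t0n.
have Tz := Ttilde_T0tilde (zpow_T0tilde z); have Tkj := TtildeM Tk Tj.
rewrite /twist linearZZ -piM // hz piM // pi_zpow piM //.
rewrite -fequiv; last exact: htilde_unramified_T0tilde.
have -> : tau (hti j t0) v = v.
  by case: htau => _ _ -> //; exact: htilde_unramified_TRtilde.
by rewrite !scalerA mulrC.
Qed.

Lemma projection_commute (s : seq 'I_r) k v : TT k ->
  (forall j, commute k (hti j t0)) ->
  projection s (twist k (f v)) = twist k (f v).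
Proof.
move=> Tk hk; elim: s => //= j s ->.
rewrite (pi_htilde_translate _ Tk (iffRL (comz_commute _ _) (hk j))) scale1r.
by rewrite scalerDr -scalerDl -[X in X *: _]mulr2n -[X in X *: _]mulr_natr mulVf
  ?scale1r.
Qed.

(** Each averaging factor acts on the translate by a scalar, and the factor of index j by (1 - 1)/2
    = 0. *)
Lemma projection_anticommute j (s : seq 'I_r) k v : TT k ->
  comz true k (hti j t0) -> j \in s ->
  projection s (twist k (f v)) = 0.
Proof.
move=> Tk hk; elim: s => //= i s IH; rewrite inE.
case: (boolP (j \in s)) => [/IH -> _|_]; first by rewrite linear0 addr0 scaler0.
rewrite orbF => /eqP <- {IH}.
have [z hz] : exists z, projection s (twist k (f v)) = z *: twist k (f v).
  elim: s => [|l s [z hz]] /=; first by exists 1; rewrite scale1r.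
  have [z' hz'] := comz_Ttilde l Tk.
  exists (2%:R^-1 * (z + z * sgnz z')).
  by rewrite hz (linearZZ (pi (hti l t0))) (pi_htilde_translate _ Tk hz') [z *:
    (sgnz _ *: _)]scalerA -scalerDl [LHS]scalerA.
by rewrite hz (linearZZ (pi (hti j t0))) (pi_htilde_translate _ Tk hk) scaleN1r
  scalerN subrr scaler0.
Qed.

Lemma projection_pi (s : seq 'I_r) h w : TT h -> (forall j, commute h (hti j t0)) ->
  projection s (twist h w) = twist h (projection s w).
Proof.
move=> Th hh; elim: s => //= j s ->; have Tj := Ttilde_htilde j t0n.
have -> : pi (hti j t0) (twist h (projection s w)) =
  twist h (pi (hti j t0) (projection s w)).
  by rewrite /twist (linearZZ (pi (hti j t0))) -!piM // hh.
by rewrite /twist (linearZZ (pi h)) (linearD (pi h)) -scalerDr !scalerA mulrC.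
Qed.

Local Notation P := (projection (enum 'I_r)).

Lemma not_ZT0tilde k : TT k -> ~ ZT0 k -> exists j, comz true k (hti j t0).
Proof.
move=> Tk nZ; apply: contrapT => nex; apply: nZ; apply/ZT0tildeP; split=> // j.
have [[] hz] := comz_Ttilde j Tk; first by case: nex; exists j.
exact/comz_commute.
Qed.

Lemma projection_outside k v : TT k -> ~ ZT0 k -> P (twist k (f v)) = 0.
Proof.
move=> Tk /(not_ZT0tilde Tk) [j hj].
by apply: projection_anticommute hj _ => //; rewrite mem_enum.
Qed.

Lemma projection_ZT0tilde h w : ZT0 h -> P (twist h w) = twist h (P w).
Proof. by move=> /ZT0tildeP [Th hh]; exact: projection_pi. Qed.

Lemma twist1 w : twist 1%g w = w.
Proof. by rewrite twist_T0tilde ?pi1 //; exact: (zpow_T0tilde false). Qed.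

Lemma projection_f v : P (f v) = f v.
Proof.
rewrite -{1}[f v]twist1 projection_ZT0tilde;
  last exact: ZT0tilde_T0tilde (zpow_T0tilde false).
rewrite twist1 -[f v in LHS]twist1 projection_commute ?twist1 //;
  first exact: Ttilde1.
by move=> j; exact/commute_sym/commute1.
Qed.

(** The translates of f V span W: those by Z(T~) T0~ stay in f V and the projection fixes them,
    while it kills the others. *)
Lemma projection_range w : exists v, P w = f v.
Proof.
pose S := [set w : W | forall g, TT g -> exists v, P (twist g w) = f v].
have [v v0] := v0_ex.
have : S w; last by move/(_ _ Ttilde1); rewrite twist1.
apply: (@stable_subspace_full S) (f_neq0 v0) _.
- by move=> g _; exists 0; rewrite twist0 projection0 linear0.
- move=> x y Sx Sy g Tg; have [a ha] := Sx g Tg; have [b hb] := Sy g Tg.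
  by exists (a + b); rewrite -[x]scale1r twist_linear projection_linear ha hb
    linearD !scale1r.
- move=> k x Sx g Tg; have [a ha] := Sx g Tg; exists (k *: a).
  by rewrite -[k *: x]addr0 twist_linear projection_linear ha twist0 projection0
    addr0 linearZZ.
- move=> g x Tg Sx h Th; rewrite twistE //.
  have [a ha] := Sx _ (TtildeM Th Tg); exists (chi (pr g) *: a).
  rewrite -[_ *: twist g x]addr0 twist_linear projection_linear twist0 projection0
    addr0.
  by rewrite -twistM // ha linearZZ.
- move=> g Tg; case: (pselect (ZT0 g)) => Zg.
    by exists (taueta g v);
      rewrite projection_ZT0tilde // projection_f twist_ZT0tilde.
  by exists 0; rewrite projection_outside // linear0.
Qed.

(** [p] is the projection read in V, and [J] is its Frobenius transform, sending w to x |-> p (x w)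
    for the twisted action. Surjectivity uses that Z(T~) T0~ has finite index, cosets being labelled
    by vectors of signs. *)
Lemma isotypic_iso_i_twist : iso_i abs2 varpi Phi X pr zeta xt Delta eta tau chi pi.
Proof.
have [p hp] := choice projection_range.
have p_linear (k : R[i]) w w' : p (k *: w + w') = k *: p w + p w'.
  by apply: finj; rewrite linearP -!hp projection_linear.
have p0 : p 0 = 0 by apply: finj; rewrite -hp projection0 linear0.
have pf v : p (f v) = v by apply: finj; rewrite -hp projection_f.
have pZ h w : ZT0 h -> p (twist h w) = taueta h (p w).
  by move=> Zh; apply: finj; rewrite -hp projection_ZT0tilde // hp twist_ZT0tilde.
have pout k v : TT k -> ~ ZT0 k -> p (twist k (f v)) = 0.
  by move=> Tk nZ; apply: finj; rewrite -hp projection_outside // linear0.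
pose J w : Gt -> V := fun x => if pselect (TT x) then p (twist x w) else 0.
have JE w x : TT x -> J w x = p (twist x w) by rewrite /J; case: pselect.
have J0 w x : ~ TT x -> J w x = 0 by rewrite /J; case: pselect.
have Jlin : linear J.
  move=> k w w'; apply: funext => x; rewrite /GRing.add /GRing.scale /=.
  case: (pselect (TT x)) => Tx; last by rewrite !J0 // scaler0 addr0.
  by rewrite !JE // twist_linear p_linear.
pose Jl : {linear W -> (Gt ->
  V)} := HB.pack J (GRing.isLinear.Build _ _ _ _ J Jlin).
exists Jl; split.
- move=> w w' e; apply/eqP; rewrite -subr_eq0; apply/eqP; apply: contrapT => nz.
  (* The kernel of [J]; were it nonzero, it would contain f v, but the section attached to f v has
     value v at 1. *)
  pose S := [set u : W | forall x, TT x -> p (twist x u) = 0].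
  have [v v0] := v0_ex.
  have : S (f v); last by move/(_ _ Ttilde1); rewrite twist1 pf; exact: v0.
  apply: (@stable_subspace_full S) nz _.
  + by move=> x _; rewrite twist0 p0.
  + by move=> a b Sa Sb x Tx;
    rewrite -[a]scale1r twist_linear p_linear Sa // Sb // scaler0 addr0.
  + by move=> k a Sa x Tx;
    rewrite -[k *: a]addr0 twist_linear p_linear Sa // twist0 p0 scaler0 addr0.
  + move=> g a Tg Sa x Tx;
    rewrite twistE // -[_ *: twist g a]addr0 twist_linear p_linear.
    by rewrite twist0 p0 addr0 -twistM // Sa ?scaler0 //; exact: TtildeM.
  + move=> x Tx; have := congr1 (fun F : Gt -> V => F x) e; rewrite /= !JE // => ex.
    rewrite addrC -scaleN1r twist_linear p_linear scaleN1r.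
    by rewrite ex addrC subrr.
- apply/seteqP; split=> [_ [w _ <-]|phi [phi0 phiH phiU]].
    split=> [x nTx|h x Zh Tx|]; first exact: J0.
      have Th := ZT0tilde_Ttilde Zh; have Thx := TtildeM Th Tx.
      by rewrite /= !JE // twistM // pZ.
    have [U1 hU1 h1] := hpi_smooth w.
    have [U2 hU2 h2] := Ttilde_small_TRtilde.
    exists (U1 `&` U2); first exact: filterI.
    move=> g x [Ug1 Ug2] Tg Tx; have [_ T0g] := h2 g Ug2 Tg.
    rewrite /= !JE //; last exact: TtildeM.
    by rewrite twistM // [twist g w]twist_T0tilde // h1.
  (* The signs of the commutators of k with the elements h~_j(t0); by [parZ] they determine the
     coset of k. *)
  pose par k (s : {ffun 'I_r -> bool}) := forall j, comz (s j) k (hti j t0).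
  have par_ex k : TT k -> exists s : {ffun 'I_r -> bool}, par k s.
    move=> Tk; have [s hs] := choice (fun j => comz_Ttilde j Tk).
    by exists [ffun j => s j] => j; rewrite ffunE.
  have comzV z k j : comz z k (hti j t0) -> comz z (k^-1)%g (hti j t0).
    rewrite /comz => hz; apply: (mulgI k);
      rewrite mulVKg mulgA -zpow_central -mulgA.
    rewrite [(k * _)%g in RHS]mulgA hz -[(zpow z * _ * _)%g]mulgA mulgK.
    by rewrite mulgA zpow_sqr mul1g.
  have parZ k k' (s s' : {ffun 'I_r -> bool}) : TT k -> TT k' -> par k s ->
    par k' s' -> ZT0 (k * k'^-1)%g <-> s = s'.
    move=> Tk Tk' hs hs'; have hc j : comz (s j (+) s' j) (k * k'^-1)%g (hti j t0).
      by apply: comzMl => //; exact: comzV.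
    split=> [/ZT0tildeP [_ H]|e].
      apply/ffunP => j; have := comz_unique (hc j) (iffRL (comz_commute _ _) (H j)).
      by case: (s j) (s' j) => -[].
    apply/ZT0tildeP; split; first by apply: TtildeM => //; exact: TtildeV.
    by move=> j; apply/comz_commute; have := hc j; rewrite e addbb.
  (* Sign vectors that do not occur get the representative 1 and are filtered out of the sum
     defining [w]. *)
  have rep_ex (s : {ffun 'I_r -> bool}) : exists k, TT k /\ forall k', TT k' ->
    par k' s -> par k s.
    case: (pselect (exists2 k, TT k & par k s)) => [[k Tk hk]|nex].
      by exists k.
    exists 1%g; split; first exact: Ttilde1.
    by move=> k' Tk' hk'; case: nex; exists k'.
  have [rep hrep] := choice rep_ex.
  have Trep e : TT (rep e) by case: (hrep e).
  (* A section is determined by its values at the coset representatives; each summand realizes it on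
     one coset and vanishes on the others. *)
  pose w := \sum_(s : {ffun 'I_r ->
    bool} | `[< par (rep s) s >]) twist ((rep s)^-1)%g (f (phi (rep s))).
  exists w => //; apply: funext => x.
  case: (pselect (TT x)) => Tx; last by rewrite /= J0 // phi0.
  have [s hs] := par_ex x Tx.
  have hreps : par (rep s) s by case: (hrep s) => _ /(_ x Tx hs).
  have psum (I : Type) (l : seq I) (Q : pred I) (u : I -> W) :
      p (twist x (\sum_(i <- l | Q i) u i)) = \sum_(i <- l | Q i) p (twist x (u i)).
    elim/big_rec2: _ => [|i a b _ <-]; first by rewrite twist0 p0.
    by rewrite -[u i]scale1r twist_linear p_linear !scale1r.
  rewrite /= JE // psum (bigD1 s) /=; last exact/asboolP.
  rewrite big1 => [|s' /andP [/asboolP hs' /eqP ss']].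
    have Zx := iffRL (parZ _ _ s s Tx (Trep s) hs hreps) erefl.
    by rewrite addr0 -twistM ?pZ ?pf -?phiH ?mulgVK //; exact: TtildeV.
  rewrite -twistM //; last exact: TtildeV.
  apply: pout; first by apply: TtildeM => //; exact: TtildeV.
  by move=> /(iffLR (parZ _ _ s s' Tx (Trep s') hs hs')) e; apply: ss'.
- move=> g w Tg; apply: funext => x /=.
  case: (pselect (TT x)) => Tx; last first.
    rewrite !J0 ?scaler0 // => Txg; apply: Tx; rewrite -(mulgK g x).
    by apply: TtildeM => //; exact: TtildeV.
  rewrite !JE //; last exact: TtildeM.
  rewrite twistM // [pi g w]twistE // -[_ *: twist g w]addr0 twist_linear p_linear.
  by rewrite twist0 p0 addr0.
Qed.

End Twist.

Lemma embedding_iso_i : exists2 chi : M -> R[i], is_unramified abs2 Phi X chi &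
  iso_i abs2 varpi Phi X pr zeta xt Delta eta tau chi pi.
Proof.
have [chi hchi chiE] := central_character_extension.
by exists chi => //; exact: isotypic_iso_i_twist.
Qed.

End Embedding.
Lemma isotypic_iff_iso_i :
  (exists2 w : W, isotypic_subspace T0t tau pi w & w <> 0) <->
  (exists2 chi : M -> R[i], is_unramified abs2 Phi X chi &
     iso_i abs2 varpi Phi X pr zeta xt Delta eta tau chi pi).
Proof.
split=> [[w [n [f [v [finj fequiv ew]]]] w0]|[chi hchi]];
  last exact: iso_i_isotypic.
(* A nonzero isotypic vector needs at least one summand, and any summand provides an embedding of
   tau. *)
case: n f v finj fequiv ew => [|n] f v finj fequiv ew.
  by case: w0; rewrite ew big_ord0.
apply: (@embedding_iso_i (f ord0)) => [|q u]; first exact: finj.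
exact: fequiv.
Qed.

End Representations.
End Unramified.
End Cover.

Theorem proposition4p27
  (R : realType)
  (Q2 : fieldType) (abs2 : Q2 -> R) (hQ2 : is_Q2 abs2)
  (F : fieldExtType Q2) (varpi : F) (hvarpi : is_uniformizer abs2 varpi)
  (r : nat) (hr : (2 <= r)%N)
  (Phi : seq 'rV[R]_r) (hPhi : is_root_system Phi)
  (hirr : irreducible_roots Phi) (hlaced : simply_laced Phi)
  (Delta : 'I_r -> 'rV[R]_r) (hDelta : is_base Phi Delta)
  (N : nat) (wt : 'I_N.+1 -> 'rV[R]_r) (c : 'rV[R]_r -> 'rV[R]_r -> int)
  (X : 'rV[R]_r -> 'M[F]_N.+1) (hX : is_chevalley_rep Phi wt c X)
  (Gt : topologicalGroupType) (pr : Gt -> 'M[F]_N.+1) (zeta : Gt)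
  (xt : 'rV[R]_r -> F -> Gt)
  (hGt : is_metaplectic_cover abs2 varpi Phi c X pr zeta xt)
  (eta : Gt -> R[i]) (heta : is_eta varpi Phi zeta xt Delta eta)
  (V : lmodType R[i]) (tau : Gt -> {linear V -> V})
  (htau : is_pseudo_spherical abs2 Phi X pr zeta xt Delta tau)
  (W : lmodType R[i]) (pi : Gt -> {linear W -> W})
  (hpi_smooth : is_smooth (Ttilde Phi X pr) pi)
  (hpi_irr : is_irreducible (Ttilde Phi X pr) pi) :
  (exists2 w : W,
     isotypic_subspace (T0tilde abs2 Phi X pr) tau pi w & w <> 0)
  <->
  (exists2 chi : 'M[F]_N.+1 -> R[i],
     is_unramified abs2 Phi X chi
     & iso_i abs2 varpi Phi X pr zeta xt Delta eta tau chi pi).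
Proof.
have [t0 [ut0 ht0 hvt0]] := 
  unramified_hsym hQ2 hvarpi hr hPhi hirr hlaced hDelta hX hGt.
exact: (isotypic_iff_iso_i hQ2 hvarpi hr hPhi hirr hlaced hDelta hX hGt ut0 ht0 hvt0
  heta htau hpi_smooth hpi_irr).
Qed.
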